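(* Let $\lambda=\lambda_n>0$ satisfy $\lim_{n\to\infty}\mathbb{P}\left(\lambda\ge 2\sqrt{n}\,\frac{\|M_X\epsilon\|_{\infty}}{\|M_X\epsilon\|_2}\right)=1$, and suppose that $p\lambda\|X\|_{\infty}\sqrt{n}=o_P(1)$ and $p\max\left(\lambda,\sqrt{\|X\|_{\infty}}\right)=o_P(1)$. Let $(\widehat\beta,\widehat\alpha)$ be a minimizer $$(\widehat{\beta},\widehat{\alpha})\in \arg\min_{b\in \mathbb{R}^K,\ a\in \mathbb{R}^n}\ \frac{1}{\sqrt{n}} \|y-Xb-a\|_2 +\frac{\lambda}{n} \|a\|_1 .$$ Then $$\sqrt{n}(\widehat{\beta}-\beta) \xrightarrow{d}\mathcal{N}(0,\sigma^2 \Sigma^{-1}).$$ Moreover, $\widehat{\sigma}^2=\frac{1}{n}\sum_{i=1}^n (y_i-x_i^{\top}\widehat{\beta}-\widehat{\alpha}_i)^2$ and $\widehat{\Sigma}=\frac{1}{n}\sum_{i=1}^n x_i x_i^{\top}$ are consistent estimators (i.e. converge in probability) of, respectively, $\sigma^2$ and $\Sigma$.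
   Context: Model. $K\ge 1$, $\beta\in\mathbb{R}^K$ and $\sigma^2\in(0,\infty)$ are fixed. For each sample size $n$ one observes i.i.d. $(y_i,x_i)$, $i=1,\dots,n$, with $y_i$ scalar and $x_i\in\mathbb{R}^K$, satisfying $y_i=x_i^\top\beta+\alpha_i+\epsilon_i$. The pairs $(x_i,\epsilon_i)$ are i.i.d. with a joint law that does not depend on $n$, $\Sigma=\mathbb{E}[x_ix_i^\top]$ is (finite and) positive definite, $\mathbb{E}[x_i\epsilon_i]=0$, $\mathbb{E}[\epsilon_i]=0$, and $\mathbb{E}[\epsilon_i^2\mid x_i]=\sigma^2$. The scalar random variable $\alpha_i$ (nonzero only for outliers) has unrestricted dependence with $x_i$ and $\epsilon_i$, its law may depend on $n$, and $p=p_n=\mathbb{P}(\alpha_i\neq 0)\in[0,1/2)$. Asymptotics are as $n\to\infty$ with $p=p_n\to 0$. Notation. $y=(y_1,\dots,y_n)^\top$, $\alpha=(\alpha_1,\dots,\alpha_n)^\top$, $\epsilon=(\epsilon_1,\dots,\epsilon_n)^\top$, $X=(x_1,\dots,x_n)^\top$ (an $n\times K$ matrix). $P_X$ is the orthogonal projector onto the column space of $X$ and $M_X=I_n-P_X$. For a vector or matrix, $\|\cdot\|_1,\|\cdot\|_2,\|\cdot\|_\infty$ are the entrywise $\ell_1$, $\ell_2$ and sup norms. *)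

(* Defs.v *)
From HB Require Import structures.
From mathcomp Require Import all_boot all_order all_algebra.
From mathcomp Require Import all_classical all_reals all_analysis.
From mathcomp Require Import measurable_realfun.

Set Implicit Arguments.
Unset Strict Implicit.
Unset Printing Implicit Defensive.

Import Order.TTheory GRing.Theory Num.Theory.
Import numFieldNormedType.Exports.

Local Open Scope classical_set_scope.
Local Open Scope ereal_scope.
Local Open Scope ring_scope.

(* Matrices (in particular vectors of R^n) carry the product sigma-algebra,
   i.e. the one generated by the entries, as the library does for tuples. *)
Definition mx_cylinders (R : realType) (m n : nat) : set (set 'M[R]_(m, n)) :=
  [set A | exists i j (B : set R),
     measurable B /\ A = (fun M : 'M[R]_(m, n) => M i j) @^-1` B].

Fact mx_display : measure_display.
Proof. exact: default_measure_display. Qed.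

HB.instance Definition _ (R : realType) (m n : nat) :=
  @isMeasurable.Build mx_display 'M[R]_(m, n)
    <<s @mx_cylinders R m n >>
    (@sigma_algebra0 _ setT (@mx_cylinders R m n))
    (@sigma_algebraC _ (@mx_cylinders R m n))
    (@sigma_algebra_bigcup _ setT (@mx_cylinders R m n)).

Section MeasurableMatrix.
Context d (T : measurableType d) (R : realType) (m n : nat).

Lemma measurable_entry (i : 'I_m) (j : 'I_n) :
  measurable_fun [set: 'M[R]_(m, n)] (fun M : 'M[R]_(m, n) => M i j).
Proof.
by move=> _ B mB; rewrite setTI; apply: sub_sigma_algebra; exists i, j, B.
Qed.

Lemma measurable_fun_mxP (f : T -> 'M[R]_(m, n)) :
  (forall i j, measurable_fun setT (fun w => f w i j)) ->
  measurable_fun setT f.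
Proof.
move=> mf; apply: (@measurability _ _ _ _ _ _ (@mx_cylinders R m n)) => //.
move=> _ [_ [i [j [B [mB ->]]]] <-].
exact: (mf i j measurableT B mB).
Qed.

End MeasurableMatrix.

Section GaussianVector.
Context (R : realType).

Definition cons_cv K (z : measurableTypeR R * 'cV[R]_K) : 'cV[R]_K.+1 :=
  col_mx (const_mx z.1 : 'cV_1) z.2.

Fact measurable_cons_cv K : measurable_fun setT (@cons_cv K).
Proof.
apply: measurable_fun_mxP => i j; rewrite /cons_cv.
case: (@split_ordP 1 K i) => k ->.
  under eq_fun do rewrite (@col_mxEu R 1 K 1) mxE.
  exact: measurable_fst.
under eq_fun do rewrite (@col_mxEd R 1 K 1).
exact: (measurableT_comp (measurable_entry k j) measurable_snd).
Qed.

HB.instance Definition _ K :=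
  isMeasurableFun.Build _ _ _ _ (@cons_cv K) (@measurable_cons_cv K).

(* law of K independent N(0,1) coordinates *)
Fixpoint std_normal_cv (K : nat) : probability 'cV[R]_K R :=
  match K return probability 'cV[R]_K R with
  | 0 => \d_(0 : 'cV[R]_0)
  | K'.+1 => distribution (normal_prob 0 1 \x std_normal_cv K')%E (@cons_cv K')
  end.

Definition affine_cv K (m : 'cV[R]_K) (A : 'M[R]_K) (g : 'cV[R]_K) : 'cV[R]_K :=
  m + A *m g.

Fact measurable_affine_cv K m A : measurable_fun setT (@affine_cv K m A).
Proof.
apply: measurable_fun_mxP => i j; rewrite /affine_cv.
under eq_fun do rewrite 2!mxE.
apply: measurable_funD => //.
apply: measurable_sum => k; rewrite /=.
exact: measurable_funM (measurable_cst _) (measurable_entry k j).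
Qed.

HB.instance Definition _ K m A :=
  isMeasurableFun.Build _ _ _ _ (@affine_cv K m A) (@measurable_affine_cv K m A).

(* N(m, V) is the law of m + A g, where g is standard normal and A is a square
   root of the covariance matrix: A A^T = V. The law does not depend on which A
   is picked; one exists iff V is symmetric positive semidefinite, the only case
   in which mvnormal is meaningful. *)
Definition mvnormal K (m : 'cV[R]_K) (V : 'M[R]_K) : probability 'cV[R]_K R :=
  distribution (std_normal_cv K)
    (affine_cv m (xget 0 [set A : 'M[R]_K | A *m A^T = V])).

End GaussianVector.

Section Probability.
Context (R : realType).

Definition mutually_independent d d' (T : measurableType d)
    (T' : measurableType d') (P : probability T R) n (Z : 'I_n -> T -> T') :=
  forall B : 'I_n -> set T', (forall i, measurable (B i)) ->
    P (\bigcap_(i in [set: 'I_n]) (Z i @^-1` B i)) =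
    (\prod_(i < n) P (Z i @^-1` B i))%E.

Definition identically_distributed d d' (T : measurableType d)
    (T' : measurableType d') (P : probability T R) n (Z : 'I_n -> T -> T') :=
  forall i j (B : set T'), measurable B -> P (Z i @^-1` B) = P (Z j @^-1` B).

Definition iid d d' (T : measurableType d) (T' : measurableType d')
    (P : probability T R) n (Z : 'I_n -> T -> T') :=
  mutually_independent P Z /\ identically_distributed P Z.

Definition has_law d d' (T : measurableType d) (T' : measurableType d')
    (P : probability T R) (Z : T -> T') (Q : probability T' R) :=
  forall B : set T', measurable B -> P (Z @^-1` B) = Q B.

(* g \o X is a version of the conditional expectation of Y given X. *)
Definition is_cond_expectation d d' (T : measurableType d)
    (T' : measurableType d') (P : probability T R)
    (Y : T -> R) (X : T -> T') (g : T' -> R) :=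
  [/\ P.-integrable setT (fun w => (Y w)%:E),
      measurable_fun setT g,
      P.-integrable setT (fun w => (g (X w))%:E) &
      forall B : set T', measurable B ->
        (\int[P]_(w in X @^-1` B) (Y w)%:E =
         \int[P]_(w in X @^-1` B) (g (X w))%:E)%E].

(* In both modes of convergence the n-th variable lives on its own space. *)
Definition cvg_in_probability (d : nat -> measure_display)
    (T : forall n, measurableType (d n)) (P : forall n, probability (T n) R)
    (V : normedModType R) (Z : forall n, T n -> V) (c : V) :=
  forall e : R, 0 < e ->
    P n [set w | e <= `|Z n w - c|] @[n --> \oo] --> 0%E.

Definition cvg_in_distribution (d : nat -> measure_display)
    (T : forall n, measurableType (d n)) (P : forall n, probability (T n) R)
    K (Z : forall n, T n -> 'cV[R]_K) (Q : probability 'cV[R]_K R) :=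
  forall f : 'cV[R]_K -> R, continuous f ->
    (exists M : R, forall v, `|f v| <= M) ->
    'E_(P n)[fun w => f (Z n w)] @[n --> \oo] --> 'E_Q[f].

End Probability.

Section LinearAlgebra.
Context (R : realType).

Definition l1norm n (v : 'cV[R]_n) : R := \sum_(i < n) `|v i 0|.

Definition l2norm n (v : 'cV[R]_n) : R := Num.sqrt (\sum_(i < n) v i 0 ^+ 2).

Definition posdefmx K (A : 'M[R]_K) :=
  A^T = A /\ forall v : 'cV[R]_K, v != 0 -> 0 < (v^T *m A *m v) 0 0.

(* Orthogonal projector onto the column space of X: the projection onto the row
   space of X^T along its orthogonal complement kermx X = {u | u *m X = 0},
   transposed so as to act on column vectors. X may be rank deficient. *)
Definition col_proj n K (X : 'M[R]_(n, K)) : 'M[R]_n :=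
  (proj_mx <<X^T>>%MS (kermx X))^T.

Definition col_annihilator n K (X : 'M[R]_(n, K)) : 'M[R]_n :=
  1%:M - col_proj X.

Lemma col_proj_cap n K (X : 'M[R]_(n, K)) : (<<X^T>> :&: kermx X = 0)%MS.
Proof.
apply/eqP; rewrite -submx0; apply/rV_subP => u.
rewrite sub_capmx genmxE => /andP[/submxP[a ua] /sub_kermxP uX].
have uu : u *m u^T = 0 by rewrite {2}ua trmx_mul trmxK mulmxA uX mul0mx.
rewrite submx0; apply/eqP/rowP => i; rewrite mxE.
have /eqP : \sum_j u 0 j ^+ 2 = 0.
  transitivity ((u *m u^T) 0 0); last by rewrite uu mxE.
  by rewrite mxE; apply: eq_bigr => j _; rewrite mxE expr2.
rewrite psumr_eq0; last by move=> j _; exact: sqr_ge0.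
by move=> /allP/(_ i (mem_index_enum _))/=; rewrite sqrf_eq0 => /eqP.
Qed.

Lemma col_proj_id n K (X : 'M[R]_(n, K)) : col_proj X *m X = X.
Proof.
apply: trmx_inj; rewrite trmx_mul trmxK proj_mx_id ?genmxE//.
exact: col_proj_cap.
Qed.

Lemma col_proj_orth n K (X : 'M[R]_(n, K)) (u : 'cV[R]_n) :
  X^T *m u = 0 -> col_proj X *m u = 0.
Proof.
move=> Xu; apply: trmx_inj; rewrite trmx_mul trmxK trmx0 proj_mx_0//.
  exact: col_proj_cap.
by apply/sub_kermxP; rewrite -[X]trmxK -trmx_mul Xu trmx0.
Qed.

End LinearAlgebra.

Section Model.
Context (R : realType).

Definition design_mx n K (x : 'I_n -> 'cV[R]_K) : 'M[R]_(n, K) :=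
  \matrix_(i, j) x i j 0.

Definition sqrt_lasso_obj n K (lam : R) (y : 'cV[R]_n) (X : 'M[R]_(n, K))
    (b : 'cV[R]_K) (a : 'cV[R]_n) : R :=
  (Num.sqrt n%:R)^-1 * l2norm (y - X *m b - a) + lam / n%:R * l1norm a.

End Model.

(* Main.v *)
(* The square-root lasso objective is convex, so its minimizer satisfies the normal
   equations X^T (y - X bhat - ahat) = 0; hence, with S = X^T X / n and
   W = X^T eps / sqrt n,
     S sqrt n (bhat - beta) = W - X^T (ahat - alpha) / sqrt n,
   and the last term is at most |X| ||ahat - alpha||_1 / sqrt n. Let s be the number of
   outliers. The choice of lam puts ahat - alpha in the cone where the mass off the
   support of alpha is at most three times the mass on it. On this cone M_X does not
   contract much as soon as s |X|^2 / n is small, so the lasso argument yields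
   ||ahat - alpha||_1 = O(s lam) and an error of order s lam^2 / n for the residual
   norm. By Markov's inequality s = O_P(n p), so s lam |X| / sqrt n tends to 0 in
   probability; since s is an integer, lam >= 2 and |X| is bounded below, its square
   dominates both s |X|^2 / n and s lam^2 / n. Therefore
   sqrt n (bhat - beta) = Sigma^-1 W + o_P(1).
   The limit law of Sigma^-1 W is obtained from real characteristic functions
   E cos (t . Z + s): for a sum of independent terms they satisfy a linear recursion,
   and they determine convergence in distribution of a tight sequence, because every
   bounded continuous function is approximated on a cube by a trigonometric polynomial
   (Bernstein polynomials in the variables (1 + sin (c v_k)) / 2). *)
Require Import Defs.
From HB Require Import structures.
From mathcomp Require Import all_boot all_order all_algebra.
From mathcomp Require Import all_classical all_reals all_analysis.
From mathcomp Require Import measurable_realfun ring lra.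

Set Implicit Arguments.
Unset Strict Implicit.
Unset Printing Implicit Defensive.

Import Order.TTheory GRing.Theory Num.Theory.
Import numFieldNormedType.Exports.

Local Open Scope classical_set_scope.
Local Open Scope ereal_scope.
Local Open Scope ring_scope.

(** * Expectations of real random variables *)

Notation mean P f := (\int[P]_w (f%R w)).
Notation integrable_fun P f := (P.-integrable setT (EFin \o f%R)).

Section Mean.
Context d (T : measurableType d) (R : realType) {P : probability T R}.
Implicit Types (f g : T -> R) (A : set T).

Lemma integrable_funM_bounded f g M : measurable_fun setT f ->
  (forall w, `|f w| <= M) -> integrable_fun P g ->
  integrable_fun P (fun w => f w * g w).
Proof.
move=> mf fM ig.
have mg : measurable_fun setT g by apply/measurable_EFinP; exact: measurable_int ig.
have iMg : P.-integrable setT (fun w => (M%:E * (g w)%:E)%E).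
  exact: integrableZl.
apply: (le_integrable _ _ _ iMg) => //.
  by apply/measurable_EFinP; exact: measurable_funM.
move=> w _ /=; rewrite lee_fin !normrM ler_wpM2r//.
exact: le_trans (fM w) (ler_norm _).
Qed.

Lemma integrable_cst_fun (c : R) : integrable_fun P (fun=> c).
Proof. by apply: finite_measure_integrable_cst. Qed.

Lemma integrable_bounded f M : measurable_fun setT f ->
  (forall w, `|f w| <= M) -> integrable_fun P f.
Proof.
move=> mf fM; have := integrable_funM_bounded mf fM (integrable_cst_fun 1).
by congr (_.-integrable _ _); apply/funext => w /=; rewrite mulr1.
Qed.

Lemma integrable_measurable f : integrable_fun P f -> measurable_fun setT f.
Proof. by move=> /measurable_int/measurable_EFinP. Qed.

Lemma integrable_funD f g : integrable_fun P f -> integrable_fun P g ->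
  integrable_fun P (fun w => f w + g w).
Proof. by move=> fi gi; have := integrableD measurableT fi gi. Qed.

Lemma integrable_funZ c f : integrable_fun P f ->
  integrable_fun P (fun w => c * f w).
Proof. by move=> fi; have := integrableZl measurableT c fi. Qed.

Lemma integrable_funB f g : integrable_fun P f -> integrable_fun P g ->
  integrable_fun P (fun w => f w - g w).
Proof. by move=> fi gi; have := integrableB measurableT fi gi. Qed.

Lemma integrable_fun_sum (I : Type) (s : seq I) (h : I -> T -> R) :
  (forall i, integrable_fun P (h i)) ->
  integrable_fun P (fun w => \sum_(i <- s) h i w).
Proof.
move=> ih; elim: s => [|i s IHs].
  rewrite (_ : (fun _ => _) = fun=> 0).
    exact: integrable_cst_fun.
  by apply/funext => w; rewrite big_nil.
have := integrable_funD (ih i) IHs.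
by congr (_.-integrable _ _); apply/funext => w /=; rewrite big_cons.
Qed.

Lemma integrable_fun_le f g : measurable_fun setT f ->
  (forall w, `|f w| <= g w) -> integrable_fun P g -> integrable_fun P f.
Proof.
move=> mf fg ig; apply: (le_integrable _ _ _ ig) => //.
  exact/measurable_EFinP.
by move=> w _ /=; rewrite lee_fin (le_trans (fg w))// ler_norm.
Qed.

Lemma integrable_fun_norm f : integrable_fun P f ->
  integrable_fun P (fun w => `|f w|).
Proof. exact: integrable_norm. Qed.

Lemma integral_mean f : integrable_fun P f ->
  (\int[P]_w (f w)%:E)%E = (mean P f)%:E.
Proof. by move=> fi; rewrite fineK//; exact: integrable_fin_num. Qed.

Lemma meanD f g : integrable_fun P f -> integrable_fun P g ->
  mean P (fun w => f w + g w) = mean P f + mean P g.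
Proof. by move=> fi gi; rewrite RintegralD. Qed.

Lemma meanB f g : integrable_fun P f -> integrable_fun P g ->
  mean P (fun w => f w - g w) = mean P f - mean P g.
Proof. by move=> fi gi; rewrite RintegralB. Qed.

Lemma meanZ c f : integrable_fun P f ->
  mean P (fun w => c * f w) = c * mean P f.
Proof. by move=> fi; rewrite RintegralZl. Qed.

Lemma mean_cst c : mean P (fun=> c) = c.
Proof.
by rewrite Rintegral_cst// [X in fine X](@probability_setT _ _ _ P)/= mulr1.
Qed.

Lemma eq_mean f g : f =1 g -> mean P f = mean P g.
Proof. by move=> fg; apply: eq_Rintegral => w _; rewrite fg. Qed.

Lemma mean_sum (I : Type) (s : seq I) (h : I -> T -> R) :
  (forall i, integrable_fun P (h i)) ->
  mean P (fun w => \sum_(i <- s) h i w) = \sum_(i <- s) mean P (h i).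
Proof.
move=> ih; elim: s => [|i s IHs].
  rewrite big_nil -[RHS](mean_cst 0).
  by apply: eq_mean => w; rewrite big_nil.
rewrite big_cons -IHs -meanD//; last exact: integrable_fun_sum.
by apply: eq_mean => w; rewrite big_cons.
Qed.

Lemma mean_le f g : integrable_fun P f -> integrable_fun P g ->
  (forall w, f w <= g w) -> mean P f <= mean P g.
Proof. by move=> fi gi fg; apply: le_Rintegral. Qed.

Lemma mean_ge0 f : (forall w, 0 <= f w) -> 0 <= mean P f.
Proof. by move=> f0; apply: Rintegral_ge0. Qed.

Lemma mean_norm_le f M : measurable_fun setT f -> (forall w, `|f w| <= M) ->
  `|mean P f| <= M.
Proof.
move=> mf fM; have fi := integrable_bounded mf fM.
apply: le_trans (le_normr_Rintegral _ fi) _ => //.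
rewrite -[leRHS]mean_cst; apply: mean_le => //.
  exact: integrable_norm.
exact: integrable_cst_fun.
Qed.

Lemma norm_mean_le f : integrable_fun P f ->
  `|mean P f| <= mean P (fun w => `|f w|).
Proof. by move=> fi; exact: le_normr_Rintegral. Qed.

Lemma mean_indic A : measurable A -> mean P (\1_A) = fine (P A).
Proof. by move=> mA; rewrite /Rintegral integral_indic// setIT. Qed.

Lemma norm_indic_le1 A w : `|\1_A w : R| <= 1.
Proof. by rewrite indicE normr_nat lern1 leq_b1. Qed.

Lemma integrable_indic_fun A : measurable A -> integrable_fun P (\1_A).
Proof.
move=> mA; apply: (integrable_bounded (M := 1%R)); last exact: norm_indic_le1.
exact: measurable_indic.
Qed.

Lemma mean_dominated_cvg (h : nat -> T -> R) f g :
  (forall n, measurable_fun setT (h n)) -> 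
  (forall w, h n w @[n --> \oo] --> f w) ->
  (forall n w, `|h n w| <= g w) -> integrable_fun P g ->
  integrable_fun P f /\ mean P (h n) @[n --> \oo] --> mean P f.
Proof.
move=> mh hf hg ig.
have mf : measurable_fun setT f by apply: (measurable_fun_cvg mh) => w _.
have [] := @dominated_convergence _ _ _ P setT measurableT
  (fun n w => (h n w)%:E) (fun w => (f w)%:E) (fun w => (g w)%:E).
- by move=> n; exact/measurable_EFinP.
- exact/measurable_EFinP.
- by apply: aeW => w _; apply: cvg_EFin; [exact: nearW|exact: hf].
- by [].
- by apply: aeW => w n _ /=; rewrite lee_fin.
move=> fi _ cv; split=> //.
have ih n : integrable_fun P (h n) by exact: integrable_fun_le ig.
apply/fine_cvg; rewrite -/(mean P f) -integral_mean//.
Qed.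

Lemma markov_mean f (e : R) : 0 < e -> integrable_fun P f -> (forall w, 0 <= f w) ->
  (P [set w | e <= f w]%R <= (mean P f / e)%:E)%E.
Proof.
move=> e0 fi f0; have mf := integrable_measurable fi.
have mA : measurable [set w | e <= f w].
  rewrite (_ : [set _ | _] = f @^-1` `[e, +oo[%classic).
    by rewrite -[X in measurable X]setTI; apply: mf.
  by apply/seteqP; split=> w /=; rewrite in_itv/= andbT.
rewrite -[leLHS]fineK ?fin_num_measure// lee_fin.
rewrite -mean_indic// ler_pdivlMr// mulrC -meanZ; last exact: integrable_indic_fun.
apply: mean_le => //; first exact/integrable_funZ/integrable_indic_fun.
move=> w; rewrite indicE; have [/set_mem/= wA|_] := boolP (w \in _).
  by rewrite mulr1.
by rewrite mulr0.
Qed.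

End Mean.

(** * Integrals of functions of a random element with a given law *)

Section ChangeOfVariables.
Context d d' (T : measurableType d) (T' : measurableType d') (R : realType).
Context (P : probability T R) (Q : probability T' R) (Z : T -> T').
Hypotheses (mZ : measurable_fun setT Z) (lawZ : has_law P Z Q).

Let Zrv : {RV P >-> T'} := HB.pack Z (isMeasurableFun.Build _ _ _ _ Z mZ).

Let eq_law A : measurable A -> A `<=` setT -> distribution P Zrv A = Q A.
Proof. by move=> mA _; exact: lawZ. Qed.

Lemma ge0_integral_law (f : T' -> \bar R) : measurable_fun setT f ->
  (forall y, 0 <= f y)%E -> (\int[P]_w f (Z w) = \int[Q]_z f z)%E.
Proof.
move=> mf f0; rewrite -(ge0_integral_distribution Zrv)//.
exact: eq_measure_integral.
Qed.

Lemma integrable_law (f : T' -> R) : integrable_fun Q f ->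
  integrable_fun P (f \o Z).
Proof.
move=> /integrableP[mf fi]; apply/integrableP; split.
  exact: (measurableT_comp mf mZ).
apply: le_lt_trans fi.
rewrite -(@ge0_integral_law (fun z => `|(f z)%:E|)%E)//.
by apply: measurableT_comp.
Qed.

Lemma mean_law (f : T' -> R) : integrable_fun Q f ->
  mean P (f \o Z) = mean Q f.
Proof.
move=> fi; congr fine.
rewrite -(@integral_distribution _ _ _ _ _ _ Zrv (EFin \o f)).
- exact: eq_measure_integral.
- exact: measurable_int fi.
- exact: integrable_law.
Qed.

End ChangeOfVariables.

(** * Independence *)

Section BoundedMeasurable.
Context d (T : measurableType d) (R : realType).

(** The sum counts the integers from 1 to [N] that do not exceed [u], so it is the integer part of
    [u]. It is the staircase used to approximate a bounded function. *)
Lemma sum_step_le1 N (u : R) : 0 <= u <= N%:R ->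
  `|\sum_(k < N) (k.+1%:R <= u)%R%:R - u| <= 1.
Proof.
elim: N u => [u|N IHN u /andP[u0 uN]].
  by move=> u0; rewrite big_ord0 ler_norml; lra.
rewrite big_ord_recr/=; have [uN'|Nu] := leP u N%:R.
  have -> : (N.+1%:R <= u) = false by apply/negbTE; rewrite -ltNge -natr1; lra.
  by rewrite addr0 IHN ?u0.
rewrite (eq_bigr (fun=> 1)) => [|i _].
  rewrite sumr_const card_ord ler_norml; move: uN; rewrite -natr1.
  by case: (_ <= u) => /=; lra.
by rewrite (le_trans _ (ltW Nu))// ler_nat.
Qed.

(** Cutting the range into equal steps shows that a bounded measurable function is a uniform limit
    of combinations of indicators. Identities between expectations then need checking on indicators
    only. *)
Lemma bounded_measurable_ind (S : (T -> R) -> Prop) (f : T -> R) (M : R) :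
  (forall A, measurable A -> S (\1_A)) ->
  (forall (a : R) g h, S g -> S h -> S (fun w => a * g w + h w)) ->
  (forall g : T -> R, measurable_fun setT g ->
     (forall e : R, 0 < e -> exists2 h, S h & forall w, `|g w - h w| <= e) ->
     S g) ->
  measurable_fun setT f -> (forall w, `|f w| <= M) -> S f.
Proof.
move=> S1 SD Scv mf fM0.
pose K := `|M| + 1; have K0 : 0 < K by rewrite ltr_wpDl.
have fK w : - K <= f w <= K.
  rewrite -ler_norml (le_trans (fM0 w))// (le_trans (ler_norm M))//.
  by rewrite /K lerDl.
have Scst c : S (fun=> c).
  have S0 : S (fun=> 0).
    rewrite (_ : (fun _ => _) = (\1_set0 : T -> R)); first exact: S1.
    by apply/funext => w; rewrite indicE in_set0.
  have := SD c _ _ (S1 setT measurableT) S0.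
  congr S; apply/funext => w; rewrite indicE in_setT addr0 mulr1//.
apply: Scv => // e e0.
(* [N] steps cut the range [[-K, K]] into pieces of height at most [e]; [u] below rescales this
   range to [[0, N]]. *)
pose N := (Num.truncn (2 * K / e)).+1.
have N0 : 0 < N%:R :> R by rewrite ltr0n.
have KN : 2 * K / N%:R <= e.
  rewrite ler_pdivrMr// [leRHS]mulrC -ler_pdivrMr// ltW//.
  by rewrite /N truncnS_gt.
pose u w := N%:R * (f w + K) / (2 * K).
pose A (k : nat) := [set w | (k.+1%:R <= u w)%R].
exists (fun w => \sum_(k < N) (2 * K / N%:R) * \1_(A k) w - K).
  have S2 n : S (fun w => \sum_(k < n) (2 * K / N%:R) * \1_(A k) w - K).
    elim: n => [|n IHn].
      have := Scst (- K); congr S; apply/funext => w.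
      by rewrite big_ord0 add0r.
    have mA : measurable (A n).
      rewrite (_ : A n = u @^-1` `[n.+1%:R, +oo[%classic).
        rewrite -[X in measurable X]setTI.
        apply: (_ : measurable_fun setT u) => //.
        by apply: measurable_funM => //; apply: measurable_funM => //; exact: measurable_funD.
      by apply/seteqP; split=> w /=; rewrite in_itv/= andbT.
    have := SD (2 * K / N%:R) _ _ (S1 _ mA) IHn.
    by congr S; apply/funext => w; rewrite big_ord_recr/=; ring.
  exact: S2.
move=> w.
have uN : 0 <= u w <= N%:R.
  have [fl fr] := andP (fK w); rewrite /u; apply/andP; split.
    by rewrite divr_ge0// ?mulr_ge0//; lra.
  by rewrite ler_pdivrMr; [rewrite ler_wpM2l//; lra|lra].
have := sum_step_le1 uN; rewrite -mulr_sumr.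
set s := \sum_(k < N) _; have -> : \sum_(k < N) \1_(A k) w = s :> R.
  apply: eq_bigr => k _; rewrite indicE; congr (_%:R); congr nat_of_bool.
  by apply/idP/idP => [/set_mem//|kw]; apply/mem_set.
move=> su; apply: le_trans KN.
have -> : f w - (2 * K / N%:R * s - K) = 2 * K / N%:R * (u w - s).
  by rewrite /u; field; rewrite !gt_eqF.
rewrite normrM ger0_norm; last by rewrite divr_ge0// ltW// mulr_gt0.
by rewrite distrC ler_piMr// divr_ge0// ltW// mulr_gt0.
Qed.

End BoundedMeasurable.

Section Independence.
Context d d' (T : measurableType d) (T' : measurableType d') (R : realType).
Context (P : probability T R).

(** Both sides are linear in [h] and continuous for uniform convergence. The lemma serves twice: for
    independence, with [G] the product of the other factors, and for conditional expectation, with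
    [G] the squared noise and [C] its constant conditional mean. *)
Lemma mean_factor (Z : T -> T') (G : T -> R) (C : R) :
  measurable_fun setT Z -> integrable_fun P G ->
  (forall B, measurable B ->
     mean P (fun w => \1_B (Z w) * G w) = mean P (fun w => \1_B (Z w)) * C) ->
  forall (h : T' -> R) (M : R), measurable_fun setT h -> (forall z, `|h z| <= M) ->
  mean P (fun w => h (Z w) * G w) = mean P (fun w => h (Z w)) * C.
Proof.
move=> mZ iG hB h M mh hM.
pose S (g : T' -> R) := [/\ measurable_fun setT g,
  exists M : R, forall z, `|g z| <= M &
  mean P (fun w => g (Z w) * G w) = mean P (fun w => g (Z w)) * C].
have ig (g : T' -> R) (M' : R) : measurable_fun setT g -> (forall z, `|g z| <= M') ->
    integrable_fun P (fun w => g (Z w)).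
  move=> mg gM; apply: (integrable_bounded _ (fun w => gM (Z w))).
  exact: measurableT_comp.
have igG (g : T' -> R) (M' : R) : measurable_fun setT g -> (forall z, `|g z| <= M') ->
    integrable_fun P (fun w => g (Z w) * G w).
  move=> mg gM; apply: (integrable_funM_bounded _ (fun w => gM (Z w))) => //.
  exact: measurableT_comp.
suff [] : S h by [].
apply: (bounded_measurable_ind (M := M)) mh hM => [A mA|a f g|f mf fe].
- split; [exact: measurable_indic| |exact: hB].
  by exists 1 => z; exact: norm_indic_le1.
- move=> [mf [Mf fM] Ef] [mg [Mg gM] Eg]; split.
  + by apply: measurable_funD => //; exact: measurable_funM.
  + exists (`|a| * Mf + Mg) => z; rewrite (le_trans (ler_normD _ _))//.
    by rewrite lerD// normrM ler_wpM2l.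
  + rewrite (eq_mean (g := fun w => a * (f (Z w) * G w) + g (Z w) * G w)); last first.
      by move=> w; ring.
    have [i1 i2] := (igG _ _ mf fM, igG _ _ mg gM).
    have [i3 i4] := (ig _ _ mf fM, ig _ _ mg gM).
    rewrite (meanD (integrable_funZ a i1) i2) (meanZ a i1) Ef Eg.
    by rewrite (meanD (integrable_funZ a i3) i4) (meanZ a i3) mulrDl mulrA.
- have [g [mg [Mg gM] _] fg] := fe 1 ltr01.
  have fM z : `|f z| <= 1 + Mg.
    rewrite -(subrK (g z) (f z)) (le_trans (ler_normD _ _))//.
    by rewrite lerD.
  split=> //; first by exists (1 + Mg).
  have iaG := integrable_fun_norm iG.
  apply/eqP; rewrite -subr_eq0 -normr_eq0; apply/eqP/le_anti.
  rewrite normr_ge0 andbT; apply/ler_addgt0Pr => e e0; rewrite add0r.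
  (* An error [e / c] on the function costs [e / c] times the mean of [|G|] on one side and times
     [|C|] on the other; the added 1 keeps [c] positive. *)
  pose c := mean P (fun w => `|G w|) + `|C| + 1.
  have c0 : 0 < c by rewrite ltr_wpDl// addr_ge0// mean_ge0.
  have [k [mk [Mk kM] Ek] fk] := fe (e / c) (divr_gt0 e0 c0).
  have -> : mean P (fun w => f (Z w) * G w) - mean P (fun w => f (Z w)) * C =
    mean P (fun w => (f (Z w) - k (Z w)) * G w) -
    mean P (fun w => f (Z w) - k (Z w)) * C.
    rewrite meanB ?(ig _ _ mk kM) ?(ig _ _ mf fM)//.
    rewrite (eq_mean (f := fun w => (f (Z w) - k (Z w)) * G w)
                     (g := fun w => f (Z w) * G w - k (Z w) * G w)).
      rewrite meanB ?(igG _ _ mk kM) ?(igG _ _ mf fM)// Ek; ring.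
    by move=> w; ring.
  have mfk : measurable_fun setT (fun z => f z - k z) by exact: measurable_funB.
  have b1 : `|mean P (fun w => (f (Z w) - k (Z w)) * G w)| <=
      e / c * mean P (fun w => `|G w|).
    have i1 := igG _ _ mfk fk.
    rewrite (le_trans (norm_mean_le i1))// -meanZ//.
    apply: mean_le; first exact: integrable_fun_norm.
      exact: integrable_funZ.
    by move=> w; rewrite normrM ler_wpM2r.
  have b2 : `|mean P (fun w => f (Z w) - k (Z w))| <= e / c.
    by apply: mean_norm_le => //; exact: measurableT_comp mfk mZ.
  rewrite (le_trans (ler_normB _ _))// normrM.
  rewrite (le_trans (lerD b1 (ler_wpM2r (normr_ge0 C) b2)))//.
  by rewrite -mulrDr mulrAC ler_pdivrMr// ler_wpM2l ?ltW// /c ltrDl.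
Qed.

Lemma prod_indic n (I : 'I_n -> set T) w :
  \prod_i (\1_(I i) w : R) = \1_(\bigcap_(i in [set: 'I_n]) I i) w.
Proof.
rewrite [RHS]indicE; have [/set_mem h|h] := boolP (w \in _).
  by rewrite big1// => i _; rewrite indicE mem_set//; exact: h.
have [i iw] : exists i, w \notin I i.
  apply: contrapT => k; case/negP: h; apply/mem_set => i _.
  by apply: contrapT => iw; apply: k; exists i; apply/negP => /set_mem.
by rewrite (bigD1 i)//= indicE (negbTE iw) mul0r.
Qed.

Lemma mean_prod_independent n (Z : 'I_n -> T -> T') (f : 'I_n -> T' -> R) (M : R) :
  (forall i, measurable_fun setT (Z i)) -> mutually_independent P Z ->
  (forall i, measurable_fun setT (f i)) -> (forall i z, `|f i z| <= M) ->
  mean P (fun w => \prod_i f i (Z i w)) = \prod_i mean P (fun w => f i (Z i w)).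
Proof.
move=> mZ indZ mf fM.
have ifZ (g : T' -> R) i (K : R) : measurable_fun setT g -> (forall z, `|g z| <= K) ->
    integrable_fun P (fun w => g (Z i w)).
  by move=> mg gM; apply: (integrable_bounded _ (fun w => gM (Z i w))); exact: measurableT_comp.
(* Induction on the number [m] of factors that may be arbitrary, the others being indicators. At
   [m = 0] this is the definition of independence, and each step frees one factor by
   [mean_factor]. *)
suff H m : (m <= n)%N -> forall g : 'I_n -> T' -> R,
    (forall i, measurable_fun setT (g i)) ->
    (exists K : R, forall i z, `|g i z| <= K) ->
    (forall i : 'I_n, (m <= i)%N -> exists2 B, measurable B & g i = \1_B) ->
    mean P (fun w => \prod_i g i (Z i w)) = \prod_i mean P (fun w => g i (Z i w)).
  apply: (H n) => //; first by exists M.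
  by move=> i; rewrite leqNgt ltn_ord.
elim: m => [_ g mg _ gi|m IHm mn g mg [K gK] gi].
  have /fin_all_exists2[B mB gB] : forall i, exists2 B, measurable B & g i = \1_B.
    by move=> i; exact: gi.
  pose E := \bigcap_(i in [set: 'I_n]) (Z i @^-1` B i).
  have mE i : measurable (Z i @^-1` B i).
    by rewrite -[X in measurable X]setTI; exact: mZ.
  rewrite (eq_mean (g := \1_E)); last first.
    by move=> w; rewrite -prod_indic; apply: eq_bigr => i _; rewrite gB.
  rewrite mean_indic; last by apply: fin_bigcap_measurable => //; exact: finite_finset.
  rewrite indZ// (eq_bigr (fun i => (mean P (fun w => g i (Z i w)))%:E)).
    rewrite (_ : (\prod_(i < n) _)%E =
      (\prod_i mean P (fun w => g i (Z i w)))%:E)//.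
    by elim/big_rec2: _ => // i y1 y2 _ ->.
  move=> i _; rewrite -[LHS]fineK ?fin_num_measure// -mean_indic//.
  by congr _%:E; apply: eq_mean => w; rewrite gB.
pose i0 := Ordinal mn.
pose G w := \prod_(i | i != i0) g i (Z i w).
have mG : measurable_fun setT G.
  rewrite (_ : G = fun w => \prod_i if i != i0 then g i (Z i w) else 1).
    apply: measurable_prod => i _; case: (i != i0); last exact: measurable_cst.
    exact: measurableT_comp.
  by apply/funext => w; rewrite /G big_mkcond.
have K1 i z : `|g i z| <= `|K| + 1.
  by rewrite (le_trans (gK i z))// (le_trans (ler_norm K))// lerDl.
have GM w : `|G w| <= \prod_(i | i != i0) (`|K| + 1).
  rewrite normr_prod; apply: ler_prod => i _.
  by rewrite normr_ge0 K1.
have iG : integrable_fun P G by exact: integrable_bounded mG GM.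
rewrite (bigD1 i0)//= (eq_mean (g := fun w => g i0 (Z i0 w) * G w)); last first.
  by move=> w; rewrite (bigD1 i0).
apply: (mean_factor _ iG _ (mg i0) (K1 i0)) => // B mB.
(* With an indicator in place of the freed factor, the induction hypothesis applies. *)
pose g' i := if i == i0 then \1_B else g i.
have g'0 : g' i0 = \1_B by rewrite /g' eqxx.
have g'N i : i != i0 -> g' i = g i by move=> /negbTE ii0; rewrite /g' ii0.
have := IHm (ltnW mn) g'.
rewrite (bigD1 i0)//= g'0 (eq_mean (g := fun w => \1_B (Z i0 w) * G w)); last first.
  move=> w; rewrite (bigD1 i0)//= g'0; congr (_ * _).
  by apply: eq_bigr => i ii0; rewrite g'N.
move=> ->.
- by congr (_ * _); apply: eq_bigr => i ii0; rewrite g'N.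
- move=> i; rewrite /g'; case: ifP => _ //; exact: measurable_indic.
- exists (`|K| + 1) => i z; rewrite /g'; case: ifP => _ //.
  by rewrite (le_trans (norm_indic_le1 R B z))// lerDr.
- move=> i mi; rewrite /g'; case: (eqVneq i i0) => [_|ii0]; first by exists B.
  apply: gi; rewrite ltn_neqAle mi andbT.
  by apply: contra ii0 => /eqP e; apply/eqP/val_inj.
Qed.

End Independence.

(** * Truncation and second moments of sums of independent terms *)

Section Truncation.
Context (R : realType).

Definition trunc (m u : R) : R := u * \1_(`[- m, m]%classic) u.

Lemma measurable_trunc m : measurable_fun setT (trunc m).
Proof.
by apply: measurable_funM; [exact: measurable_id|exact: measurable_indic].
Qed.

Lemma norm_trunc_le m u : `|trunc m u| <= `|u|.
Proof. by rewrite normrM ler_piMr// norm_indic_le1. Qed.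

Lemma trunc_id m u : `|u| <= m -> trunc m u = u.
Proof.
by move=> um; rewrite /trunc indicE mem_set ?mulr1//= in_itv/= -ler_norml.
Qed.

Lemma norm_trunc_bound m u : 0 <= m -> `|trunc m u| <= m.
Proof.
move=> m0; rewrite /trunc indicE; have [/set_mem/=|_] := boolP (u \in _).
  by rewrite in_itv/= mulr1 ler_norml.
by rewrite mulr0 normr0.
Qed.

Lemma trunc_near u : \forall m \near \oo, trunc m%:R u = u.
Proof.
near=> m; apply: trunc_id; near: m; exact: nbhs_infty_ger.
Unshelve. all: by end_near. Qed.

Lemma trunc_cvg u : trunc m%:R u @[m --> \oo] --> u.
Proof.
apply: cvg_near_cst; exact: trunc_near.
Qed.

End Truncation.

Section SecondMoment.
Context d d' (T : measurableType d) (T' : measurableType d') (R : realType).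
Context (P : probability T R) (Q : probability T' R) (n : nat).
Context (Z : 'I_n -> T -> T').
Hypotheses (mZ : forall i, measurable_fun setT (Z i)).
Hypotheses (indZ : mutually_independent P Z) (lawZ : forall i, has_law P (Z i) Q).

Lemma mean_mul_independent_bounded (i j : 'I_n) (f g : T' -> R) (M : R) :
  i != j -> measurable_fun setT f -> measurable_fun setT g ->
  (forall z, `|f z| <= M) -> (forall z, `|g z| <= M) ->
  mean P (fun w => f (Z i w) * g (Z j w)) =
  mean P (fun w => f (Z i w)) * mean P (fun w => g (Z j w)).
Proof.
move=> ij mf mg fM gM.
pose F k := if k == i then f else if k == j then g else cst 1.
have ji : (j == i) = false by rewrite eq_sym (negbTE ij).
have Fi : F i = f by rewrite /F eqxx.
have Fj : F j = g by rewrite /F ji eqxx.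
have Fk k : (k != i) && (k != j) -> F k = cst 1.
  by move=> /andP[/negbTE ki /negbTE kj]; rewrite /F ki kj.
have := @mean_prod_independent _ _ _ _ _ P n Z F (Num.max M 1) mZ indZ.
rewrite (bigD1 i)//= (bigD1 j) ?ji//= Fi Fj big1 ?mulr1.
  move=> <-.
  - apply: eq_mean => w; rewrite (bigD1 i)//= (bigD1 j) ?ji//= Fi Fj.
    by rewrite big1 ?mulr1// => k kij; rewrite Fk.
  - by move=> k; rewrite /F; case: (k == i) => //; case: (k == j).
  - move=> k z; rewrite /F le_max; case: (k == i); first by rewrite fM.
    by case: (k == j); rewrite ?gM//= normr1 lexx orbT.
move=> k kij; rewrite -[RHS](mean_cst (P := P) 1); apply: eq_mean => w.
by rewrite Fk.
Qed.

Lemma integrable_mul_sqr (f g : T -> R) :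
  measurable_fun setT f -> measurable_fun setT g ->
  integrable_fun P (fun w => f w ^+ 2) -> integrable_fun P (fun w => g w ^+ 2) ->
  integrable_fun P (fun w => f w * g w).
Proof.
move=> mf mg fi gi; apply: (integrable_fun_le _ _ (integrable_funD fi gi)).
  exact: measurable_funM.
move=> w /=; rewrite normrM -[f w ^+ 2]real_normK ?num_real//.
rewrite -[g w ^+ 2]real_normK ?num_real//.
by have := sqr_ge0 (`|f w| - `|g w|); nra.
Qed.

Lemma integrable_of_sqr (S : measurableType d') (Q' : probability S R) (f : S -> R) :
  measurable_fun setT f ->
  integrable_fun Q' (fun w => f w ^+ 2) -> integrable_fun Q' f.
Proof.
move=> mf fi.
apply: (integrable_fun_le mf _ (integrable_funD (integrable_cst_fun 1) fi)).
move=> w /=; rewrite -[f w ^+ 2]real_normK ?num_real//.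
by have := sqr_ge0 (`|f w| - 1); nra.
Qed.

(** Both factors are truncated so that the bounded case applies. The products of truncations are
    dominated by [f ^ 2 + g ^ 2], which is integrable from the marginal laws alone. *)
Lemma mean_mul_independent (i j : 'I_n) (f g : T' -> R) :
  i != j -> measurable_fun setT f -> measurable_fun setT g ->
  integrable_fun Q (fun z => f z ^+ 2) -> integrable_fun Q (fun z => g z ^+ 2) ->
  mean P (fun w => f (Z i w) * g (Z j w)) = mean Q f * mean Q g.
Proof.
move=> ij mf mg f2 g2.
have fi := integrable_of_sqr mf f2; have gi := integrable_of_sqr mg g2.
pose fm (m : nat) z := trunc m%:R (f z); pose gm (m : nat) z := trunc m%:R (g z).
have mfm m : measurable_fun setT (fm m).
  exact: measurableT_comp (measurable_trunc _) mf.
have mgm m : measurable_fun setT (gm m).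
  exact: measurableT_comp (measurable_trunc _) mg.
have fZ2 := integrable_law (mZ i) (lawZ i) f2.
have gZ2 := integrable_law (mZ j) (lawZ j) g2.
have [_ cv1] := @mean_dominated_cvg _ _ _ Q fm f (fun z => `|f z|) mfm
  (fun z => @trunc_cvg R (f z)) (fun m z => norm_trunc_le _ _) (integrable_fun_norm fi).
have [_ cv2] := @mean_dominated_cvg _ _ _ Q gm g (fun z => `|g z|) mgm
  (fun z => @trunc_cvg R (g z)) (fun m z => norm_trunc_le _ _) (integrable_fun_norm gi).
have bfg m w : `|fm m (Z i w) * gm m (Z j w)| <= f (Z i w) ^+ 2 + g (Z j w) ^+ 2.
  rewrite normrM -[f _ ^+ 2]real_normK ?num_real//.
  rewrite -[g _ ^+ 2]real_normK ?num_real//.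
  have := norm_trunc_le m%:R (f (Z i w)); have := norm_trunc_le m%:R (g (Z j w)).
  rewrite -/(fm m _) -/(gm m _) => h1 h2.
  rewrite (le_trans (ler_pM _ _ h2 h1))//.
  by have := sqr_ge0 (`|f (Z i w)| - `|g (Z j w)|); nra.
have [_ cv3] := @mean_dominated_cvg _ _ _ P (fun m w => fm m (Z i w) * gm m (Z j w))
  (fun w => f (Z i w) * g (Z j w)) (fun w => f (Z i w) ^+ 2 + g (Z j w) ^+ 2)
  (fun m => measurable_funM (measurableT_comp (mfm m) (mZ i))
                            (measurableT_comp (mgm m) (mZ j)))
  (fun w => cvgM (@trunc_cvg R (f (Z i w))) (@trunc_cvg R (g (Z j w))))
  bfg (integrable_funD fZ2 gZ2).
apply: (cvg_unique _ cv3) => //=.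
apply: (cvg_trans _ (cvgM cv1 cv2)); apply: near_eq_cvg; apply: nearW => m.
have bf z : `|fm m z| <= m%:R by apply: norm_trunc_bound.
have bg z : `|gm m z| <= m%:R by apply: norm_trunc_bound.
rewrite (mean_mul_independent_bounded ij (mfm m) (mgm m) bf bg).
rewrite /= -(mean_law (mZ i) (lawZ i) (integrable_bounded (mfm m) bf)).
by rewrite -(mean_law (mZ j) (lawZ j) (integrable_bounded (mgm m) bg)).
Qed.

Lemma mean_sqr_sum (h : T' -> R) : measurable_fun setT h ->
  integrable_fun Q (fun z => h z ^+ 2) -> mean Q h = 0 ->
  integrable_fun P (fun w => (\sum_i h (Z i w)) ^+ 2) /\
  mean P (fun w => (\sum_i h (Z i w)) ^+ 2) = n%:R * mean Q (fun z => h z ^+ 2).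
Proof.
move=> mh h2 h0.
have hZ2 i := integrable_law (mZ i) (lawZ i) h2.
have mhZ i := measurableT_comp mh (mZ i).
have hZZ i j := integrable_mul_sqr (mhZ i) (mhZ j) (hZ2 i) (hZ2 j).
have E w : (\sum_i h (Z i w)) ^+ 2 = \sum_i \sum_j h (Z i w) * h (Z j w).
  by rewrite expr2 mulr_suml; apply: eq_bigr => i _; rewrite mulr_sumr.
have i2 i : integrable_fun P (fun w => \sum_j h (Z i w) * h (Z j w)).
  exact: (integrable_fun_sum _ (hZZ i)).
split.
  have := integrable_fun_sum (index_enum 'I_n) i2.
  by congr (_.-integrable _ _); apply/funext => w /=; rewrite E.
rewrite (eq_mean E) mean_sum// (eq_bigr (fun=> mean Q (fun z => h z ^+ 2))).
  by rewrite sumr_const card_ord mulr_natl.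
move=> i _; rewrite (mean_sum _ (hZZ i)) (bigD1 i)//= big1 ?addr0 => [|j ji].
  by rewrite -(mean_law (mZ i) (lawZ i))//; apply: eq_mean => w; rewrite expr2.
by rewrite (mean_mul_independent _ mh mh) ?h0 ?mulr0// eq_sym.
Qed.

End SecondMoment.

(** * Weak law of large numbers for triangular arrays *)

Section LawOfLargeNumbers.
Context (R : realType) (d : nat -> measure_display).
Context (T : forall n, measurableType (d n)) (P : forall n, probability (T n) R).
Context d' (T' : measurableType d') (Q : probability T' R).
Context (Z : forall n, 'I_n -> T n -> T').
Hypotheses (mZ : forall n i, measurable_fun setT (@Z n i)).
Hypotheses (indZ : forall n, mutually_independent (P n) (@Z n)).
Hypotheses (lawZ : forall n i, has_law (P n) (@Z n i) Q).

(** Only a first moment is available, so [h] is truncated at a level [m] independent of [n]. The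
    truncated part has a variance and its average concentrates; the remainder has a small mean,
    uniformly in [n]. *)
Lemma mean_dist_average (h : T' -> R) (e : R) : integrable_fun Q h -> 0 < e ->
  \forall n \near \oo,
    integrable_fun (P n)
      (fun w => `|n%:R^-1 * (\sum_(i < n) h (Z i w)) - mean Q h|) /\
    mean (P n) (fun w => `|n%:R^-1 * (\sum_(i < n) h (Z i w)) - mean Q h|) <= e.
Proof.
(* The four shares [y] pay for the constant in the bound of the centered average, its variance, the
   mean of the remainder and the bias [c - mean Q h]. *)
move=> ih e0; have [y y0 ->] : exists2 y : R, 0 < y & e = 4 * y.
  by exists (e / 4); [rewrite divr_gt0|field].
have mh := integrable_measurable ih.
pose hm (m : nat) z := trunc m%:R (h z).
have mhm m : measurable_fun setT (hm m).
  exact: measurableT_comp (measurable_trunc _) mh.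
have [_ cv] : integrable_fun Q (fun=> 0) /\
    mean Q (fun z => `|h z - hm n z|) @[n --> \oo] --> mean Q (fun=> 0).
  apply: (mean_dominated_cvg _ _ _ (integrable_funZ 2 (integrable_fun_norm ih))).
  - by move=> m; apply: measurableT_comp => //; exact: measurable_funB.
  - move=> z; apply: cvg_near_cst; near=> m.
    by rewrite (_ : hm m z = h z) ?subrr ?normr0//; near: m; exact: trunc_near.
  - move=> m z; rewrite normr_id (le_trans (ler_normB _ _))//.
    by rewrite mulr_natl mulr2n lerD// norm_trunc_le.
rewrite mean_cst in cv.
have [m hmy] : exists m, mean Q (fun z => `|h z - hm m z|) <= y.
  move/cvgr0_norm_le: cv => /(_ _ y0)[m _ /(_ m (leqnn m))/= hmy].
  by exists m; rewrite (le_trans (ler_norm _)).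
pose r z : R := `|h z - hm m z|.
have hmM z : `|hm m z| <= m%:R by exact: norm_trunc_bound.
have ihm : integrable_fun Q (hm m) := integrable_bounded (mhm m) hmM.
have ihhm : integrable_fun Q (fun z => h z - hm m z) := integrable_funB ih ihm.
have ir : integrable_fun Q r := integrable_fun_norm ihhm.
pose c := mean Q (hm m); pose g z := hm m z - c.
have mg : measurable_fun setT g by exact: measurable_funB.
have cm : `|c| <= m%:R by exact: mean_norm_le.
have gM z : `|g z ^+ 2| <= (m%:R + m%:R) ^+ 2.
  rewrite normrX lerXn2r ?nnegrE ?addr_ge0//.
  by rewrite (le_trans (ler_normB _ _))// lerD.
have g2 : integrable_fun Q (fun z => g z ^+ 2).
  by apply: integrable_bounded gM; exact: measurable_funX.
have g0 : mean Q g = 0.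
  by rewrite /g meanB ?mean_cst ?subrr//; exact: integrable_cst_fun.
have cy : `|c - mean Q h| <= y.
  by rewrite distrC -meanB// (le_trans (norm_mean_le ihhm)).
pose V := mean Q (fun z => g z ^+ 2).
have V0 : 0 <= V by apply: mean_ge0 => z; exact: sqr_ge0.
near=> n.
have n0 : 0 < n%:R :> R by rewrite ltr0n; near: n; exact: nbhs_infty_gt.
have nV : V / y ^+ 2 <= n%:R by near: n; exact: nbhs_infty_ger.
have [iS ES] := mean_sqr_sum (@mZ n) (@indZ n) (@lawZ n) mg g2 g0.
have irZ i : integrable_fun (P n) (fun w => r (Z i w)).
  exact (integrable_law (@mZ n i) (@lawZ n i) ir).
have ihZ i : integrable_fun (P n) (fun w => h (Z i w)).
  exact (integrable_law (@mZ n i) (@lawZ n i) ih).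
pose S w : R := (\sum_(i < n) g (Z i w)) ^+ 2.
(* The centered average [t] satisfies [|t| <= y + t ^ 2 / y], so its mean is controlled by its mean
   square without a square root. *)
pose B w : R := (y + n%:R ^- 2 / y * S w) + (n%:R^-1 * (\sum_(i < n) r (Z i w)) + y).
have iB1 : integrable_fun (P n) (fun w => y + n%:R ^- 2 / y * S w).
  by apply: integrable_funD; [exact: integrable_cst_fun|exact: integrable_funZ].
have iB2 : integrable_fun (P n) (fun w => n%:R^-1 * (\sum_(i < n) r (Z i w)) + y).
  apply: integrable_funD; last exact: integrable_cst_fun.
  exact/integrable_funZ/integrable_fun_sum.
have iB : integrable_fun (P n) B by exact: integrable_funD.
pose D w : R := n%:R^-1 * (\sum_(i < n) h (Z i w)) - mean Q h.
have iD : integrable_fun (P n) D.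
  apply: integrable_funB; last exact: integrable_cst_fun.
  exact/integrable_funZ/integrable_fun_sum.
split; first exact: integrable_fun_norm iD.
have DB w : `|D w| <= B w.
  have -> : D w = n%:R^-1 * (\sum_(i < n) g (Z i w)) +
      (n%:R^-1 * (\sum_(i < n) (h (Z i w) - hm m (Z i w))) + (c - mean Q h)).
    rewrite /D /g !sumrB sumr_const card_ord -mulr_natl.
    by field; rewrite gt_eqF.
  rewrite (le_trans (ler_normD _ _))// lerD//.
    rewrite /S -mulrA; set s := \sum_i _.
    have -> : n%:R ^- 2 * (y^-1 * s ^+ 2) = (n%:R^-1 * s) ^+ 2 / y.
      by field; rewrite !gt_eqF.
    rewrite -[(_ * s) ^+ 2]real_normK ?num_real//; set t := `|_|.
    have t0 : 0 <= t by exact: normr_ge0.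
    rewrite -(ler_pM2r y0) mulrDl divfK ?gt_eqF//.
    by have := sqr_ge0 (t - y); nra.
  rewrite (le_trans (ler_normD _ _))// lerD// normrM ger0_norm ?invr_ge0 ?ler0n//.
  by rewrite ler_wpM2l ?invr_ge0 ?ler0n// ler_norm_sum.
rewrite (le_trans (mean_le (integrable_fun_norm iD) iB DB))//.
rewrite /B meanD// meanD ?meanZ ?mean_cst//; last 2 first.
- exact: integrable_cst_fun.
- exact: integrable_funZ.
rewrite ES meanD ?meanZ ?mean_cst ?mean_sum//; last 3 first.
- exact: integrable_fun_sum.
- exact/integrable_funZ/integrable_fun_sum.
- exact: integrable_cst_fun.
rewrite (eq_bigr (fun=> mean Q r)) => [|i _]; last exact: (mean_law (@mZ n i) (@lawZ n i)).
rewrite sumr_const card_ord -[mean Q r *+ n]mulr_natl mulKf ?gt_eqF//.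
have -> : n%:R ^- 2 / y * (n%:R * V) = V / y / n%:R by field; rewrite !gt_eqF.
have : V / y / n%:R <= y.
  rewrite ler_pdivrMr//; move: nV; rewrite ler_pdivrMr ?exprn_gt0//.
  move=> hV; rewrite ler_pdivrMr//; move: hV; rewrite expr2; lra.
rewrite -/r in hmy; lra.
Unshelve. all: by end_near. Qed.

End LawOfLargeNumbers.

(** * Events of high probability *)

Section WithProbability.
Context (R : realType) (d : nat -> measure_display).
Context (T : forall n, measurableType (d n)) (P : forall n, probability (T n) R).

(* A n holds, for all large n, off a measurable set of probability at most r;
   A n itself need not be measurable. *)
Definition with_prob (r : R) (A : forall n, set (T n)) :=
  \forall n \near \oo, exists B : set (T n),
    [/\ measurable B, (P n B <= r%:E)%E & forall w, ~ B w -> A n w].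

Lemma with_prob_sub r (A A' : forall n, set (T n)) :
  (\forall n \near \oo, forall w, A n w -> A' n w) ->
  with_prob r A -> with_prob r A'.
Proof.
apply: filterS2 => n AA' [B [mB PB BA]]; exists B; split=> // w /BA; exact: AA'.
Qed.

Lemma with_prob_and r1 r2 (A A' : forall n, set (T n)) :
  with_prob r1 A -> with_prob r2 A' ->
  with_prob (r1 + r2) (fun n w => A n w /\ A' n w).
Proof.
apply: filterS2 => n [B [mB PB BA]] [B' [mB' PB' BA']].
exists (B `|` B'); split.
- exact: measurableU.
- by rewrite (le_trans (measureU2 _ _ _))// EFinD leeD.
- by move=> w /not_orP[/BA ? /BA' ?].
Qed.

Lemma with_prob_andW (A A' : forall n, set (T n)) :
  (forall r, 0 < r -> with_prob r A) -> (forall r, 0 < r -> with_prob r A') ->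
  forall r, 0 < r -> with_prob r (fun n w => A n w /\ A' n w).
Proof.
move=> hA hA' r r0; have r2 : 0 < r / 2 by rewrite divr_gt0.
by rewrite [r]splitr; apply: with_prob_and; [exact: hA|exact: hA'].
Qed.

Lemma with_prob_forall (I : finType) (r : R) (A : I -> forall n, set (T n)) :
  0 < r -> (forall i s, 0 < s -> with_prob s (A i)) ->
  with_prob r (fun n w => forall i, A i n w).
Proof.
move=> r0 hA.
have H (s : seq I) (t : R) : 0 < t ->
    with_prob t (fun n w => forall i, i \in s -> A i n w).
  elim: s t => [t t0|i s IHs t t0].
    apply: nearW => n; exists set0; split=> //.
    by rewrite measure0 lee_fin ltW.
  have t2 : 0 < t / 2 by rewrite divr_gt0.
  have -> : t = t / 2 + t / 2 by field.
  apply: with_prob_sub (with_prob_and (hA i _ t2) (IHs _ t2)).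
  apply: nearW => n w [Ai As] j; rewrite inE => /predU1P[->//|]; exact: As.
apply: with_prob_sub (H (index_enum I) r r0).
by apply: nearW => n w Aw i; apply: Aw; rewrite mem_index_enum.
Qed.

Lemma with_prob_markov (f : forall n, T n -> R) (r : R) (a : nat -> R) :
  (forall n, 0 < a n) ->
  (\forall n \near \oo, [/\ integrable_fun (P n) (f n), forall w, 0 <= f n w &
                            mean (P n) (f n) <= r * a n]) ->
  with_prob r (fun n w => f n w < a n).
Proof.
move=> a0; apply: filterS => n [fi f0 fr].
have mf := integrable_measurable fi.
exists [set w | a n <= f n w]; split.
- rewrite (_ : [set _ | _] = f n @^-1` `[a n, +oo[%classic).
    by rewrite -[X in measurable X]setTI; apply: mf.
  by apply/seteqP; split=> w /=; rewrite in_itv/= andbT.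
- by rewrite (le_trans (markov_mean (a0 n) fi f0))// lee_fin ler_pdivrMr.
- by move=> w /= /negP; rewrite -ltNge.
Qed.

Lemma measurable_ge (D : measure_display) (S : measurableType D) (f : S -> R) (a : R) :
  measurable_fun setT f -> measurable [set w | a <= f w].
Proof.
move=> mf; rewrite (_ : [set _ | _] = f @^-1` `[a, +oo[%classic).
  by rewrite -[X in measurable X]setTI; apply: mf.
by apply/seteqP; split=> w /=; rewrite in_itv/= andbT.
Qed.

Lemma measurable_le (D : measure_display) (S : measurableType D) (f : S -> R) (a : R) :
  measurable_fun setT f -> measurable [set w | f w <= a].
Proof.
move=> mf; rewrite (_ : [set _ | _] = f @^-1` `]-oo, a]%classic).
  by rewrite -[X in measurable X]setTI; apply: mf.
by apply/seteqP; split=> w /=; rewrite in_itv/=.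
Qed.

Lemma measurable_gt (D : measure_display) (S : measurableType D) (f : S -> R) (a : R) :
  measurable_fun setT f -> measurable [set w | a < f w].
Proof.
move=> mf; rewrite (_ : [set _ | _] = f @^-1` `]a, +oo[%classic).
  by rewrite -[X in measurable X]setTI; apply: mf.
by apply/seteqP; split=> w /=; rewrite in_itv/= andbT.
Qed.

Lemma cvg_in_probability_with_prob (V : normedModType R) (Z : forall n, T n -> V)
    (c : V) e r : 0 < e -> 0 < r ->
  (forall n, measurable_fun setT (fun w => `|Z n w - c|)) ->
  cvg_in_probability P Z c -> with_prob r (fun n w => `|Z n w - c| < e).
Proof.
move=> e0 r0 mZ /(_ e e0).
move=> /fine_cvgP[_ /cvgr0_norm_le /(_ _ r0)].
apply: filterS => n /= h; exists [set w | e <= `|Z n w - c|]; split.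
- exact: measurable_ge.
- have mA := @measurable_ge _ _ _ e (mZ n).
  rewrite -[leLHS]fineK ?fin_num_measure// lee_fin (le_trans _ h)//.
  exact: ler_norm.
- by move=> w /= /negP; rewrite -ltNge.
Qed.

Lemma with_prob_cvg_in_probability (V : normedModType R) (Z : forall n, T n -> V)
    (c : V) :
  (forall n, measurable_fun setT (fun w => `|Z n w - c|)) ->
  (forall e r, 0 < e -> 0 < r -> with_prob r (fun n w => `|Z n w - c| < e)) ->
  cvg_in_probability P Z c.
Proof.
move=> mZ hZ e e0.
have mA n := @measurable_ge _ _ _ e (mZ n).
apply/fine_cvgP; split.
  by apply: nearW => n; rewrite fin_num_measure.
apply/cvgr0Pnorm_le => r r0; have := hZ _ _ e0 r0.
apply: filterS => n [B [mB PB BA]] /=.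
rewrite ger0_norm ?fine_ge0// -lee_fin fineK ?fin_num_measure//.
apply: le_trans PB; apply: le_measure; rewrite ?inE//.
by move=> w /= ew; apply: contrapT => /BA; rewrite ltNge ew.
Qed.

Lemma with_prob_lim1 (A : forall n, set (T n)) r : 0 < r ->
  (forall n, measurable (A n)) -> P n (A n) @[n --> \oo] --> 1%E ->
  with_prob r A.
Proof.
move=> r0 mA /fine_cvgP[_ /cvgrPdist_le /(_ _ r0)].
apply: filterS => n /= h; exists (~` A n); split.
- exact: measurableC.
- rewrite probability_setC// -[P n _]fineK ?fin_num_measure// -EFinB lee_fin.
  by rewrite (le_trans _ h)// ler_norm.
- by move=> w /contrapT.
Qed.

End WithProbability.

(** * The central limit theorem for cosines *)

Section TrigonometricBounds.
Context (R : realType).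
Implicit Types x u : R.

Lemma norm_sin_le x : `|sin x| <= `|x|.
Proof.
wlog x0 : x / 0 <= x.
  move=> H; have [/H//|/ltW x0] := leP 0 x.
  by rewrite -normrN -sinN -[leRHS]normrN H// oppr_ge0.
have [|c _] := @MVT_segment R sin cos 0 x x0 (fun y _ => is_derive_sin y).
  by apply: continuous_subspaceT => y; exact: continuous_sin.
rewrite sin0 !subr0 => ->; rewrite normrM ler_piMl//.
by rewrite cos_max.
Qed.

Lemma cos1B x : 1 - cos x = 2 * sin (x / 2) ^+ 2.
Proof.
have -> : cos x = cos ((x / 2) *+ 2) by congr cos; field.
rewrite cos_mulr2n mulr_natl; have := sin2cos2 (x / 2); move: (cos _) (sin _) => c s.
by rewrite !mulr2n => ->; ring.
Qed.

Lemma cos1B_ge0 x : 0 <= 1 - cos x.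
Proof. by rewrite subr_ge0 cos_le1. Qed.

Lemma cos1B_le x : 1 - cos x <= x ^+ 2 / 2.
Proof.
rewrite cos1B; have := norm_sin_le (x / 2).
rewrite -ler_sqr ?nnegrE// !real_normK ?num_real// => h; lra.
Qed.

(** The derivative of [y - sin y] is [1 - cos y], at most [y ^ 2 / 2], so one use of the mean value
    theorem gives a cube; the constant is not optimal but suffices. *)
Lemma norm_sinB_le x : `|sin x - x| <= `|x| ^+ 3 / 2.
Proof.
wlog x0 : x / 0 <= x.
  move=> H; have [/H//|/ltW x0] := leP 0 x.
  have := H (- x); rewrite sinN normrN oppr_ge0 => /(_ x0).
  by rewrite -opprD normrN.
have [|c] := @MVT_segment R (fun y => y - sin y) (fun y => 1 - cos y) 0 x x0.
  apply: continuous_subspaceT => y; apply: cvgB; first exact: cvg_id.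
  exact: continuous_sin.
rewrite sin0 !subr0 in_itv/= => /andP[c0 cx] E.
rewrite distrC E normrM (ger0_norm (cos1B_ge0 c)) (ger0_norm x0).
rewrite exprS mulrC -mulrA ler_wpM2l//.
by rewrite (le_trans (cos1B_le c))// ler_pM2r// lerXn2r// nnegrE.
Qed.

(** A bound by the square, valid for all [x], is a majorant that is integrable under a second
    moment; the cubic bound serves for pointwise limits. Beyond 2 the trivial bound [2 |x|] takes
    over. *)
Lemma norm_sinB_le_sqr x : `|sin x - x| <= x ^+ 2.
Proof.
rewrite -[leRHS]real_normK ?num_real//; have [x2|x2] := leP `|x| 2.
  rewrite (le_trans (norm_sinB_le x))// exprSr ler_pdivrMr//.
  by rewrite ler_wpM2l// sqr_ge0.
rewrite (le_trans (ler_normB _ _))//; have := norm_sin_le x; nra.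
Qed.

(** By the half-angle formula the quantity is twice the difference of the squares of [sin (x / 2)]
    and [x / 2]. The cubic bound on one factor and a linear bound on the other give order four
    without a Taylor expansion. *)
Lemma norm_cos_sqr_le x : `|1 - cos x - x ^+ 2 / 2| <= x ^+ 4 / 8.
Proof.
rewrite cos1B; have -> : 2 * sin (x / 2) ^+ 2 - x ^+ 2 / 2 =
    2 * ((sin (x / 2) - x / 2) * (sin (x / 2) + x / 2)) by field.
have h1 := norm_sinB_le (x / 2).
have h2 : `|sin (x / 2) + x / 2| <= 2 * `|x / 2|.
  by rewrite (le_trans (ler_normD _ _))//; have := norm_sin_le (x / 2); lra.
rewrite 2!normrM (ger0_norm (ler0n _ 2)).
have -> : x ^+ 4 / 8 = 2 * ((`|x / 2| ^+ 3 / 2) * (2 * `|x / 2|)).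
  have -> : x = 2 * (x / 2) by field.
  rewrite (_ : 2 * (x / 2) / 2 = x / 2); last by field.
  set u := x / 2; have -> : (2 * u) ^+ 4 = 16 * (`|u| ^+ 2) ^+ 2.
    by rewrite real_normK ?num_real//; ring.
  by field.
by rewrite ler_pM2l// ler_pM.
Qed.

Lemma norm_cosB_le x u : `|cos x - cos u| <= `|x - u|.
Proof.
wlog xu : x u / x <= u.
  move=> H; have [/H//|/ltW/H] := leP x u.
  by rewrite distrC [leRHS]distrC.
have [|c _ E] := @MVT_segment R cos (fun y => - sin y) x u xu
    (fun y _ => is_derive_cos y).
  by apply: continuous_subspaceT => y; exact: continuous_cos.
by rewrite distrC E normrM normrN distrC ler_piMl// sin_max.
Qed.

(** [expR (- u)] lies between [1 - u] and [1 / (1 + u)], and the latter is at most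
    [1 - u + u ^ 2]. *)
Lemma norm_expRN_le u : 0 <= u -> `|expR (- u) - 1 + u| <= u ^+ 2.
Proof.
move=> u0; have h1 := expR_ge1Dx (- u); have h2 := expR_ge1Dx u.
have u1 : 0 < 1 + u by rewrite ltr_wpDr.
have h3 : expR (- u) <= (1 + u)^-1.
  by rewrite expRN lef_pV2// ?posrE ?expR_gt0.
have h4 : (1 + u)^-1 <= 1 - u + u ^+ 2.
  rewrite -[leLHS]mul1r ler_pdivrMr//.
  have -> : (1 - u + u ^+ 2) * (1 + u) = 1 + u ^+ 3 by ring.
  by rewrite lerDl exprn_ge0.
rewrite ler_norml; lra.
Qed.

Lemma measurable_cos : measurable_fun setT (@cos R).
Proof. by apply: continuous_measurable_fun; exact: continuous_cos. Qed.

Lemma measurable_sin : measurable_fun setT (@sin R).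
Proof. by apply: continuous_measurable_fun; exact: continuous_sin. Qed.

Lemma cvg_dist_sqrt (a : nat -> R) (l C : R) :
  (forall n, (0 < n)%N -> `|a n - l| <= C / Num.sqrt n%:R) ->
  a n @[n --> \oo] --> l.
Proof.
move=> h; apply/cvgrPdist_le => e e0; near=> n.
have n0 : (0 < n)%N by near: n; exact: nbhs_infty_gt.
have s0 : 0 < Num.sqrt n%:R :> R by rewrite sqrtr_gt0 ltr0n.
rewrite distrC (le_trans (h n n0))// ler_pdivrMr// mulrC -ler_pdivrMr//.
have [Ce|Ce] := leP (C / e) 0; first by rewrite (le_trans Ce)// ltW.
rewrite -(ler_pXn2r (n := 2))// ?nnegrE ?(ltW Ce) ?(ltW s0)// sqr_sqrtr//.
by near: n; exact: nbhs_infty_ger.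
Unshelve. all: by end_near. Qed.

End TrigonometricBounds.

Section CosineOfSum.
Context d d' (T : measurableType d) (T' : measurableType d') (R : realType).
Context (P : probability T R) (Q : probability T' R) (n : nat).
Context (Z : 'I_n -> T -> T') (th : T' -> R).
Hypotheses (mZ : forall i, measurable_fun setT (Z i)).
Hypotheses (indZ : mutually_independent P Z) (lawZ : forall i, has_law P (Z i) Q).
Hypothesis mth : measurable_fun setT th.

Let mcos : measurable_fun setT (fun z => cos (th z)).
Proof. exact: measurableT_comp (@measurable_cos R) mth. Qed.

Let msin : measurable_fun setT (fun z => sin (th z)).
Proof. exact: measurableT_comp (@measurable_sin R) mth. Qed.

(* mean_cos_rec k s is the mean of cos (th (Z 0) + ... + th (Z k.-1) + s),
   computed by splitting off one independent summand at a time *)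
Fixpoint mean_cos_rec (k : nat) (s : R) : R :=
  if k is k'.+1 then
    mean Q (fun z => cos (th z)) * mean_cos_rec k' s +
    mean Q (fun z => sin (th z)) * mean_cos_rec k' (s + pi / 2)
  else cos s.

(** The product over the indices not yet absorbed makes the induction possible: when the summand of
    index [k] is split off by the addition formula, its cosine or sine becomes one of these
    factors. *)
Lemma mean_cos_sum_prod (k : nat) (s : R) (f : 'I_n -> T' -> R) (M : R) :
  (k <= n)%N -> (forall i, measurable_fun setT (f i)) ->
  (forall i z, `|f i z| <= M) ->
  mean P (fun w => cos (\sum_(i < n | (i < k)%N) th (Z i w) + s) *
                   \prod_(i < n | (k <= i)%N) f i (Z i w)) =
  mean_cos_rec k s * \prod_(i < n | (k <= i)%N) mean P (fun w => f i (Z i w)).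
Proof.
elim: k s f M => [|k IHk] s f M kn mf fM.
  rewrite -(mean_prod_independent mZ indZ mf fM) -meanZ; last first.
    apply: (integrable_bounded (M := M ^+ n)).
      by apply: measurable_prod => i _; exact: measurableT_comp.
    move=> w; rewrite normr_prod -[n in M ^+ n]card_ord -prodr_const.
    by apply: ler_prod => i _; rewrite normr_ge0 fM.
  apply: eq_mean => w; rewrite [X in cos (X + s)]big_pred0 ?add0r//.
pose i0 := Ordinal kn.
pose F (g : T' -> R) i := if i == i0 then g else f i.
have F0 g : F g i0 = g by rewrite /F eqxx.
have FN g i : i != i0 -> F g i = f i by move=> /negbTE e; rewrite /F e.
have mF (g : T' -> R) : measurable_fun setT g -> forall i, measurable_fun setT (F g i).
  by move=> mg i; rewrite /F; case: (i == i0).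
have FM g : (forall z, `|g z| <= 1) -> forall i z, `|F g i z| <= Num.max 1 M.
  by move=> g1 i z; rewrite /F le_max; case: (i == i0); rewrite ?g1 ?fM ?orbT.
have c1 z : `|cos (th z)| <= 1 by exact: cos_max.
have s1 z : `|sin (th z)| <= 1 by exact: sin_max.
have kP (i : 'I_n) : (k <= i)%N && (i != i0) = (k < i)%N.
  by rewrite ltn_neqAle andbC eq_sym.
have ki0 (i : 'I_n) : (k < i)%N -> i != i0 by rewrite -kP => /andP[].
have kP' (i : 'I_n) : (i < k.+1)%N && (i != i0) = (i < k)%N.
  rewrite ltnS leq_eqVlt -(inj_eq val_inj)/=; case: (ltngtP i k) => //.
have IHF s' (g : T' -> R) : measurable_fun setT g -> (forall z, `|g z| <= 1) ->
    mean P (fun w => cos (\sum_(i < n | (i < k)%N) th (Z i w) + s') *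
      (g (Z i0 w) * \prod_(i < n | (k < i)%N) f i (Z i w))) =
    mean_cos_rec k s' * (mean Q g *
      \prod_(i < n | (k < i)%N) mean P (fun w => f i (Z i w))).
  move=> mg g1; have := IHk s' _ _ (ltnW kn) (mF g mg) (FM g g1).
  rewrite (bigD1 i0)//= F0 (eq_bigl _ _ kP).
  rewrite (mean_law (mZ i0) (lawZ i0) (integrable_bounded mg g1)).
  rewrite (eq_bigr (fun i => mean P (fun w => f i (Z i w)))) => [<-|i /ki0 ii0].
    apply: eq_mean => w; congr (_ * _).
    rewrite [RHS](bigD1 i0)//= F0 (eq_bigl _ _ kP); congr (_ * _).
    by apply: eq_bigr => i /ki0 ii0; rewrite FN.
  by rewrite FN.
pose G w := \prod_(i < n | (k < i)%N) f i (Z i w).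
(* Addition formula, where minus a sine is written as a cosine with phase advanced by [pi / 2]; the
   recursion thus stays among cosines. *)
rewrite (eq_mean (g := fun w =>
  cos (\sum_(i < n | (i < k)%N) th (Z i w) + s) * (cos (th (Z i0 w)) * G w) +
  cos (\sum_(i < n | (i < k)%N) th (Z i w) + (s + pi / 2)) *
    (sin (th (Z i0 w)) * G w))); last first.
  move=> w; rewrite (bigD1 i0)//= (eq_bigl _ _ kP').
  set S := \sum_(i < n | _) _; rewrite addrA cosDpihalf.
  by rewrite -/(G w) -addrA cosD; ring.
have mG : measurable_fun setT G.
  rewrite (_ : G = fun w => \prod_(i < n) if (k < i)%N then f i (Z i w) else 1).
    apply: measurable_prod => i _; case: (k < i)%N; last exact: measurable_cst.
    exact: measurableT_comp.
  by apply/funext => w; rewrite /G big_mkcond.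
have GM w : `|G w| <= \prod_(i < n | (k < i)%N) M.
  by rewrite normr_prod; apply: ler_prod => i _; rewrite normr_ge0 fM.
have mS : measurable_fun setT (fun w => \sum_(i < n | (i < k)%N) th (Z i w)).
  rewrite (_ : (fun _ => _) = fun w => \sum_(i < n) if (i < k)%N then th (Z i w) else 0).
    apply: measurable_sum => i; case: (i < k)%N; last exact: measurable_cst.
    exact: measurableT_comp.
  by apply/funext => w; rewrite big_mkcond.
have iterm s' (g : T' -> R) : measurable_fun setT g -> (forall z, `|g z| <= 1) ->
    integrable_fun P (fun w => cos (\sum_(i < n | (i < k)%N) th (Z i w) + s') *
      (g (Z i0 w) * G w)).
  move=> mg g1; apply: (integrable_funM_bounded (M := 1)).
  - by apply: measurableT_comp (@measurable_cos R) _; exact: measurable_funD.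
  - by move=> w; exact: cos_max.
  - apply: (integrable_funM_bounded (M := 1)) => //.
      exact: measurableT_comp.
    exact: integrable_bounded mG GM.
rewrite (meanD (iterm s _ mcos c1) (iterm (s + pi / 2) _ msin s1)) /G.
by rewrite (IHF s _ mcos c1) (IHF (s + pi / 2) _ msin s1)/=; ring.
Qed.

Lemma mean_cos_partial_sum k (s : R) : (k <= n)%N ->
  mean P (fun w => cos (\sum_(i < n | (i < k)%N) th (Z i w) + s)) =
  mean_cos_rec k s.
Proof.
move=> kn; have := @mean_cos_sum_prod k s (fun _ _ => 1) 1 kn
  (fun _ => measurable_cst _) (fun _ _ => ltac:(by rewrite normr1)).
rewrite [in RHS]big1 ?mulr1 => [<-|i _]; last exact: mean_cst.
by apply: eq_mean => w; rewrite [X in _ * X]big1 ?mulr1.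
Qed.

Lemma mean_cos_sum (s : R) :
  mean P (fun w => cos (\sum_(i < n) th (Z i w) + s)) = mean_cos_rec n s.
Proof.
rewrite -mean_cos_partial_sum//; apply: eq_mean => w.
by congr (cos (_ + s)); apply: eq_bigl => i; rewrite ltn_ord.
Qed.

(** The recursion does not show this bound, since the absolute values of its two coefficients may
    add up to more than 1. It holds because the value is the mean of a cosine of [k] of the [n]
    variables, hence [k <= n]. *)
Lemma norm_mean_cos_rec_le1 k s : (k <= n)%N -> `|mean_cos_rec k s| <= 1.
Proof.
move=> kn; rewrite -mean_cos_partial_sum//.
apply: mean_norm_le => [|w]; last exact: cos_max.
apply: measurableT_comp (@measurable_cos R) _; apply: measurable_funD => //.
rewrite (_ : (fun _ => _) = fun w => \sum_(i < n) if (i < k)%N then th (Z i w) else 0).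
  apply: measurable_sum => i; case: (i < k)%N; last exact: measurable_cst.
  exact: measurableT_comp.
by apply/funext => w; rewrite big_mkcond.
Qed.

(** Real counterpart of [|a ^ k - r ^ k| <= k |a - r|] in the unit disk: the means of [cos (th z)]
    and [sin (th z)] are the real and imaginary parts of a characteristic function, and each of the
    [k] replacements is harmless because the other factors are bounded by 1. *)
Lemma mean_cos_rec_dist (r s : R) k : (k <= n)%N -> 0 <= r <= 1 ->
  `|mean_cos_rec k s - r ^+ k * cos s| <=
  k%:R * (`|mean Q (fun z => cos (th z)) - r| + `|mean Q (fun z => sin (th z))|).
Proof.
move=> kn r01; elim: k s kn => [|k IHk] s kn; first by rewrite mul1r subrr normr0 mul0r.
rewrite /=; set a := \int[Q]_w cos (th w); set b := \int[Q]_w sin (th w).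
have -> : a * mean_cos_rec k s + b * mean_cos_rec k (s + pi / 2) - r ^+ k.+1 * cos s =
  (r * (mean_cos_rec k s - r ^+ k * cos s)) + ((a - r) * mean_cos_rec k s +
   b * mean_cos_rec k (s + pi / 2)) by rewrite exprS; ring.
rewrite -[k.+1%:R]natr1 [leRHS]mulrDl mul1r (le_trans (ler_normD _ _))// lerD//.
  rewrite normrM (le_trans _ (IHk s (ltnW kn)))// ler_piMl//.
  by rewrite ger0_norm; case/andP: r01.
rewrite (le_trans (ler_normD _ _))// !normrM lerD// ler_piMr//;
  exact/norm_mean_cos_rec_le1/ltnW.
Qed.

End CosineOfSum.

(** * Limit of the mean cosine of a normalized sum *)

Section CentralLimit.
Context (R : realType) (d : nat -> measure_display).
Context (T : forall n, measurableType (d n)) (P : forall n, probability (T n) R).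
Context d' (T' : measurableType d') (Q : probability T' R).
Context (Z : forall n, 'I_n -> T n -> T').
Hypotheses (mZ : forall n i, measurable_fun setT (@Z n i)).
Hypotheses (indZ : forall n, mutually_independent (P n) (@Z n)).
Hypotheses (lawZ : forall n i, has_law (P n) (@Z n i) Q).
Context (h : T' -> R).
Hypotheses (mh : measurable_fun setT h).
Hypothesis h2 : integrable_fun Q (fun z => h z ^+ 2).
Hypothesis h0 : mean Q h = 0.

Let root n : R := Num.sqrt n%:R.

Let root_gt0 n : (0 < n)%N -> 0 < root n.
Proof. by move=> n0; rewrite sqrtr_gt0 ltr0n. Qed.

Let root_sqr n : root n ^+ 2 = n%:R.
Proof. by rewrite sqr_sqrtr. Qed.

Let root_ge1 n : (0 < n)%N -> 1 <= root n.
Proof. by move=> n0; rewrite -[leLHS]sqrtr1 ler_sqrt ?ler1n// ltr0n. Qed.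

Let mdiv n : measurable_fun setT (fun z => h z / root n).
Proof. exact: measurable_funM. Qed.

(** The scaled integrand converges pointwise to [h ^ 2 / 2] and is dominated by it, because
    [1 - cos u <= u ^ 2 / 2] for all [u]. Dominated convergence thus takes the place of a Lindeberg
    condition. *)
Lemma mean_cos_scaled_cvg :
  n%:R * (1 - mean Q (fun z => cos (h z / root n))) @[n --> \oo] -->
  mean Q (fun z => h z ^+ 2) / 2.
Proof.
have mc n : measurable_fun setT (fun z => 1 - cos (h z / root n)).
  by apply: measurable_funB => //; exact: measurableT_comp (@measurable_cos R) (mdiv n).
have bc n z : `|1 - cos (h z / root n)| <= 2.
  by rewrite (le_trans (ler_normB _ _))// normr1 lerD// cos_max.
have [_ cv] : integrable_fun Q (fun z => h z ^+ 2 / 2) /\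
    mean Q (fun z => n%:R * (1 - cos (h z / root n))) @[n --> \oo] -->
    mean Q (fun z => h z ^+ 2 / 2).
  apply: (mean_dominated_cvg _ _ _ (integrable_funZ 2^-1 h2)).
  - by move=> n; exact: measurable_funM.
  - move=> z; apply: (@cvg_dist_sqrt _ _ _ (h z ^+ 4 / 8)) => n n0.
    have r0 := root_gt0 n0.
    have -> : n%:R * (1 - cos (h z / root n)) - h z ^+ 2 / 2 =
        n%:R * (1 - cos (h z / root n) - (h z / root n) ^+ 2 / 2).
      by rewrite -root_sqr; field; rewrite gt_eqF.
    rewrite normrM ger0_norm// (le_trans (ler_wpM2l _ (norm_cos_sqr_le _)))//.
    have -> : n%:R * ((h z / root n) ^+ 4 / 8) = (h z ^+ 4 / 8) / n%:R.
      by rewrite -root_sqr; field; rewrite gt_eqF.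
    apply: ler_wpM2l; first by rewrite divr_ge0// exprn_even_ge0.
    rewrite lef_pV2 ?posrE ?ltr0n// -/(root n) -root_sqr expr2.
    exact: ler_peMr (ltW r0) (root_ge1 n0).
  - move=> n z; rewrite normrM (ger0_norm (cos1B_ge0 _)) ger0_norm//.
    case: n => [|n]; first by rewrite mul0r mulr_ge0// sqr_ge0.
    have r0 := @root_gt0 n.+1 isT.
    rewrite (le_trans (ler_wpM2l _ (cos1B_le _)))// -root_sqr le_eqVlt.
    by apply/orP; left; apply/eqP; field; rewrite gt_eqF.
have -> : mean Q (fun z => h z ^+ 2) / 2 = mean Q (fun z => h z ^+ 2 / 2).
  by rewrite mulrC -meanZ//; apply: eq_mean => z; rewrite mulrC.
apply: cvg_trans cv; apply: near_eq_cvg; apply: nearW => n /=.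
have ic : integrable_fun Q (fun z => cos (h z / root n)).
  apply: (integrable_bounded (M := 1)) => [|z]; last exact: cos_max.
  exact: measurableT_comp (@measurable_cos R) (mdiv n).
rewrite meanZ; last exact: integrable_bounded (mc n) (bc n).
by rewrite meanB ?mean_cst//; exact: integrable_cst_fun.
Qed.

(** The linear term [h z / root n] is subtracted first: its mean is zero by [h0], and the remainder
    multiplied by [n] is dominated by [h ^ 2]. *)
Lemma mean_sin_scaled_cvg :
  n%:R * mean Q (fun z => sin (h z / root n)) @[n --> \oo] --> 0.
Proof.
have ms n : measurable_fun setT (fun z => sin (h z / root n)).
  exact: measurableT_comp (@measurable_sin R) (mdiv n).
have ih := integrable_of_sqr mh h2.
have [_ cv] : integrable_fun Q (fun=> 0) /\
    mean Q (fun z => n%:R * (sin (h z / root n) - h z / root n)) @[n --> \oo] -->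
    mean Q (fun=> 0).
  apply: (mean_dominated_cvg _ _ _ h2).
  - by move=> n; apply: measurable_funM => //; exact: measurable_funB.
  - move=> z; apply: (@cvg_dist_sqrt _ _ _ (`|h z| ^+ 3 / 2)) => n n0.
    have r0 := root_gt0 n0.
    rewrite subr0 normrM ger0_norm// (le_trans (ler_wpM2l _ (norm_sinB_le _)))//.
    rewrite normrM normfV (ger0_norm (ltW r0)) -/(root n) -root_sqr le_eqVlt.
    by apply/orP; left; apply/eqP; field; rewrite gt_eqF.
  - move=> n z; rewrite normrM ger0_norm//.
    case: n => [|n]; first by rewrite mul0r sqr_ge0.
    have r0 := @root_gt0 n.+1 isT.
    rewrite (le_trans (ler_wpM2l _ (norm_sinB_le_sqr _)))// -root_sqr le_eqVlt.
    by apply/orP; left; apply/eqP; field; rewrite gt_eqF.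
rewrite mean_cst in cv.
apply: cvg_trans cv; apply: near_eq_cvg; apply: nearW => n /=.
have is_ : integrable_fun Q (fun z => sin (h z / root n)).
  by apply: (integrable_bounded (M := 1)) => // z; exact: sin_max.
have idiv : integrable_fun Q (fun z => h z / root n).
  have := integrable_funZ (root n)^-1 ih.
  by congr (_.-integrable _ _); apply/funext => z /=; rewrite mulrC.
rewrite meanZ ?meanB//; last exact: integrable_funB.
rewrite (eq_mean (f := fun z => h z / root n) (g := fun z => (root n)^-1 * h z)).
  by rewrite meanZ// h0 mulr0 subr0.
by move=> z; rewrite mulrC.
Qed.

Lemma mean_cos_clt (s : R) :
  mean (P n) (fun w => cos ((root n)^-1 * (\sum_(i < n) h (Z i w)) + s))
    @[n --> \oo] --> expR (- (mean Q (fun z => h z ^+ 2) / 2)) * cos s.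
Proof.
set v := mean Q (fun z => h z ^+ 2) / 2.
have v0 : 0 <= v by rewrite divr_ge0// mean_ge0// => z; exact: sqr_ge0.
(* The [n]-th power of [r n] is exactly the exponential in the limit, so only one-term means need
   comparing: [a n] with [r n] and [b n] with 0, both up to [o(1 / n)]. *)
pose r n : R := expR (- (v / n%:R)).
have rn n : (0 < n)%N -> r n ^+ n = expR (- v).
  by move=> n0; rewrite -expRM_natl -mulNr mulrC divfK// pnatr_eq0 -lt0n.
pose a n := mean Q (fun z => cos (h z / root n)).
pose b n := mean Q (fun z => sin (h z / root n)).
have cr : n%:R * `|a n - r n| @[n --> \oo] --> 0.
  have c1 : n%:R * (r n - 1) @[n --> \oo] --> - v.
    apply: (@cvg_dist_sqrt _ _ _ (v ^+ 2)) => n n0.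
    have nr0 : 0 < n%:R :> R by rewrite ltr0n.
    have vn0 : 0 <= v / n%:R by rewrite divr_ge0.
    have -> : n%:R * (r n - 1) - - v = n%:R * (r n - 1 + v / n%:R).
      by field; rewrite gt_eqF.
    rewrite normrM ger0_norm// (le_trans (ler_wpM2l _ (norm_expRN_le vn0)))//.
    have -> : n%:R * (v / n%:R) ^+ 2 = v ^+ 2 / n%:R by field; rewrite gt_eqF.
    apply: ler_wpM2l; first exact: sqr_ge0.
    rewrite lef_pV2 ?posrE ?ltr0n ?root_gt0// -/(root n) -root_sqr expr2.
    exact: ler_peMr (ltW (root_gt0 n0)) (root_ge1 n0).
  have cv : n%:R * (1 - a n) + n%:R * (r n - 1) @[n --> \oo] --> v - v.
    exact: cvgD mean_cos_scaled_cvg c1.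
  move/cvg_norm: cv; rewrite subrr normr0.
  apply: cvg_trans; apply: near_eq_cvg; apply: nearW => n /=.
  rewrite -mulrDr normrM ger0_norm// -normrN; congr (_ * `|_|).
  by ring.
have cb : n%:R * `|b n| @[n --> \oo] --> 0.
  move/cvg_norm: mean_sin_scaled_cvg; rewrite normr0.
  apply: cvg_trans; apply: near_eq_cvg; apply: nearW => n /=.
  by rewrite normrM ger0_norm.
have cab : n%:R * (`|a n - r n| + `|b n|) @[n --> \oo] --> 0.
  have : n%:R * `|a n - r n| + n%:R * `|b n| @[n --> \oo] --> (0 + 0 : R).
    exact: cvgD cr cb.
  rewrite addr0.
  by apply: cvg_trans; apply: near_eq_cvg; apply: nearW => n /=; rewrite mulrDr.
apply/cvgrPdist_le => e e0; move/cvgr0_norm_le: cab => /(_ _ e0) cab.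
near=> n; have n0 : (0 < n)%N by near: n; exact: nbhs_infty_gt.
have hn : `|n%:R * (`|a n - r n| + `|b n|)| <= e by near: n.
rewrite distrC -(rn n n0).
apply: le_trans (le_trans (ler_norm _) hn).
rewrite (eq_mean (g := fun w => cos (\sum_(i < n) h (Z i w) / root n + s))); last first.
  by move=> w; rewrite mulrC mulr_suml.
rewrite (mean_cos_sum (@mZ n) (@indZ n) (@lawZ n) (mdiv n)).
apply: (mean_cos_rec_dist (@mZ n) (@indZ n) (@lawZ n) (mdiv n)) => //.
rewrite expR_ge0/= expR_le1 oppr_le0; exact: divr_ge0.
Unshelve. all: by end_near. Qed.

End CentralLimit.

(** * Gaussian vectors *)

Definition std_normal_pdf (R : realType) (x : R) : R := normal_pdf 0 1 x.
Arguments std_normal_pdf : simpl never.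

Section GaussianCosine.
Context (R : realType).
Notation mu := (@lebesgue_measure R).
Notation g := (@std_normal_pdf R).

Let gE x : g x = normal_peak 1 * expR (- (x ^+ 2 / 2)).
Proof.
rewrite /std_normal_pdf normal_pdfE ?oner_neq0// /normal_fun subr0 expr1n mulr2n mulNr.
by congr (_ * expR (- (_ / _))); ring.
Qed.

Let g_ge0 x : 0 <= g x. Proof. exact: normal_pdf_ge0. Qed.

Let mg : measurable_fun setT g. Proof. exact: measurable_normal_pdf. Qed.

Let ig : mu.-integrable setT (EFin \o g).
Proof. exact: integrable_normal_pdf. Qed.

Let g1 : \int[mu]_x g x = 1.
Proof. by rewrite /Rintegral [X in fine X](@integral_normal_pdf R 0 1). Qed.

(** The constant [3 / 8] is the gap between the exponents [x ^ 2 / 2] and [x ^ 2 / 8] of the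
    centered normal densities with standard deviations 1 and 2. A multiple of the second density
    then dominates [|x| g x], the majorant for differentiating under the integral. *)
Let norm_le_expR (x : R) : `|x| <= 4 / 3 * expR (3 / 8 * x ^+ 2).
Proof.
have := expR_ge1Dx (3 / 8 * x ^+ 2); rewrite -[x ^+ 2]real_normK ?num_real//.
by have := sqr_ge0 (`|x| - 1); nra.
Qed.

Let G (x : R) : R := `|x| * g x.

Let mG : measurable_fun setT G.
Proof. by apply: measurable_funM => //; exact: normr_measurable. Qed.

Let iG : mu.-integrable setT (EFin \o G).
Proof.
pose c : R := 4 / 3 * normal_peak 1 / normal_peak 2.
have p2 : 0 < normal_peak (2 : R) by exact: normal_peak_gt0.
have ig2 : mu.-integrable setT (fun x => (c%:E * (normal_pdf 0 2 x)%:E)%E).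
  exact/integrableZl/integrable_normal_pdf.
apply: (le_integrable _ _ _ ig2) => //; first exact/measurable_EFinP.
move=> x _; rewrite [leLHS]/= [leRHS]/= lee_fin.
have -> : `|G x| = `|x| * g x by rewrite /G normrM normr_id (ger0_norm (g_ge0 x)).
rewrite (le_trans _ (ler_norm _))// gE normal_pdfE// /normal_fun subr0.
have -> : c * (normal_peak 2 * expR (- x ^+ 2 / (2 ^+ 2 *+ 2))) =
    normal_peak 1 * (4 / 3 * expR (- x ^+ 2 / (2 ^+ 2 *+ 2))).
  by rewrite /c; field; rewrite gt_eqF.
rewrite mulrCA ler_wpM2l ?normal_peak_ge0//.
have -> : - x ^+ 2 / (2 ^+ 2 *+ 2) = 3 / 8 * x ^+ 2 + - (x ^+ 2 / 2) by field.
by rewrite expRD mulrA ler_wpM2r// expR_ge0.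
Qed.

#[local] Instance is_derive_g (x : R) : is_derive x 1 g (- (x * g x)).
Proof.
rewrite (_ : g = fun y => normal_peak 1 * expR (- (y ^+ 2 / 2))); last first.
  by apply/funext => y; exact: gE.
by apply: is_derive_eq; rewrite /GRing.scale/=; field.
Qed.

Section Phase.
Variable s : R.

Let phi (t : R) : R := \int[mu]_x (cos (t * x + s) * g x).

Let mtrig (u : R -> R) (mu' : measurable_fun setT u) (t : R) :
  measurable_fun setT (fun x : R => u (t * x + s)).
Proof.
by apply: measurableT_comp mu' _; apply: measurable_funD => //; exact: measurable_funM.
Qed.

Let icos t : mu.-integrable setT (EFin \o (fun x => cos (t * x + s) * g x)).
Proof.
apply: (le_integrable _ _ _ ig) => //.
  apply/measurable_EFinP; apply: measurable_funM => //.
  exact: mtrig (@measurable_cos R) t.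
by move=> x _ /=; rewrite lee_fin normrM ler_piMl// cos_max.
Qed.

Let ixsin t : mu.-integrable setT (EFin \o (fun x => x * sin (t * x + s) * g x)).
Proof.
apply: (le_integrable _ _ _ iG) => //.
  apply/measurable_EFinP; apply: measurable_funM => //; apply: measurable_funM => //.
  exact: mtrig (@measurable_sin R) t.
move=> x _ /=; rewrite lee_fin /G !normrM normr_id ler_wpM2r//.
by rewrite ler_piMr// sin_max.
Qed.

Let is_derive_cosg (t x : R) :
  is_derive t 1 (fun t => cos (t * x + s) * g x) (- (x * sin (t * x + s) * g x)).
Proof. by apply: is_derive_eq; rewrite /GRing.scale/=; ring. Qed.

Let is_derive_sing (t x : R) :
  is_derive x 1 (fun x => sin (t * x + s) * g x)
    (t * (cos (t * x + s) * g x) - x * sin (t * x + s) * g x).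
Proof. by apply: is_derive_eq; rewrite /GRing.scale/=; ring. Qed.

Let is_derive_phi (t : R) : is_derive t 1 phi (- \int[mu]_x (x * sin (t * x + s) * g x)).
Proof.
have p1 t' x : partial1of2 (fun t x : R => cos (t * x + s) * g x) t' x =
    - (x * sin (t' * x + s) * g x).
  by rewrite partial1of2E; exact: derive_val.
have It : [set` `](t - 1), (t + 1)[%R] t by rewrite /= in_itv/=; lra.
have der t' x : [set` `](t - 1), (t + 1)[%R] t' -> [set: R] x ->
    derivable (fun u : R => cos (u * x + s) * g x) t' 1.
  by move=> _ _; exact: ex_derive.
have ub t' x : [set` `](t - 1), (t + 1)[%R] t' -> [set: R] x ->
    `|partial1of2 (fun t x : R => cos (t * x + s) * g x) t' x| <= G x.
  move=> _ _; rewrite p1 normrN /G !normrM [`|g x|]ger0_norm// ler_wpM2r//.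
  by rewrite ler_piMr// sin_max.
have G0 x : 0 <= G x by rewrite /G mulr_ge0.
have d1 := @derivable_under_integral R _ _ mu (fun t x : R => cos (t * x + s) * g x)
  setT measurableT t _ _ It (fun t' _ => icos t') der G G0 iG ub.
have d2 := @differentiation_under_integral R _ _ mu (fun t x : R => cos (t * x + s) * g x)
  setT measurableT t _ _ It (fun t' _ => icos t') der G G0 iG ub.
apply: DeriveDef => //; rewrite -derive1E d2.
under eq_Rintegral do rewrite p1.
rewrite -[RHS]mulN1r -RintegralZl//; apply: eq_Rintegral => x _.
by rewrite mulN1r.
Qed.

Let H (t x : R) : R := t * (cos (t * x + s) * g x) - x * sin (t * x + s) * g x.

Let iH t : mu.-integrable setT (EFin \o H t).
Proof.
by have := integrableB measurableT (integrableZl measurableT t (icos t)) (ixsin t).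
Qed.

Let cvg_g0 : g n%:R @[n --> \oo] --> 0.
Proof.
apply: (@cvg_dist_sqrt _ _ _ (normal_peak 1)) => n n0.
rewrite subr0 ger0_norm// gE ler_wpM2l ?normal_peak_ge0//.
rewrite expRN lef_pV2 ?posrE ?expR_gt0 ?sqrtr_gt0 ?ltr0n//.
rewrite (le_trans _ (expR_ge1Dx _))//.
have : Num.sqrt n%:R <= n%:R :> R.
  rewrite -[leRHS]sqr_sqrtr// expr2 ler_peMr ?sqrtr_ge0//.
  by rewrite -[leLHS]sqrtr1 ler_sqrt ?ler1n// ltr0n.
by have := sqr_ge0 (n%:R - 1 : R); nra.
Qed.

Let g_even x : g (- x) = g x.
Proof. by rewrite !gE sqrrN. Qed.

(** Integration by parts: [H t] is the derivative of [F], so its integral over [[-n, n]] is a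
    boundary term of size at most [2 g n]; dominated convergence extends this to the line. *)
Let integral_H t : \int[mu]_x H t x = 0.
Proof.
pose F x := sin (t * x + s) * g x.
pose A (n : nat) := `[(- n%:R)%R, n%:R]%classic : set R.
have mH : measurable_fun setT (H t) by have /measurable_int/measurable_EFinP := iH t.
have cH : continuous (H t).
  move=> x; rewrite /H; apply: differentiable_continuous.
  apply/derivable1_diffP; exact: ex_derive.
have E (n : nat) : (0 < n)%N ->
    (\int[mu]_(x in A n) (H t x)%:E = (F n%:R)%:E - (F (- n%:R))%:E)%E.
  move=> n0; apply: continuous_FTC2.
  - by rewrite (@lt_le_trans _ _ 0)// oppr_lt0 ltr0n.
  - exact: continuous_subspaceT.
  - have cF y : {for y, continuous F}.
      apply: differentiable_continuous.
      by apply/derivable1_diffP; have [] := is_derive_sing t y.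
    split.
    + by move=> y _; have [] := is_derive_sing t y.
    + exact/cvg_at_right_filter/cF.
    + exact/cvg_at_left_filter/cF.
  - by move=> y _; have dF := is_derive_sing t y; rewrite derive1E; exact: derive_val.
have mA n : measurable (A n) by exact: measurable_itv.
pose h_ (n : nat) x := (H t x * \1_(A n) x)%:E.
have mh_ n : measurable_fun setT (h_ n).
  by apply/measurable_EFinP; apply: measurable_funM => //; exact: measurable_indic.
have h_cv : {ae mu, forall x, setT x -> h_ n x @[n --> \oo] --> (H t x)%:E}.
  apply: aeW => x _; apply: cvg_near_cst; near=> n.
  have Anx : A n x by rewrite /A/= in_itv/= -ler_norml; near: n; exact: nbhs_infty_ger.
  by rewrite /h_ indicE mem_set// mulr1.
have h_le : {ae mu, forall x n, setT x -> (`|h_ n x| <= `|(H t x)%:E|)%E}.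
  apply: aeW => x n _; rewrite /h_ /= lee_fin normrM ler_piMr// norm_indic_le1//.
have [_ _ cv] := @dominated_convergence _ _ _ mu setT measurableT h_
  (fun x => (H t x)%:E) (fun x => `|(H t x)%:E|%E) mh_ (ltac:(exact/measurable_EFinP))
  h_cv (integrable_abse (iH t)) h_le.
have F0 : (F n%:R - F (- n%:R)) @[n --> \oo] --> (0 : R).
  have g2 : 2 * g n%:R @[n --> \oo] --> (2 * 0 : R) by apply: cvgMr; exact: cvg_g0.
  rewrite mulr0 in g2; apply/cvgr0Pnorm_le => e e0.
  move/cvgr0_norm_le : g2 => /(_ _ e0); apply: filterS => n.
  apply: le_trans; rewrite [leRHS]ger0_norm ?mulr_ge0//.
  rewrite (le_trans (ler_normB _ _))// /F g_even mulr_natl mulr2n.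
  by rewrite !normrM (ger0_norm (g_ge0 _)) lerD// ler_piMl// sin_max.
rewrite /Rintegral (_ : (\int[mu]_x (H t x)%:E)%E = 0%E)//.
apply: cvg_unique cv _ => //.
have cF : (F n%:R - F (- n%:R))%:E @[n --> \oo] --> 0%E.
  by apply: cvg_EFin; [exact: nearW|exact: F0].
apply: cvg_trans cF; apply: near_eq_cvg; near=> n.
have n0 : (0 < n)%N by near: n; exact: nbhs_infty_gt.
rewrite /= EFinB -E// integral_mkcond; apply: eq_integral => x _.
by rewrite /h_ patchE indicE; case: (x \in A n); rewrite ?mulr1// mulr0.
Unshelve. all: by end_near. Qed.

(** Differentiation under the integral and integration by parts give [phi' t = - t phi t]. Hence
    [phi t] times [expR (t ^ 2 / 2)] is constant, equal to its value [cos s] at 0. *)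
Lemma integral_cos_normal_pdf t :
  \int[mu]_x (cos (t * x + s) * g x) = expR (- (t ^+ 2 / 2)) * cos s.
Proof.
have phiE u : - (\int[mu]_x (x * sin (u * x + s) * g x)) = - (u * phi u).
  apply/eqP; rewrite eqr_opp -subr_eq0 -oppr_eq0 opprB; apply/eqP.
  rewrite -(integral_H u) /H RintegralB//; last first.
    by have := integrableZl measurableT u (icos u).
  by rewrite RintegralZl.
pose f u := phi u * expR (u ^+ 2 / 2).
have df (u : R) : is_derive u 1 f 0.
  have := is_derive_phi u; rewrite phiE => dphi.
  by apply: is_derive_eq; rewrite /GRing.scale/=; field.
have := is_derive_0_is_cst t 0 df; rewrite /f => E.
rewrite -/(phi t) expRN -[LHS](mulfK (lt0r_neq0 (expR_gt0 (t ^+ 2 / 2)))) E.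
rewrite expr0n/= mul0r expR0 mulr1 mulrC; congr (_ * _); rewrite /phi.
under eq_Rintegral do rewrite mul0r add0r.
by rewrite RintegralZl// /Rintegral integral_normal_pdf mulr1.
Qed.

End Phase.

(** The normal law is given by integrals of its density over sets, that is, on indicators; linearity
    and uniform limits carry the formula to bounded functions. *)
Lemma mean_normal_prob (f : R -> R) (M : R) : measurable_fun setT f ->
  (forall x, `|f x| <= M) ->
  mean (normal_prob 0 1 : probability _ R) f = \int[mu]_x (f x * g x).
Proof.
move=> mf fM.
have ifg (h : R -> R) (B : R) : measurable_fun setT h -> (forall x, `|h x| <= B) ->
    mu.-integrable setT (EFin \o (fun x => h x * g x)).
  move=> mh hB; have iB := integrableZl measurableT B ig.
  apply: (le_integrable _ _ _ iB) => //.
    by apply/measurable_EFinP; exact: measurable_funM.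
  move=> x _ /=; rewrite lee_fin !normrM ler_wpM2r//.
  exact: le_trans (hB x) (ler_norm _).
pose N : probability _ R := normal_prob 0 1.
pose S (h : R -> R) := [/\ measurable_fun setT h,
  exists B : R, forall x, `|h x| <= B & mean N h = \int[mu]_x (h x * g x)].
suff [] : S f by [].
apply: (bounded_measurable_ind (M := M)) mf fM => [A mA|a h k|h mh he].
- split; [exact: measurable_indic|by exists 1 => x; exact: norm_indic_le1|].
  rewrite mean_indic//; congr fine; rewrite /N/= /normal_prob integral_mkcond.
  apply: eq_integral => x _; rewrite patchE indicE.
  by case: (x \in A); rewrite ?mul1r ?mul0r.
- move=> [mh [Bh hB] Eh] [mk [Bk kB] Ek]; split.
  + by apply: measurable_funD => //; exact: measurable_funM.
  + exists (`|a| * Bh + Bk) => x; rewrite (le_trans (ler_normD _ _))//.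
    by rewrite lerD// normrM ler_wpM2l.
  + have ih : integrable_fun N h := @integrable_bounded _ _ _ N h Bh mh hB.
    have ik : integrable_fun N k := @integrable_bounded _ _ _ N k Bk mk kB.
    rewrite meanD ?meanZ//; last exact: integrable_funZ.
    rewrite Eh Ek.
    under [RHS]eq_Rintegral do rewrite mulrDl -mulrA.
    rewrite RintegralD//; last 2 first.
    * by have := integrableZl measurableT a (ifg _ _ mh hB).
    * exact: ifg mk kB.
    by rewrite RintegralZl//; exact: ifg mh hB.
- have [k [mk [Bk kB] _] hk] := he 1 ltr01.
  have hB x : `|h x| <= 1 + Bk.
    by rewrite -(subrK (k x) (h x)) (le_trans (ler_normD _ _))// lerD.
  split=> //; first by exists (1 + Bk).
  apply/eqP; rewrite -subr_eq0 -normr_eq0; apply/eqP/le_anti.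
  rewrite normr_ge0 andbT; apply/ler_addgt0Pr => e e0; rewrite add0r.
  have e2 : 0 < e / 2 by rewrite divr_gt0.
  have [q [mq [Bq qB] Eq] hq] := he (e / 2) e2.
  have mhq : measurable_fun setT (fun x => h x - q x) by exact: measurable_funB.
  have -> : mean N h - \int[mu]_x (h x * g x) =
      mean N (fun x => h x - q x) - \int[mu]_x ((h x - q x) * g x).
    have ih : integrable_fun N h := @integrable_bounded _ _ _ N h _ mh hB.
    have iq : integrable_fun N q := @integrable_bounded _ _ _ N q Bq mq qB.
    have -> : \int[mu]_x ((h x - q x) * g x) =
        \int[mu]_x (h x * g x) - \int[mu]_x (q x * g x).
      rewrite -RintegralB//; [|exact: ifg mh hB|exact: ifg mq qB].
      by apply: eq_Rintegral => x _; rewrite mulrBl.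
    by rewrite meanB// Eq; ring.
  rewrite (le_trans (ler_normB _ _))// [leRHS](_ : _ = e / 2 + e / 2); last by field.
  apply: lerD; first exact: mean_norm_le.
  have ihq := ifg _ _ mhq hq.
  rewrite (le_trans (le_normr_Rintegral _ ihq))//.
  have -> : e / 2 = \int[mu]_x (e / 2 * g x).
    by rewrite RintegralZl// g1 mulr1.
  apply: le_Rintegral => //.
  - by apply: integrable_norm.
  - by have := integrableZl measurableT (e / 2) ig.
  - by move=> x _; rewrite normrM (ger0_norm (g_ge0 _)) ler_wpM2r.
Qed.

Lemma mean_cos_normal (t s : R) :
  mean (normal_prob 0 1 : probability _ R) (fun x => cos (t * x + s)) =
  expR (- (t ^+ 2 / 2)) * cos s.
Proof.
rewrite -integral_cos_normal_pdf; apply: mean_normal_prob; last by move=> x; exact: cos_max.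
apply: measurableT_comp (@measurable_cos R) _.
by apply: measurable_funD => //; exact: measurable_funM.
Qed.

End GaussianCosine.

(** * Dot products, Cholesky factorization and Gaussian vectors *)

Section DotProduct.
Context (R : realType).

Definition dot n (u v : 'cV[R]_n) : R := \sum_i u i 0 * v i 0.

Lemma dotE n (u v : 'cV[R]_n) : dot u v = (u^T *m v) 0 0.
Proof. by rewrite mxE; apply: eq_bigr => i _; rewrite mxE. Qed.

Lemma dotC n (u v : 'cV[R]_n) : dot u v = dot v u.
Proof. by apply: eq_bigr => i _; rewrite mulrC. Qed.

Lemma dotDl n (u v w : 'cV[R]_n) : dot (u + v) w = dot u w + dot v w.
Proof. by rewrite -big_split; apply: eq_bigr => i _; rewrite mxE mulrDl. Qed.

Lemma dotDr n (u v w : 'cV[R]_n) : dot w (u + v) = dot w u + dot w v.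
Proof. by rewrite !(dotC w) dotDl. Qed.

Lemma dotZl n (a : R) (u v : 'cV[R]_n) : dot (a *: u) v = a * dot u v.
Proof. by rewrite mulr_sumr; apply: eq_bigr => i _; rewrite mxE mulrA. Qed.

Lemma dotZr n (a : R) (u v : 'cV[R]_n) : dot v (a *: u) = a * dot v u.
Proof. by rewrite !(dotC v) dotZl. Qed.

Lemma dotNl n (u v : 'cV[R]_n) : dot (- u) v = - dot u v.
Proof. by rewrite -scaleN1r dotZl mulN1r. Qed.

Lemma dotNr n (u v : 'cV[R]_n) : dot v (- u) = - dot v u.
Proof. by rewrite !(dotC v) dotNl. Qed.

Lemma dotBl n (u v w : 'cV[R]_n) : dot (u - v) w = dot u w - dot v w.
Proof. by rewrite dotDl dotNl. Qed.

Lemma dotBr n (u v w : 'cV[R]_n) : dot w (u - v) = dot w u - dot w v.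
Proof. by rewrite dotDr dotNr. Qed.

Lemma dot0l n (v : 'cV[R]_n) : dot 0 v = 0.
Proof. by rewrite -(scale0r 0) dotZl mul0r. Qed.

Lemma dot0r n (v : 'cV[R]_n) : dot v 0 = 0.
Proof. by rewrite dotC dot0l. Qed.

Lemma dot_mulmx m n (A : 'M[R]_(m, n)) u v : dot u (A *m v) = dot (A^T *m u) v.
Proof. by rewrite !dotE trmx_mul trmxK mulmxA. Qed.

Lemma dot_ge0 n (u : 'cV[R]_n) : 0 <= dot u u.
Proof. by apply: sumr_ge0 => i _; rewrite -expr2 sqr_ge0. Qed.

Lemma dot_eq0 n (u : 'cV[R]_n) : dot u u = 0 -> u = 0.
Proof.
move/eqP; rewrite psumr_eq0 => [/allP u0|i _]; last by rewrite -expr2 sqr_ge0.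
apply/colP => i; rewrite mxE; apply/eqP.
by have := u0 i (mem_index_enum _); rewrite /= mulf_eq0 orbb.
Qed.

Lemma posdefmx_dot_gt0 n (A : 'M[R]_n) v : posdefmx A -> v != 0 -> 0 < dot v (A *m v).
Proof. by move=> [_ A0] /A0; rewrite dotE mulmxA. Qed.

Lemma dot_col_mx m n (a c : 'cV[R]_m) (b d : 'cV[R]_n) :
  dot (col_mx a b) (col_mx c d) = dot a c + dot b d.
Proof.
rewrite /dot big_split_ord/=; congr (_ + _); apply: eq_bigr => i _.
  by rewrite !col_mxEu.
by rewrite !col_mxEd.
Qed.

End DotProduct.

Section Cholesky.
Context (R : realType).

(** Cholesky factorization by induction on the dimension, through the Schur complement of the first
    diagonal entry. It ensures that the matrix picked in [mvnormal] is a genuine square root. *)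
Lemma posdefmx_factor n (V : 'M[R]_n) : posdefmx V -> exists A : 'M[R]_n, A *m A^T = V.
Proof.
elim: n V => [|n IHn] V Vpd; first by exists 0; apply/matrixP => -[].
have [Vsym _] := Vpd; move: V Vpd Vsym; rewrite -[n.+1]add1n => V Vpd Vsym.
pose a := V 0 0; pose b := dlsubmx V; pose C := drsubmx V.
have Va : ulsubmx V = a%:M.
  by apply/matrixP => i j; rewrite !ord1 !mxE eqxx mulr1n; congr (V _ _); exact/val_inj.
have Vb : ursubmx V = b^T by rewrite /b -[in RHS]Vsym -trmx_ursub trmxK.
have VE : V = block_mx a%:M b^T b C by rewrite -Va -Vb submxK.
have VX (c : 'cV[R]_1) (v : 'cV[R]_n) :
    dot (col_mx c v) (V *m col_mx c v) =
    a * c 0 0 ^+ 2 + 2 * c 0 0 * dot b v + dot v (C *m v).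
  rewrite VE mul_block_col dot_col_mx !dotDr mul_scalar_mx dotZr.
  have -> : dot c c = c 0 0 ^+ 2 by rewrite /dot big_ord1 expr2.
  have -> : dot c (b^T *m v) = c 0 0 * dot b v.
    by rewrite /dot big_ord1 mxE; congr (_ * _); apply: eq_bigr => i _; rewrite mxE.
  have -> : dot v (b *m c) = c 0 0 * dot b v.
    by rewrite dotC [c]mx11_scalar mul_mx_scalar dotZl mxE eqxx mulr1n.
  ring.
have a0 : 0 < a.
  have c0 : col_mx (1%:M : 'cV[R]_1) (0 : 'cV[R]_n) != 0.
    apply/eqP => /colP/(_ (lshift n 0)); rewrite col_mxEu !mxE mulr1n => /eqP.
    by rewrite oner_eq0.
  have := posdefmx_dot_gt0 Vpd c0.
  by rewrite VX mulmx0 !dot0r mxE mulr1n expr1n mulr1 mulr0 !addr0.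
pose S := C - a^-1 *: (b *m b^T).
have [|A' A'E] := IHn S.
  split.
    have Csym : C^T = C by rewrite /C -[in RHS]Vsym trmx_drsub.
    by rewrite /S linearB/= linearZ/= trmx_mul trmxK Csym.
  move=> v v0; rewrite -mulmxA -dotE.
  (* This first coordinate minimizes the quadratic form for [v] fixed, and the minimum is the form
     of the Schur complement; positivity of [V] thus passes to [S]. *)
  pose c : 'cV[R]_1 := (- (dot b v / a))%:M.
  have cv0 : col_mx c v != 0.
    by apply: contra v0 => /eqP cv; rewrite -[v](col_mxKd c) cv linear0.
  have := posdefmx_dot_gt0 Vpd cv0; rewrite VX.
  have -> : c 0 0 = - (dot b v / a) by rewrite mxE eqxx mulr1n.
  rewrite /S mulmxBl dotBr -scalemxAl dotZr -mulmxA [dot v (b *m _)]dot_mulmx.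
  have -> : dot (b^T *m v) (b^T *m v) = dot b v ^+ 2.
    rewrite /dot big_ord1 -expr2; congr (_ ^+ 2); rewrite mxE.
    by apply: eq_bigr => i _; rewrite mxE.
  congr (0 < _); by field; rewrite gt_eqF.
pose r := Num.sqrt a; have r0 : 0 < r by rewrite sqrtr_gt0.
have rr : r * r = a by rewrite -expr2 sqr_sqrtr// ltW.
exists (block_mx r%:M 0 (r^-1 *: b) A').
rewrite tr_block_mx mulmx_block VE !trmx0 !mulmx0 !mul0mx !addr0 tr_scalar_mx.
rewrite -scalar_mxM rr A'E linearZ/= mul_scalar_mx scalerA divff ?gt_eqF// scale1r.
rewrite mul_mx_scalar scalerA divff ?gt_eqF// scale1r -scalemxAl -scalemxAr scalerA.
by rewrite -invfM rr /S addrC subrK.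
Qed.

End Cholesky.

Section GaussianVectorCosine.
Context (R : realType).

Lemma measurable_dot d (T : measurableType d) n (t : 'cV[R]_n) (f : T -> 'cV[R]_n) :
  measurable_fun setT f -> measurable_fun setT (fun w => dot t (f w)).
Proof.
move=> mf; apply: measurable_sum => i; apply: measurable_funM => //.
exact: measurableT_comp (measurable_entry i 0) mf.
Qed.

Lemma measurable_cos_dot d (T : measurableType d) n (t : 'cV[R]_n) (s : R)
    (f : T -> 'cV[R]_n) :
  measurable_fun setT f -> measurable_fun setT (fun w => cos (dot t (f w) + s)).
Proof.
move=> mf; apply: measurableT_comp (@measurable_cos R) _.
by apply: measurable_funD => //; exact: measurable_dot.
Qed.

(** The first coordinate is integrated by Fubini while the others are fixed; their contribution to
    the dot product is absorbed in the phase of the one-dimensional formula, which is why [s] is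
    arbitrary. *)
Lemma mean_cos_std_normal_cv K (t : 'cV[R]_K) (s : R) :
  mean (std_normal_cv R K) (fun v => cos (dot t v + s)) =
  expR (- (dot t t / 2)) * cos s.
Proof.
elim: K t s => [|K IHK] t s.
  rewrite /Rintegral integral_dirac//; last first.
    exact/measurable_EFinP/measurable_cos_dot.
  by rewrite diracT mul1e /dot !big_ord0 mul0r oppr0 expR0 mul1r add0r.
have dotE' (z : measurableTypeR R * 'cV[R]_K) : dot t (cons_cv z) =
    (t : 'cV_(1 + K)) 0 0 * z.1 + dot (dsubmx (t : 'cV_(1 + K))) z.2.
  have E := dot_col_mx (usubmx (t : 'cV_(1 + K))) (const_mx z.1 : 'cV_1)
    (dsubmx (t : 'cV_(1 + K))) z.2.
  rewrite vsubmxK in E; apply: (etrans E); congr (_ + _).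
  by rewrite /dot big_ord1 !mxE; congr (t _ _ * _); exact/val_inj.
set t0 := (t : 'cV_(1 + K)) 0 0 in dotE' *; set t' := dsubmx _ in dotE' *.
have mc : measurable_fun setT (fun z => cos (dot t (@cons_cv R K z) + s)).
  exact: measurable_cos_dot (@measurable_cons_cv R K).
have ic : integrable_fun (normal_prob 0 1 \x std_normal_cv R K)%E
    (fun z => cos (dot t (cons_cv z) + s)).
  by apply: (integrable_bounded (M := 1)) => // w; exact: cos_max.
rewrite /Rintegral/= integral_distribution//; last first.
  by apply/measurable_EFinP; apply: measurable_cos_dot; exact: measurable_id.
rewrite /comp -integral21_prod_meas1//.
rewrite (eq_integral (fun v => (expR (- (t0 ^+ 2 / 2)) * cos (dot t' v + s))%:E)).
  rewrite -/(Rintegral _ _ _) meanZ; last first.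
    apply: (integrable_bounded (M := 1)) => [|w]; last exact: cos_max.
    exact: measurable_cos_dot (@measurable_id _ _ setT).
  rewrite IHK mulrA -expRD; congr (expR _ * _).
  have -> : dot t t = t0 ^+ 2 + dot t' t'.
    have E := dot_col_mx (usubmx (t : 'cV_(1 + K))) (usubmx (t : 'cV_(1 + K))) t' t'.
    rewrite vsubmxK in E; apply: (etrans E); congr (_ + _).
    by rewrite /dot big_ord1 !mxE expr2; congr (t _ _ * t _ _); exact/val_inj.
  by field.
move=> v _; rewrite /fubini_G/=.
under eq_integral do rewrite dotE'/= -addrA.
rewrite integral_mean ?mean_cos_normal//.
apply: (integrable_bounded (M := 1)) => [|w]; last exact: cos_max.
apply: measurableT_comp (@measurable_cos R) _.
by apply: measurable_funD => //; exact: measurable_funM.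
Qed.

Lemma mean_cos_mvnormal K (V : 'M[R]_K) (t : 'cV[R]_K) (s : R) : posdefmx V ->
  mean (mvnormal 0 V) (fun v => cos (dot t v + s)) =
  expR (- (dot t (V *m t) / 2)) * cos s.
Proof.
move=> Vpd; rewrite /Rintegral integral_distribution; last 2 first.
- by apply/measurable_EFinP; apply: measurable_cos_dot; exact: measurable_id.
- apply: (integrable_bounded (M := 1)) => [|w]; last exact: cos_max.
  exact: measurable_cos_dot (@measurable_affine_cv R K 0 _).
set A := xget _ _.
have AE : A *m A^T = V.
  by have [B BE] := posdefmx_factor Vpd; exact: (@xgetPex _ 0 [set A : 'M[R]_K | A *m A^T = V] (ex_intro _ B BE)).
rewrite -/(Rintegral _ _ _) -AE -mulmxA dot_mulmx -mean_cos_std_normal_cv.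
by apply: eq_mean => v /=; rewrite /affine_cv add0r dot_mulmx.
Qed.

End GaussianVectorCosine.

(** * Convergence in distribution from cosines *)

Section MatrixNorm.
Context (R : realType).

(** The norm of a matrix is the largest absolute value of its entries, that is, the sup norm of the
    model. *)
Lemma norm_mx_entry m n (A : 'M[R]_(m, n)) i j : `|A i j| <= `|A|.
Proof.
by rewrite [leRHS]/Num.norm/= mx_normrE (le_trans _ (le_bigmax _ _ (i, j))).
Qed.

Lemma norm_mx_le m n (A : 'M[R]_(m, n)) (a : R) :
  0 <= a -> (forall i j, `|A i j| <= a) -> `|A| <= a.
Proof.
by move=> a0 h; rewrite [leLHS]/Num.norm/= mx_normrE; apply: bigmax_le => // -[i j] _; exact: h.
Qed.

Lemma norm_mx_lt m n (A : 'M[R]_(m, n)) (a : R) :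
  0 < a -> (forall i j, `|A i j| < a) -> `|A| < a.
Proof.
by move=> a0 h; rewrite [ltLHS]/Num.norm/= mx_normrE; apply: bigmax_lt => // -[i j] _; exact: h.
Qed.

Lemma measurable_mx_norm d (T : measurableType d) m n (f : T -> 'M[R]_(m, n)) :
  measurable_fun setT f -> measurable_fun setT (fun w => `|f w|).
Proof.
move=> mf; rewrite (_ : (fun _ => _) = fun w =>
    \big[Num.max/0]_(ij <- index_enum ('I_m * 'I_n)%type) `|f w ij.1 ij.2|); last first.
  by apply/funext => w; rewrite [LHS]/Num.norm/= mx_normrE.
elim: (index_enum _) => [|ij s IHs].
  by under eq_fun do rewrite big_nil; exact: measurable_cst.
under eq_fun do rewrite big_cons; apply: measurable_maxr => //.
apply: measurableT_comp => //.
exact: measurableT_comp (measurable_entry ij.1 ij.2) mf.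
Qed.

End MatrixNorm.

Section BernsteinWeights.
Context (R : realType).
Implicit Types x : R.

(* the probability that a binomial (N, x) variable equals i *)
Fixpoint binomial_weight x (N i : nat) : R :=
  if N is N'.+1 then
    x * (if i is j.+1 then binomial_weight x N' j else 0) +
    (1 - x) * binomial_weight x N' i
  else (i == 0%N)%:R.

Lemma binomial_weight_ge0 x N i : 0 <= x <= 1 -> 0 <= binomial_weight x N i.
Proof.
move=> /andP[x0 x1]; elim: N i => [|N IHN] i /=; first exact: ler0n.
by case: i => [|i]; rewrite addr_ge0// mulr_ge0// ?subr_ge0.
Qed.

Lemma binomial_weight_gt x N i : (N < i)%N -> binomial_weight x N i = 0.
Proof.
elim: N i => [|N IHN] [|i]//= Ni; rewrite !IHN ?mulr0 ?addr0//.
exact: ltn_trans Ni.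
Qed.

(** Conditioning on one of the [N + 1] trials: with probability [x] it succeeds and shifts the
    argument of [h]. The first two moments follow from this recursion without binomial
    coefficients. *)
Lemma sum_binomial_weightS x N (h : nat -> R) :
  \sum_(i < N.+2) binomial_weight x N.+1 i * h i =
  x * (\sum_(i < N.+1) binomial_weight x N i * h i.+1) +
  (1 - x) * (\sum_(i < N.+1) binomial_weight x N i * h i).
Proof.
have -> : \sum_(i < N.+1) binomial_weight x N i * h i =
    \sum_(i < N.+2) binomial_weight x N i * h i.
  by rewrite [RHS]big_ord_recr/= binomial_weight_gt ?mul0r ?addr0.
have -> : \sum_(i < N.+1) binomial_weight x N i * h i.+1 =
    \sum_(i < N.+2) (if nat_of_ord i is j.+1 then binomial_weight x N j else 0) * h i.
  by rewrite [RHS]big_ord_recl/= mul0r add0r.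
rewrite !mulr_sumr -big_split/=; apply: eq_bigr => i _.
by rewrite mulrDl !mulrA.
Qed.

Lemma sum_binomial_weight x N : \sum_(i < N.+1) binomial_weight x N i = 1.
Proof.
elim: N => [|N IHN]; first by rewrite big_ord1.
have := sum_binomial_weightS x N (fun=> 1).
under eq_bigr do rewrite mulr1; move=> ->.
under eq_bigr do rewrite mulr1; rewrite IHN; ring.
Qed.

Lemma sum_binomial_weight_mean x N :
  \sum_(i < N.+1) binomial_weight x N i * (i%:R - N%:R * x) = 0.
Proof.
elim: N => [|N IHN]; first by rewrite big_ord1/= mul0r subr0 mulr0.
rewrite (sum_binomial_weightS x N (fun i => i%:R - N.+1%:R * x)).
have E (h : nat -> R) (a : R) : (forall i, h i = i%:R - N%:R * x + a) ->
    \sum_(i < N.+1) binomial_weight x N i * h i = a.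
  move=> hE; under eq_bigr do rewrite hE mulrDr.
  by rewrite big_split/= IHN add0r -mulr_suml sum_binomial_weight mul1r.
rewrite (E (fun i => i.+1%:R - N.+1%:R * x) (1 - x)); last first.
  by move=> i; rewrite -!natr1; ring.
rewrite (E (fun i => i%:R - N.+1%:R * x) (- x)); first by ring.
by move=> i; rewrite -!natr1; ring.
Qed.

Lemma sum_binomial_weight_var x N :
  \sum_(i < N.+1) binomial_weight x N i * (i%:R - N%:R * x) ^+ 2 =
  N%:R * (x * (1 - x)).
Proof.
elim: N => [|N IHN]; first by rewrite big_ord1/= mul0r subr0 expr0n/= mulr0 mul0r.
rewrite (sum_binomial_weightS x N (fun i => (i%:R - N.+1%:R * x) ^+ 2)).
have E (h : nat -> R) (a : R) : (forall i, h i = i%:R - N%:R * x + a) ->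
    \sum_(i < N.+1) binomial_weight x N i * h i ^+ 2 =
    N%:R * (x * (1 - x)) + a ^+ 2.
  move=> hE; under eq_bigr => i _.
    rewrite hE (_ : _ * _ = binomial_weight x N i * (i%:R - N%:R * x) ^+ 2 +
      (2 * a * (binomial_weight x N i * (i%:R - N%:R * x)) +
       a ^+ 2 * binomial_weight x N i)); last by ring.
    over.
  rewrite big_split big_split/= IHN -!mulr_sumr sum_binomial_weight_mean.
  by rewrite sum_binomial_weight; ring.
rewrite (E (fun i => i.+1%:R - N.+1%:R * x) (1 - x)); last first.
  by move=> i; rewrite -!natr1; ring.
rewrite (E (fun i => i%:R - N.+1%:R * x) (- x)); first by rewrite -natr1; ring.
by move=> i; rewrite -!natr1; ring.
Qed.

End BernsteinWeights.

Section TrigonometricPolynomials.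
Context (R : realType) (K : nat).
Implicit Types f g : 'cV[R]_K -> R.

(** The free phases make sines members of the class and turn a product of two cosines into a sum of
    two members, so the class is an algebra. *)
Definition trig_poly f := exists L : seq (R * 'cV[R]_K * R),
  forall v, f v = \sum_(p <- L) p.1.1 * cos (dot p.1.2 v + p.2).

Lemma trig_poly_ext f g : f =1 g -> trig_poly f -> trig_poly g.
Proof. by move=> fg [L fL]; exists L => v; rewrite -fg. Qed.

Lemma trig_poly_cos c t s : trig_poly (fun v => c * cos (dot t v + s)).
Proof. by exists [:: (c, t, s)] => v; rewrite big_seq1. Qed.

Lemma trig_poly_cst c : trig_poly (fun=> c).
Proof.
apply: trig_poly_ext (trig_poly_cos c 0 0) => v.
by rewrite dot0l addr0 cos0 mulr1.
Qed.

Lemma trig_polyD f g : trig_poly f -> trig_poly g -> trig_poly (fun v => f v + g v).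
Proof. by move=> [L fL] [L' gL]; exists (L ++ L') => v; rewrite big_cat/= fL gL. Qed.

Lemma trig_poly_sum (I : Type) (r : seq I) (f : I -> 'cV[R]_K -> R) :
  (forall i, trig_poly (f i)) -> trig_poly (fun v => \sum_(i <- r) f i v).
Proof.
move=> hf; elim: r => [|i r IHr].
  by apply: trig_poly_ext (trig_poly_cst 0) => v; rewrite big_nil.
by apply: trig_poly_ext (trig_polyD (hf i) IHr) => v; rewrite big_cons.
Qed.

Lemma trig_polyM f g : trig_poly f -> trig_poly g -> trig_poly (fun v => f v * g v).
Proof.
move=> [L fL] [L' gL].
have := trig_poly_sum L (fun p => trig_poly_sum L' (fun q => trig_polyD
  (trig_poly_cos (p.1.1 * q.1.1 / 2) (p.1.2 + q.1.2) (p.2 + q.2))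
  (trig_poly_cos (p.1.1 * q.1.1 / 2) (p.1.2 - q.1.2) (p.2 - q.2)))).
apply: trig_poly_ext => v; rewrite fL gL mulr_suml; apply: eq_bigr => p _.
rewrite mulr_sumr; apply: eq_bigr => q _; rewrite dotDl dotBl.
set a := dot p.1.2 v; set b := dot q.1.2 v.
have -> : a + b + (p.2 + q.2) = (a + p.2) + (b + q.2) by ring.
have -> : a - b + (p.2 - q.2) = (a + p.2) - (b + q.2) by ring.
by rewrite cosB cosD; field.
Qed.

Lemma trig_poly_prod (I : Type) (r : seq I) (f : I -> 'cV[R]_K -> R) :
  (forall i, trig_poly (f i)) -> trig_poly (fun v => \prod_(i <- r) f i v).
Proof.
move=> hf; elim: r => [|i r IHr].
  by apply: trig_poly_ext (trig_poly_cst 1) => v; rewrite big_nil.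
by apply: trig_poly_ext (trig_polyM (hf i) IHr) => v; rewrite big_cons.
Qed.

Lemma trig_poly_binomial_weight f N i : trig_poly f ->
  trig_poly (fun v => binomial_weight (f v) N i).
Proof.
move=> hf; elim: N i => [|N IHN] i /=; first exact: trig_poly_cst.
apply: trig_polyD.
  by apply: trig_polyM => //; case: i => [|i]; [exact: trig_poly_cst|exact: IHN].
apply: trig_polyM => //; apply: trig_polyD; first exact: trig_poly_cst.
by apply: trig_poly_ext (trig_polyM (trig_poly_cst (-1)) hf) => v; rewrite mulN1r.
Qed.

Lemma measurable_trig_poly f : trig_poly f -> measurable_fun setT f.
Proof.
move=> [L fL]; rewrite (_ : f = fun v => \sum_(p <- L) p.1.1 * cos (dot p.1.2 v + p.2)).
  apply: measurable_sum => p; apply: measurable_funM => //.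
  exact: measurable_cos_dot (@measurable_id _ _ setT).
exact/funext.
Qed.

End TrigonometricPolynomials.

Section UniformContinuity.
Context (R : realType) (K : nat).

Lemma uniform_continuity_box (f : 'cV[R]_K -> R) (A e : R) :
  continuous f -> 0 < e ->
  exists2 r : R, 0 < r & forall u v : 'cV[R]_K,
    `|u| <= A -> `|u - v| < r -> `|f u - f v| <= e.
Proof.
(* Bounded closed sets of row vectors are compact; the function is transported to rows by
   transposition, which preserves the norm. *)
move=> cf e0; pose g (u : 'rV[R]_K) := f u^T.
have cg : continuous g.
  move=> u; apply: continuous_comp; last exact: cf.
  move=> B /= /nbhs_ballP[r r0 rB]; apply/nbhs_ballP; exists r => // v [_ uv].
  by apply: rB; split=> // i j; rewrite !mxE; exact: uv.
pose box := [set u : 'rV[R]_K | `|u| <= A].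
have cbox : compact box.
  apply: bounded_closed_compact.
    exists A; split; first exact: num_real.
    by move=> M AM u /= uA; rewrite (le_trans uA)// ltW.
  rewrite (_ : box = (fun u => `|u|) @^-1` `]-oo, A]%classic); last first.
    by apply/seteqP; split=> u /=; rewrite in_itv.
  apply: closed_comp => [u _|]; last exact: interval_closed.
  exact: norm_continuous.
have := (compact_near_coveringP box).1 cbox.
move=> /(_ _ (0^'+ : set_system R) (fun r u => forall v, `|u - v| < r -> `|g u - g v| <= e)).
case.
- move=> u uA; have := cg u => /cvgrPdist_lt/(_ (e / 2)) h.
  have /h/nbhs_ballP[r /= r0 rh] : 0 < e / 2 by rewrite divr_gt0.
  exists (ball u (r / 2), [set s | s < r / 2]) => /=.
    split; first by apply: nbhsx_ballx; rewrite divr_gt0.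
    exact: nbhs_right_lt (divr_gt0 r0 _).
  move=> [v s] /= [uv sr] w vw.
  have uv' : `|u - v| < r / 2 by move: uv; rewrite mx_norm_ball.
  have hv : `|g u - g v| < e / 2.
    apply: rh; rewrite mx_norm_ball /ball_/=; lra.
  have hw : `|g u - g w| < e / 2.
    apply: rh; rewrite mx_norm_ball /ball_/= -(subrK v u) -addrA.
    by rewrite (le_lt_trans (ler_normD _ _))//; lra.
  have -> : g v - g w = (g u - g w) - (g u - g v) by ring.
  by rewrite (le_trans (ler_normB _ _))//; lra.
- move=> r /= r0 rh.
have normT m n (B : 'M[R]_(m, n)) : `|B^T| = `|B|.
  apply/le_anti/andP; split; apply: norm_mx_le => // i j.
    by rewrite mxE norm_mx_entry.
  have -> : B i j = B^T j i by rewrite mxE.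
  exact: norm_mx_entry.
exists (r / 2); first by rewrite divr_gt0.
move=> u v uA uv.
have r2 : 0 < r / 2 by rewrite divr_gt0.
have b : ball_ Num.norm 0 r (r / 2).
  rewrite /ball_/= sub0r normrN ger0_norm ?(ltW r2)// ltr_pdivrMr//.
  by rewrite ltr_pMr// ltr1n.
have := rh _ b r2 u^T; rewrite /box/= normT => /(_ uA v^T).
by rewrite -linearB/= normT /g !trmxK; exact.
Qed.

End UniformContinuity.

Section TrigonometricApproximation.
Context (R : realType) (K : nat).

(* With a = sin x and b = sin y, this bounds the oscillation of asin uniformly on
   [-1, 1], where asin is not Lipschitz. *)
Lemma cos1B_le_sinB (x y : R) : - (pi / 2) <= x <= pi / 2 ->
  - (pi / 2) <= y <= pi / 2 -> 1 - cos (x - y) <= `|sin x - sin y|.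
Proof.
wlog : x y / sin y <= sin x.
  move=> H hx hy; have [yx|/ltW xy] := leP (sin y) (sin x); first exact: H.
  by rewrite distrC -cosN opprB H.
move=> yx /cos_ge0_pihalf cx /cos_ge0_pihalf cy.
rewrite ger0_norm ?subr_ge0// cosB.
have := cos2Dsin2 x; have := cos2Dsin2 y; have := sin_le1 x; have := sin_geN1 y.
have := sin_le1 y; have := sin_geN1 x.
move: (sin x) (sin y) (cos x) (cos y) yx cx cy => a b c d ba c0 d0 a1 b1 b2 a2 hb ha.
suff : (1 - a) * (1 + b) <= c * d by nra.
have p0 : 0 <= (1 - a) * (1 + b) by apply: mulr_ge0; lra.
rewrite -(ler_pXn2r (n := 2))// ?nnegrE ?mulr_ge0//.
have -> : (c * d) ^+ 2 = ((1 - a) * (1 + b)) * ((1 + a) * (1 - b)).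
  have -> : (c * d) ^+ 2 = c ^+ 2 * d ^+ 2 by ring.
  have -> : c ^+ 2 = 1 - a ^+ 2 by lra.
  have -> : d ^+ 2 = 1 - b ^+ 2 by lra.
  ring.
by rewrite expr2 ler_wpM2l//; lra.
Qed.

(** The approximant averages the values of [f] at nodes with product binomial weights in the
    variables [U k v]. Since the weights are nonnegative and sum to 1, the bound [M] holds on the
    whole space, not only on the cube; this is what controls the error on the tails of a law. *)
Lemma trig_poly_approx (f : 'cV[R]_K -> R) (M A e : R) : continuous f ->
  (forall v, `|f v| <= M) -> 0 < A -> 0 < e ->
  exists g, [/\ trig_poly g, forall v, `|g v| <= M &
    forall v, `|v| <= A -> `|f v - g v| <= e].
Proof.
move=> cf fM A0 e0.
have M0 : 0 <= M by rewrite (le_trans _ (fM 0)).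
have e2 : 0 < e / 2 by rewrite divr_gt0.
have [r r0 fr] := uniform_continuity_box A cf e2.
(* With this scale the coordinates of the cube are mapped into [[-pi / 2, pi / 2]], where the sine
   is injective. *)
pose c := pi / 2 / A.
have pi0 : 0 < pi / 2 :> R by rewrite divr_gt0// pi_gt0.
have c0 : 0 < c by rewrite divr_gt0.
(* y is a lower bound for the change of sin (c x) when x moves by r *)
pose q := Num.min (c * r) pi; pose y := 1 - cos q.
have q0 : 0 < q by rewrite lt_min mulr_gt0// pi_gt0.
have qpi : q <= pi by rewrite ge_min lexx orbT.
have y0 : 0 < y.
  rewrite subr_gt0 -[ltRHS](@cos0 R) ltr_cos// in_itv/= ?lexx ?pi_ge0//.
  by rewrite ltW.
pose U (k : 'I_K) (v : 'cV[R]_K) := (1 + sin (c * v k 0)) / 2.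
have U01 k v : 0 <= U k v <= 1.
  have := sin_le1 (c * v k 0); have := sin_geN1 (c * v k 0).
  by rewrite /U; lra.
have tU k : trig_poly (U k).
  apply: (trig_poly_ext _ (trig_polyD (trig_poly_cst _ (2^-1))
    (trig_poly_cos (2^-1) (c *: delta_mx k 0) (- (pi / 2))))) => v.
  rewrite cosBpihalf dotZl (_ : dot _ v = v k 0); first by rewrite /U; ring.
  rewrite /dot (bigD1 k)//= mxE !eqxx mul1r big1 ?addr0// => i ik.
  by rewrite mxE (negbTE ik) mul0r.
(* At a far node some frequency differs from [U k v] by at least [y / 2], so the crude bound [2 M]
   is at most [C] times the squared deviation, as in Chebyshev's inequality. A binomial frequency
   has variance at most [1 / (4 N)], and [N] is taken so that the [K] coordinates cost at most
   [e / 2]. *)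
pose C := 2 * M * (4 / y ^+ 2).
have C0 : 0 <= C.
  by apply: mulr_ge0; [exact: mulr_ge0|rewrite divr_ge0// sqr_ge0].
pose N := (Num.truncn (C * K%:R / (4 * (e / 2)))).+1.
have N0 : 0 < N%:R :> R by rewrite ltr0n.
pose node (j : {ffun 'I_K -> 'I_N.+1}) : 'cV[R]_K :=
  \col_k (asin (2 * (j k)%:R / N%:R - 1) / c).
pose W (j : {ffun 'I_K -> 'I_N.+1}) v := \prod_k binomial_weight (U k v) N (j k).
have W0 j v : 0 <= W j v by apply: prodr_ge0 => k _; exact: binomial_weight_ge0.
have W1 v : \sum_j W j v = 1.
  rewrite -(bigA_distr_bigA (fun k (i : 'I_N.+1) => binomial_weight (U k v) N i)).
  by rewrite big1// => k _; exact: sum_binomial_weight.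
have Wvar v k : \sum_j W j v * ((j k)%:R - N%:R * U k v) ^+ 2 <= N%:R / 4.
  pose B l (i : 'I_N.+1) := binomial_weight (U l v) N i *
    (if l == k then (i%:R - N%:R * U k v) ^+ 2 else 1).
  have -> : \sum_j W j v * ((j k)%:R - N%:R * U k v) ^+ 2 =
      \sum_(j : {ffun 'I_K -> 'I_N.+1}) \prod_l B l (j l).
    apply: eq_bigr => j _; rewrite /B big_split/= -/(W j v); congr (_ * _).
    by rewrite -big_mkcond/= big_pred1_eq.
  have Bk : \sum_i B k i = N%:R * (U k v * (1 - U k v)).
    by rewrite -sum_binomial_weight_var; apply: eq_bigr => i _; rewrite /B eqxx.
  have BN l : l != k -> \sum_i B l i = 1.
    move=> lk; rewrite -(sum_binomial_weight (U l v) N); apply: eq_bigr => i _.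
    by rewrite /B (negbTE lk) mulr1.
  rewrite -(bigA_distr_bigA B) (bigD1 k)//= Bk [X in _ * X]big1 ?mulr1//.
  by rewrite ler_wpM2l//; have := sqr_ge0 (2 * U k v - 1); nra.
exists (fun v => \sum_j f (node j) * W j v); split.
- apply: trig_poly_sum => j; apply: trig_polyM; first exact: trig_poly_cst.
  by apply: trig_poly_prod => k; exact: trig_poly_binomial_weight.
- move=> v; rewrite (le_trans (ler_norm_sum _ _ _))//.
  rewrite -[leRHS]mulr1 -(W1 v) mulr_sumr; apply: ler_sum => j _.
  by rewrite normrM (ger0_norm (W0 j v)) ler_wpM2r.
move=> v vA.
have fv : f v = \sum_j f v * W j v by rewrite -mulr_sumr W1 mulr1.
rewrite {1}fv -sumrB (le_trans (ler_norm_sum _ _ _))//.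
have key j : `|f v - f (node j)| <=
    e / 2 + \sum_k C * (((j k)%:R - N%:R * U k v) / N%:R) ^+ 2.
  have S0 : 0 <= \sum_k C * (((j k)%:R - N%:R * U k v) / N%:R) ^+ 2.
    by apply: sumr_ge0 => k _; rewrite mulr_ge0// sqr_ge0.
  have [near|far] := ltP `|v - node j| r.
    by rewrite (le_trans (fr _ _ vA near))// lerDl.
  have [k kr] : exists k, r <= `|v k 0 - node j k 0|.
    apply: contrapT => /forallNP h; move: far; rewrite leNgt => /negP; apply.
    apply: norm_mx_lt => // k i; rewrite ord1 ltNge mxE [X in `|_ + X|]mxE.
    by apply/negP => /h.
  pose x := c * v k 0; pose z := asin (2 * (j k)%:R / N%:R - 1 : R).
  have vk : - (pi / 2) <= x <= pi / 2.
    rewrite -ler_norml normrM (ger0_norm (ltW c0)) /c mulrAC ler_pdivrMr//.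
    by rewrite ler_wpM2l ?(ltW pi0)// (le_trans (norm_mx_entry _ _ _)).
  have jN : (-1 <= 2 * (j k)%:R / N%:R - 1 :> R) && (2 * (j k)%:R / N%:R - 1 <= 1 :> R).
    have jkN : (j k)%:R / N%:R <= 1 :> R.
      by rewrite ler_pdivrMr// mul1r ler_nat -ltnS.
    have : 0 <= (j k)%:R / N%:R :> R by rewrite divr_ge0.
    by move: jkN; rewrite -mulrA; lra.
  have [zpi sz] := asin_def jN; rewrite -/z in zpi sz.
  have qxz : q <= `|x - z|.
    rewrite ge_min; apply/orP; left.
    have -> : x - z = c * (v k 0 - node j k 0).
      by rewrite /node mxE /x -/z; field; rewrite gt_eqF.
    by rewrite normrM (ger0_norm (ltW c0)) ler_pM2l.
  have xzpi : `|x - z| <= pi by rewrite ler_norml; lra.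
  have yxz : y <= `|sin x - sin z|.
    apply: le_trans (cos1B_le_sinB vk zpi).
    have -> : cos (x - z) = cos `|x - z| by case: (ger0P (x - z)) => // _; rewrite cosN.
    rewrite /y lerD2l lerN2 leNgt ltr_cos ?in_itv/= ?normr_ge0 ?qpi ?(ltW q0)//.
    by rewrite -leNgt.
  have jU : ((j k)%:R - N%:R * U k v) / N%:R = (sin z - sin x) / 2.
    by rewrite sz /U -/x; field; rewrite gt_eqF.
  rewrite (le_trans (ler_normB _ _))// (le_trans (lerD (fM _) (fM _)))//.
  rewrite (bigD1 k)//= addrCA; apply: ler_wpDr.
    by rewrite addr_ge0 ?(ltW e2)// sumr_ge0// => l _; rewrite mulr_ge0// sqr_ge0.
  rewrite jU /C -mulrA; have -> : M + M = 2 * M * 1 by ring.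
  rewrite ler_wpM2l ?mulr_ge0//.
  have -> : 4 / y ^+ 2 * ((sin z - sin x) / 2) ^+ 2 = (sin x - sin z) ^+ 2 / y ^+ 2.
    by field; rewrite gt_eqF.
  rewrite ler_pdivlMr ?exprn_gt0// mul1r -[leRHS]real_normK ?num_real//.
  by rewrite ler_pXn2r ?nnegrE ?(ltW y0).
rewrite (@le_trans _ _ (\sum_(j : {ffun 'I_K -> 'I_N.+1})
    (e / 2 + \sum_k C * (((j k)%:R - N%:R * U k v) / N%:R) ^+ 2)
    * W j v))//.
  by apply: ler_sum => j _; rewrite -mulrBl normrM (ger0_norm (W0 j v)) ler_wpM2r.
under eq_bigr do rewrite mulrDl mulr_suml.
rewrite big_split/= -mulr_sumr W1 mulr1 exchange_big/=.
have -> : e = e / 2 + e / 2 by field.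
rewrite [in X in X + _](_ : e / 2 + e / 2 = e); last by field.
rewrite lerD2l.
rewrite (@le_trans _ _ (\sum_(k < K) C / (4 * N%:R)))//.
  apply: ler_sum => k _.
  rewrite (eq_bigr (fun j => C / N%:R ^+ 2 * (W j v * ((j k)%:R - N%:R * U k v) ^+ 2))).
    rewrite -mulr_sumr (le_trans (ler_wpM2l _ (Wvar v k)))//.
      by rewrite divr_ge0// sqr_ge0.
    by rewrite le_eqVlt; apply/orP; left; apply/eqP; field; rewrite gt_eqF.
  by move=> j _; field; rewrite gt_eqF.
rewrite sumr_const card_ord.
have : C * K%:R / (4 * (e / 2)) < N%:R by exact: truncnS_gt.
rewrite ltr_pdivrMr ?mulr_gt0// => /ltW h.
rewrite -[_ *+ K]mulr_natr mulrAC ler_pdivrMr ?mulr_gt0//; lra.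
Qed.

End TrigonometricApproximation.

Section CosineConvergence.
Context (R : realType) (K : nat).

(** The sigma-algebra is generated by the entries, not by the open sets, so continuity does not give
    measurability at once. The function is a pointwise limit of trigonometric polynomials, each
    close to it on a larger cube. *)
Lemma measurable_continuous_cv (f : 'cV[R]_K -> R) (M : R) : continuous f ->
  (forall v, `|f v| <= M) -> measurable_fun setT f.
Proof.
move=> cf fM.
have /choice[g gP] : forall m : nat, exists g, trig_poly g /\
    forall v, `|v| <= m.+1%:R -> `|f v - g v| <= m.+1%:R^-1.
  move=> m; have m0 : 0 < m.+1%:R :> R by rewrite ltr0n.
  have mV : 0 < m.+1%:R^-1 :> R by rewrite invr_gt0.
  by have [g [tg _ gf]] := trig_poly_approx cf fM m0 mV; exists g.
apply: (@measurable_fun_cvg _ _ _ _ g) => [m|v _].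
  by apply: measurable_trig_poly; have [] := gP m.
apply/cvgrPdist_le => e e0; near=> m.
have [_ /(_ v) gv] := gP m.
rewrite (le_trans (gv _))//.
  by rewrite (@le_trans _ _ m%:R) ?ler_nat//; near: m; exact: nbhs_infty_ger.
rewrite invf_ple ?posrE ?ltr0n// (@le_trans _ _ m%:R) ?ler_nat//.
by near: m; exact: nbhs_infty_ger.
Unshelve. all: by end_near. Qed.

Lemma prob_norm_le (Q : probability 'cV[R]_K R) (r : R) : 0 < r ->
  exists2 A : R, 0 < A & mean Q (fun v => \1_[set v : 'cV[R]_K | A < `|v|] v) <= r.
Proof.
move=> r0; pose B (m : nat) := [set v : 'cV[R]_K | m.+1%:R < `|v|].
have mB m : measurable (B m).
  have mn := measurable_mx_norm (@measurable_id _ 'cV[R]_K setT).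
  exact: measurable_gt.
have [_ cv] : integrable_fun Q (fun=> 0) /\
    mean Q (\1_(B m)) @[m --> \oo] --> mean Q (fun=> 0).
  apply: (mean_dominated_cvg _ _ _ (integrable_cst_fun 1)) => [m|v|m v].
  - exact: measurable_indic.
  - apply: cvg_near_cst; near=> m; rewrite indicE memNset// /B/=.
    apply/negP; rewrite -leNgt (@le_trans _ _ m%:R) ?ler_nat//.
    by near: m; exact: nbhs_infty_ger.
  - exact: norm_indic_le1.
rewrite mean_cst in cv; move/cvgr0_norm_le: cv => /(_ _ r0)[m _ /(_ m (leqnn m))/= h].
exists m.+1%:R; first by rewrite ltr0n.
exact: le_trans (ler_norm _) h.
Unshelve. all: by end_near. Qed.

(** [f] is exchanged for a trigonometric polynomial close to it on a cube; both are bounded by [M]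
    off the cube, where the laws put mass at most [r]. For the sequence this is the assumed
    tightness, for [Q] it is automatic. *)
Lemma cvg_in_distribution_cos (d : nat -> measure_display)
    (T : forall n, measurableType (d n)) (P : forall n, probability (T n) R)
    (Z : forall n, T n -> 'cV[R]_K) (Q : probability 'cV[R]_K R) :
  (forall n, measurable_fun setT (Z n)) ->
  (forall t s, mean (P n) (fun w => cos (dot t (Z n w) + s)) @[n --> \oo] -->
               mean Q (fun v => cos (dot t v + s))) ->
  (forall r, 0 < r -> exists A : R, with_prob P r (fun n w => `|Z n w| <= A)) ->
  cvg_in_distribution P Z Q.
Proof.
move=> mZ hcos tight f cf [M fM].
have mf := measurable_continuous_cv cf fM.
have mfZ n : measurable_fun setT (fun w => f (Z n w)) by exact: measurableT_comp mf (mZ n).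
have ifZ n : integrable_fun (P n) (fun w => f (Z n w)) by exact: integrable_bounded (mfZ n) _.
have ifQ : integrable_fun Q f by exact: integrable_bounded mf fM.
rewrite unlock integral_mean//.
apply: (@cvg_trans _ ((mean (P n) (fun w => f (Z n w)))%:E @[n --> \oo])).
  by apply: near_eq_cvg; apply: nearW => n; rewrite integral_mean.
apply: cvg_EFin; first exact: nearW.
have htrig g : trig_poly g -> mean (P n) (fun w => g (Z n w)) @[n --> \oo] --> mean Q g.
  move=> [L gL].
  have iZ n t s : integrable_fun (P n) (fun w => cos (dot t (Z n w) + s)).
    apply: (integrable_bounded (M := 1)) => [|w]; last exact: cos_max.
    exact: measurable_cos_dot.
  have iQ t s : integrable_fun Q (fun v => cos (dot t v + s)).
    apply: (integrable_bounded (M := 1)) => [|w]; last exact: cos_max.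
    exact: measurable_cos_dot (@measurable_id _ _ setT).
  rewrite (eq_mean gL) mean_sum; last by move=> p; exact: integrable_funZ.
  apply: (@cvg_trans _ (\sum_(p <- L) p.1.1 * mean (P n) (fun w =>
      cos (dot p.1.2 (Z n w) + p.2)) @[n --> \oo])).
    apply: near_eq_cvg; apply: nearW => n.
    rewrite (eq_mean (fun w => gL (Z n w))) mean_sum; last first.
      by move=> p; apply: integrable_funZ; exact: iZ.
    by apply: eq_bigr => p _; rewrite meanZ//; exact: iZ.
  elim: (L) => [|p L' IHL].
    rewrite big_nil; apply: cvg_near_cst; apply: nearW => n; rewrite big_nil//.
  rewrite big_cons; under eq_fun do rewrite big_cons.
  have hp : p.1.1 * mean (P n) (fun w => cos (dot p.1.2 (Z n w) + p.2)) @[n --> \oo]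
      --> mean Q (fun v => p.1.1 * cos (dot p.1.2 v + p.2)).
    by rewrite meanZ//; apply: cvgMr; exact: hcos.
  exact: cvgD hp IHL.
have M0 : 0 <= M by rewrite (le_trans _ (fM 0)).
apply/cvgrPdist_le => e e0.
(* Each of the two exchanges costs [e / 8 + 2 M r], at most [3 e / 8], and the convergence for the
   polynomial costs [e / 8]; the total is [7 e / 8]. *)
pose r := e / (8 * (M + 1)).
have r0 : 0 < r by rewrite divr_gt0// mulr_gt0// ltr_wpDl.
have [A1 A10 A1r] := prob_norm_le Q r0.
have [A2 hA2] := tight r r0.
pose A := Num.max A1 A2.
have A0 : 0 < A by rewrite lt_max A10.
have e8 : 0 < e / 8 by rewrite divr_gt0.
have [g [tg gM fg]] := trig_poly_approx cf fM A0 e8.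
have mg := measurable_trig_poly tg.
have dist (D : measure_display) (S : measurableType D) (P' : probability S R)
    (Y : S -> 'cV[R]_K) (B : set S) : measurable_fun setT Y -> measurable B ->
    mean P' (\1_B) <= r -> (forall w, ~ B w -> `|Y w| <= A) ->
    `|mean P' (fun w => f (Y w)) - mean P' (fun w => g (Y w))| <= e / 8 + 2 * M * r.
  move=> mY mB Br BA.
  have ifY : integrable_fun P' (fun w => f (Y w)).
    by apply: (integrable_bounded (M := M)) => //; exact: measurableT_comp mf mY.
  have igY : integrable_fun P' (fun w => g (Y w)).
    by apply: (integrable_bounded (M := M)) => //; exact: measurableT_comp mg mY.
  rewrite -meanB// (le_trans (norm_mean_le (integrable_funB ifY igY)))//.
  have iB := integrable_indic_fun (P := P') mB.
  rewrite (@le_trans _ _ (mean P' (fun w => e / 8 + 2 * M * \1_B w)))//.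
    apply: mean_le.
    - exact/integrable_fun_norm/integrable_funB.
    - apply: integrable_funD; first exact: integrable_cst_fun.
      exact: integrable_funZ.
    - move=> w; rewrite indicE; have [_|/negP wB] := boolP (w \in B).
        rewrite mulr1 ler_wpDl ?(ltW e8)// (le_trans (ler_normB _ _))//.
        by rewrite mulr_natl mulr2n lerD.
      by rewrite mulr0 addr0 fg// BA// => /mem_set.
  rewrite meanD ?mean_cst ?meanZ//; last 2 first.
  - exact: integrable_cst_fun.
  - exact: integrable_funZ.
  by rewrite lerD2l ler_wpM2l// mulr_ge0.
have Mr : 2 * M * r <= e / 4.
  rewrite /r mulrA ler_pdivrMr ?mulr_gt0 ?ltr_wpDl//.
  have -> : e / 4 * (8 * (M + 1)) = 2 * M * e + 2 * e by field.
  by rewrite lerDl mulr_ge0// ltW.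
have hQ : `|mean Q f - mean Q g| <= e / 8 + e / 4.
  apply: le_trans (dist _ _ Q id [set v : 'cV[R]_K | A1 < `|v|] _ _ A1r _) _.
  - exact: measurable_id.
  - exact/measurable_gt/measurable_mx_norm.
  - by move=> v /= /negP; rewrite -leNgt => vA; rewrite le_max vA.
  - by rewrite lerD2l.
have hg := htrig g tg; move/cvgrPdist_le: hg => /(_ _ e8) hg.
near=> n.
have hPn : `|mean (P n) (fun w => f (Z n w)) - mean (P n) (fun w => g (Z n w))| <=
    e / 8 + e / 4.
  have [B [mB PB BA]] : exists B : set (T n),
      [/\ measurable B, (P n B <= r%:E)%E & forall w, ~ B w -> `|Z n w| <= A2].
    by near: n.
  apply: le_trans (dist _ _ (P n) (Z n) B (mZ n) mB _ _) _.
  - by rewrite mean_indic// -lee_fin fineK ?fin_num_measure.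
  - by move=> w /BA wA; rewrite le_max wA orbT.
  - by rewrite lerD2l.
have hgn : `|mean Q g - mean (P n) (fun w => g (Z n w))| <= e / 8 by near: n.
move: hQ hPn hgn; rewrite /= !ler_norml; lra.
Unshelve. all: by end_near. Qed.

End CosineConvergence.

(** * The square-root lasso, deterministically *)

Section QuadraticForms.
Context (R : realType).

Lemma posdefmx_dot_ge0 n (A : 'M[R]_n) v : posdefmx A -> 0 <= dot v (A *m v).
Proof.
move=> Apd; have [->|v0] := eqVneq v 0; first by rewrite mulmx0 dot0l.
exact/ltW/posdefmx_dot_gt0.
Qed.

Lemma cauchy_schwarz_posdef n (A : 'M[R]_n) (u v : 'cV[R]_n) : posdefmx A ->
  dot u (A *m v) ^+ 2 <= dot u (A *m u) * dot v (A *m v).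
Proof.
move=> Apd; have [AT _] := Apd.
have [->|v0] := eqVneq v 0; first by rewrite mulmx0 !dot0r expr0n/= mulr0.
have q0 := posdefmx_dot_gt0 Apd v0.
set q := dot v (A *m v) in q0 *; set b := dot u (A *m v).
have bE : dot v (A *m u) = b by rewrite dot_mulmx AT dotC.
have := posdefmx_dot_ge0 (u - (b / q) *: v) Apd.
rewrite mulmxBr -scalemxAr dotBl !dotBr !dotZl !dotZr bE -/q -/b.
have -> : dot u (A *m u) - b / q * b - (b / q * b - b / q * (b / q * q)) =
    dot u (A *m u) - b ^+ 2 / q by field; rewrite gt_eqF.
by rewrite subr_ge0 ler_pdivrMr.
Qed.

Lemma posdefmx1 n : posdefmx (1%:M : 'M[R]_n).
Proof.
split; first exact: trmx1.
move=> v v0; rewrite mulmx1 -dotE lt_neqAle dot_ge0 andbT eq_sym.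
by apply: contra v0 => /eqP/dot_eq0 ->.
Qed.

Lemma cauchy_schwarz n (u v : 'cV[R]_n) : dot u v ^+ 2 <= dot u u * dot v v.
Proof. by have := cauchy_schwarz_posdef u v (posdefmx1 n); rewrite !mul1mx. Qed.

Lemma l2norm_ge0 n (u : 'cV[R]_n) : 0 <= l2norm u.
Proof. exact: sqrtr_ge0. Qed.

Lemma l2norm_sqr n (u : 'cV[R]_n) : l2norm u ^+ 2 = dot u u.
Proof.
rewrite /l2norm sqr_sqrtr; first by apply: eq_bigr => i _; rewrite expr2.
by apply: sumr_ge0 => i _; exact: sqr_ge0.
Qed.

Lemma dot_le_l2norm n (u v : 'cV[R]_n) : dot u v <= l2norm u * l2norm v.
Proof.
have [uv0|/ltW uv0] := leP (dot u v) 0.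
  by rewrite (le_trans uv0)// mulr_ge0// l2norm_ge0.
rewrite -(ler_pXn2r (n := 2))// ?nnegrE ?mulr_ge0 ?l2norm_ge0//.
by rewrite exprMn !l2norm_sqr cauchy_schwarz.
Qed.

Lemma dot_min_orthogonal n (u w : 'cV[R]_n) :
  (forall t, dot u u <= dot (u - t *: w) (u - t *: w)) -> dot u w = 0.
Proof.
move=> key; set B := dot u w; have q0 := dot_ge0 w; set q := dot w w in q0.
have q1 : 0 < q + 1 by rewrite ltr_wpDl.
(* Dividing by [q + 1] rather than [q] covers the case [w = 0]; the resulting inequality still
   forces the step [t] to vanish. *)
have := key (B / (q + 1)); rewrite dotBl !dotBr !dotZl !dotZr [dot w u]dotC -/B -/q.
set t := B / (q + 1) => H.
have tE : B = t * (q + 1) by rewrite divfK// gt_eqF.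
have : t ^+ 2 * (q + 2) <= 0 by move: H; rewrite tE; nra.
have q2 : 0 < q + 2 by lra.
rewrite pmulr_lle0// => t2; have /eqP : t ^+ 2 = 0 by apply/le_anti; rewrite t2 sqr_ge0.
by rewrite sqrf_eq0 => /eqP t0; rewrite tE t0 mul0r.
Qed.

Lemma l1norm_ge0 n (u : 'cV[R]_n) : 0 <= l1norm u.
Proof. by apply: sumr_ge0 => i _. Qed.

Lemma norm_dot_le n (u v : 'cV[R]_n) : `|dot u v| <= `|u| * l1norm v.
Proof.
rewrite (le_trans (ler_norm_sum _ _ _))// mulr_sumr; apply: ler_sum => i _.
by rewrite normrM ler_wpM2r// norm_mx_entry.
Qed.

Lemma norm_trmx_mul_le n K (X : 'M[R]_(n, K)) (v : 'cV[R]_n) :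
  `|X^T *m v| <= `|X| * l1norm v.
Proof.
apply: norm_mx_le => [|k j]; first by rewrite mulr_ge0// l1norm_ge0.
rewrite ord1 mxE (le_trans (ler_norm_sum _ _ _))// mulr_sumr; apply: ler_sum => i _.
by rewrite mxE normrM ler_wpM2r// norm_mx_entry.
Qed.

Lemma dot_le_norm n (u : 'cV[R]_n) : dot u u <= n%:R * `|u| ^+ 2.
Proof.
rewrite (@le_trans _ _ (\sum_(i < n) `|u| ^+ 2))//; last first.
  by rewrite sumr_const card_ord mulr_natl.
apply: ler_sum => i _; rewrite -expr2 -real_normK ?num_real//.
by rewrite ler_pXn2r ?nnegrE// norm_mx_entry.
Qed.

Lemma norm_le_dot n (u : 'cV[R]_n) : `|u| ^+ 2 <= dot u u.
Proof.
rewrite -l2norm_sqr ler_pXn2r ?nnegrE ?l2norm_ge0//.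
apply: norm_mx_le => [|i j]; first exact: l2norm_ge0.
rewrite ord1 -(ler_pXn2r (n := 2))// ?nnegrE ?l2norm_ge0// l2norm_sqr.
rewrite real_normK ?num_real// /dot (bigD1 i)//= -expr2 lerDl.
by apply: sumr_ge0 => k _; rewrite -expr2 sqr_ge0.
Qed.

End QuadraticForms.

(** * The residual maker as an orthogonal projector *)

Section Annihilator.
Context (R : realType) (n K : nat) (X : 'M[R]_(n, K)).
Notation M := (col_annihilator X).

Lemma annihilator_design : M *m X = 0.
Proof. by rewrite mulmxBl mul1mx col_proj_id subrr. Qed.

Lemma annihilator_id (u : 'cV[R]_n) : X^T *m u = 0 -> M *m u = u.
Proof. by move=> Xu; rewrite mulmxBl mul1mx col_proj_orth// subr0. Qed.

Lemma row_full_design_sum : row_full (<<X^T>> + kermx X)%MS.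
Proof.
rewrite /row_full mxrank_disjoint_sum ?col_proj_cap// genmxE mxrank_tr.
by rewrite mxrank_ker subnKC ?rank_leq_row.
Qed.

Lemma annihilator_orth (v : 'cV[R]_n) : X^T *m (M *m v) = 0.
Proof.
apply: trmx_inj; rewrite !trmx_mul trmxK trmx0.
rewrite /col_annihilator linearB/= trmx1 trmxK mulmxBr mulmx1.
apply/sub_kermxP; apply: proj_mx_compl_sub; apply: submx_full.
exact: row_full_design_sum.
Qed.

Lemma annihilator_decomp (v : 'cV[R]_n) : exists c : 'cV[R]_K, v = M *m v + X *m c.
Proof.
have : ((col_proj X *m v)^T <= X^T)%MS.
  by rewrite trmx_mul trmxK -(genmxE X^T); exact: proj_mx_sub.
move=> /submxP[D DE]; exists D^T.
have -> : X *m D^T = col_proj X *m v.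
  by apply: trmx_inj; rewrite trmx_mul trmxK DE.
by rewrite mulmxBl mul1mx subrK.
Qed.

Lemma dot_annihilator (u v : 'cV[R]_n) : dot (M *m u) (M *m v) = dot (M *m u) v.
Proof.
have [c {2}->] := annihilator_decomp v.
by rewrite dotDr [dot _ (X *m c)]dot_mulmx annihilator_orth dot0l addr0.
Qed.

Lemma annihilator_pythagoras (v : 'cV[R]_n) (c : 'cV[R]_K) : v = M *m v + X *m c ->
  dot v v = dot (M *m v) (M *m v) + dot (X *m c) (X *m c).
Proof.
move=> E; rewrite {1 2}E dotDl !dotDr.
have -> : dot (M *m v) (X *m c) = 0 by rewrite dot_mulmx annihilator_orth dot0l.
have -> : dot (X *m c) (M *m v) = 0.
  by rewrite dotC dot_mulmx annihilator_orth dot0l.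
by rewrite addr0 add0r.
Qed.

(** Here [X *m c] is the projection of [v], and its squared norm [q] equals [dot c (X^T *m v)]. With
    [w] the squared norm of [X^T *m v], Cauchy-Schwarz and the eigenvalue bound give
    [l q ^ 2 <= q w], and one factor [q] cancels. *)
Lemma proj_le (v : 'cV[R]_n) (c : 'cV[R]_K) (l : R) : 0 < l ->
  (forall b : 'cV[R]_K, l * dot b b <= dot (X *m b) (X *m b)) ->
  v = M *m v + X *m c ->
  dot (X *m c) (X *m c) <= dot (X^T *m v) (X^T *m v) / l.
Proof.
move=> l0 hl E.
have XcE : dot (X *m c) (X *m c) = dot c (X^T *m v).
  rewrite [in RHS]E mulmxDr annihilator_orth add0r dotC.
  by rewrite dot_mulmx dotC mulmxA.
have h := hl c; have cs := cauchy_schwarz c (X^T *m v); rewrite -XcE in cs.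
set q := dot (X *m c) (X *m c) in h cs *; have q0 : 0 <= q by exact: dot_ge0.
set w := dot (X^T *m v) _ in cs *; have w0 : 0 <= w by exact: dot_ge0.
rewrite ler_pdivlMr//; have [->|qn0] := eqVneq q 0; first by rewrite mul0r.
have qp : 0 < q by rewrite lt_neqAle eq_sym qn0.
rewrite -(ler_pM2l qp) mulrA -expr2.
rewrite (le_trans (ler_wpM2r (ltW l0) cs))// mulrAC ler_wpM2r//.
by rewrite mulrC.
Qed.

End Annihilator.

(** * Cone condition and error rates for the penalized estimator *)

Section SqrtLasso.
Context (R : realType) (n K : nat) (X : 'M[R]_(n, K)) (beta : 'cV[R]_K).
Context (e al y : 'cV[R]_n) (lam l : R) (bh : 'cV[R]_K) (ah : 'cV[R]_n).
Notation M := (col_annihilator X).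
Hypothesis yE : y = X *m beta + al + e.
Hypotheses (n0 : (0 < n)%N) (lam0 : 0 < lam) (l0 : 0 < l).
Hypothesis hmin : forall b a, sqrt_lasso_obj lam y X bh ah <= sqrt_lasso_obj lam y X b a.

Let np : 0 < n%:R :> R. Proof. by rewrite ltr0n. Qed.

Lemma residual_decomp :
  y - X *m bh - ah = e - (ah - al) - X *m (bh - beta).
Proof. by rewrite yE mulmxBr; apply/colP => i; rewrite !mxE; ring. Qed.

(** For [a] fixed at [ah] only the residual norm depends on [b], so [bh] solves a least-squares
    problem. Comparing squared norms avoids differentiating the norm, which is impossible at a zero
    residual. *)
Lemma normal_equations : X^T *m (y - X *m bh - ah) = 0.
Proof.
set u := y - X *m bh - ah; apply: dot_eq0; set h := X^T *m u.
have <- : dot u (X *m h) = dot h h by rewrite dot_mulmx.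
apply: dot_min_orthogonal => t.
have := hmin (bh + t *: h) ah; rewrite /sqrt_lasso_obj lerD2r.
rewrite ler_pM2l ?invr_gt0 ?sqrtr_gt0//.
have -> : y - X *m (bh + t *: h) - ah = u - t *: (X *m h).
  by rewrite /u mulmxDr -scalemxAr; apply/colP => i; rewrite !mxE; ring.
by rewrite -!l2norm_sqr ler_pXn2r ?nnegrE ?l2norm_ge0.
Qed.

Lemma gram_estimation_error :
  X^T *m X *m (bh - beta) = X^T *m (e - (ah - al)).
Proof.
have := normal_equations; rewrite residual_decomp mulmxBr => /eqP; rewrite subr_eq0.
by move=> /eqP ->; rewrite mulmxA.
Qed.

Section Rates.
(** The quantities of the argument are variables tied by equations, so that the polynomial steps see
    atoms. [Q0] and [Q1] are the residual levels of the reference point and of the estimator, [a]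
    and [b] the masses of the error [D] on and off the support of [al]. *)
Variables (root : R) (u D : 'cV[R]_n).
Hypotheses (rootE : root = Num.sqrt n%:R) (u_def : u = y - X *m bh - ah).
Hypothesis (D_def : D = ah - al).
Variables (N0 Q0 Q1 : R).
Hypotheses (N0E : N0 = l2norm (M *m e)) (Q0E : Q0 = N0 / root).
Hypothesis (Q1E : Q1 = l2norm u / root).
Hypothesis N0_gt0 : 0 < N0.
Hypothesis hlam : 2 * root * (`|M *m e| / N0) <= lam.
Variables (s a b ln D2 : R).
Hypothesis sE : s = \sum_(i < n) (al i 0 != 0)%:R.
Hypothesis aE : a = \sum_(i < n | al i 0 != 0) `|D i 0|.
Hypothesis bE : b = \sum_(i < n | al i 0 == 0) `|D i 0|.
Hypothesis lnE : ln = lam / n%:R.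
Hypothesis D2E : D2 = dot (M *m D) (M *m D) / n%:R.

Let root_gt0 : 0 < root. Proof. by rewrite rootE sqrtr_gt0. Qed.
Let root_sqr : root ^+ 2 = n%:R. Proof. by rewrite rootE sqr_sqrtr. Qed.

Let uE : u = M *m e - M *m D.
Proof.
have Xu : X^T *m u = 0 by rewrite u_def; exact: normal_equations.
rewrite -[LHS](annihilator_id Xu) u_def residual_decomp -D_def !mulmxBr.
rewrite [M *m (X *m bh)]mulmxA [M *m (X *m beta)]mulmxA annihilator_design.
by rewrite !mul0mx subrr subr0.
Qed.

Let a_ge0 : 0 <= a. Proof. by rewrite aE; exact: sumr_ge0. Qed.
Let b_ge0 : 0 <= b. Proof. by rewrite bE; exact: sumr_ge0. Qed.
Let Q0_gt0 : 0 < Q0. Proof. by rewrite Q0E divr_gt0. Qed.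
Let Q1_ge0 : 0 <= Q1. Proof. by rewrite Q1E divr_ge0 ?l2norm_ge0 ?(ltW root_gt0). Qed.
Let s_ge0 : 0 <= s. Proof. by rewrite sE; exact: sumr_ge0. Qed.

Let l1D : l1norm D = a + b.
Proof.
rewrite /l1norm (bigID (fun i => al i 0 != 0))/= aE bE; congr (_ + _).
by apply: eq_bigl => i; rewrite negbK.
Qed.

(** The estimator is compared with [beta + c] and [al], where [X *m c] is the projection of the
    noise; the residual there is exactly [M *m e]. *)
Let basic : Q1 + ln * l1norm ah <= Q0 + ln * l1norm al.
Proof.
have [c ec] := annihilator_decomp X e.
have := hmin (beta + c) al; rewrite /sqrt_lasso_obj -u_def.
have -> : y - X *m (beta + c) - al = M *m e.
  have -> : M *m e = e - X *m c.
    by apply/eqP; rewrite eq_sym subr_eq; exact/eqP.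
  by rewrite yE mulmxDr; apply/colP => i; rewrite !mxE; ring.
by rewrite Q1E Q0E N0E lnE rootE ![_ / Num.sqrt _]mulrC.
Qed.

Let l1_diff : l1norm al - l1norm ah <= a - b.
Proof.
have E1 : l1norm al = \sum_(i < n | al i 0 != 0) `|al i 0|.
  rewrite /l1norm (bigID (fun i => al i 0 != 0))/= [X in _ + X]big1 ?addr0//.
  by move=> i; rewrite negbK => /eqP ->; rewrite normr0.
have E2 : l1norm ah = \sum_(i < n | al i 0 != 0) `|ah i 0| + b.
  rewrite /l1norm (bigID (fun i => al i 0 != 0))/=; congr (_ + _).
  rewrite bE; apply: eq_big => [i|i]; first by rewrite negbK.
  by rewrite negbK D_def => /eqP al0; rewrite !mxE al0 subr0.
have h1 : \sum_(i < n | al i 0 != 0) `|al i 0| <=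
    \sum_(i < n | al i 0 != 0) `|ah i 0| + a.
  rewrite aE -big_split; apply: ler_sum => i _ /=; rewrite D_def !mxE.
  by rewrite -[in leLHS](subrK (ah i 0) (al i 0)) addrC -[in leRHS]distrC ler_normD.
rewrite E1 E2; move: h1; move: (\sum_(i < n | _) _) (\sum_(i < n | _) _).
by move=> p q; lra.
Qed.

Let ln_gt0 : 0 < ln. Proof. by rewrite lnE divr_gt0. Qed.

Let upper : Q1 - Q0 <= ln * (a - b).
Proof.
have h := basic; have h' : ln * (l1norm al - l1norm ah) <= ln * (a - b).
  by rewrite ler_pM2l// l1_diff.
by move: h h'; rewrite mulrBr; lra.
Qed.

Let MeQ0 : `|M *m e| <= lam * Q0 / 2.
Proof.
have h : 2 * root * `|M *m e| <= lam * N0.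
  by have := hlam; rewrite mulrA ler_pdivrMr.
have -> : lam * Q0 / 2 = lam * N0 / (2 * root).
  by rewrite Q0E; field; rewrite gt_eqF.
by rewrite ler_pdivlMr ?mulr_gt0// mulrC.
Qed.

Let dotMeD : dot (M *m e) D <= lam * Q0 / 2 * (a + b).
Proof.
rewrite (le_trans (ler_norm _))// (le_trans (norm_dot_le _ _))// l1D.
by rewrite ler_wpM2r// addr_ge0.
Qed.

(** Convexity of the norm in the form of Cauchy-Schwarz: the inner product of [M *m e] and [u] is
    the squared norm of [M *m e] minus [dot (M *m e) D], and is at most the product of the norms.
    The penalty level bounds [dot (M *m e) D], up to the scale [Q0], by half the penalty of [D]. *)
Let lower : - (ln / 2 * (a + b)) <= Q1 - Q0.
Proof.
have cs := dot_le_l2norm (M *m e) u.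
rewrite {1}uE dotBr dot_annihilator -[dot (M *m e) e]dot_annihilator in cs.
rewrite -l2norm_sqr dot_annihilator -N0E in cs.
have E1 : N0 = root * Q0 by rewrite Q0E mulrC divfK// gt_eqF.
have E2 : l2norm u = root * Q1 by rewrite Q1E mulrC divfK// gt_eqF.
rewrite E2 E1 in cs.
have lE : lam = ln * root ^+ 2 by rewrite lnE root_sqr divfK// gt_eqF.
have rQ : 0 < root ^+ 2 * Q0 by rewrite mulr_gt0// exprn_gt0.
rewrite -(ler_pM2l rQ); move: cs dotMeD; rewrite lE.
move: (dot (M *m e) D) => z; nra.
Qed.

(** After division by [ln] the two bounds on [Q1 - Q0] give [- (a + b) / 2 <= a - b]; the 3 comes
    from the factor 2 in the condition on the penalty level. *)
Let cone : b <= 3 * a.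
Proof.
have h := le_trans lower upper.
have : ln * (b - 3 * a) <= 0 by move: h; nra.
by rewrite pmulr_rle0// subr_le0.
Qed.

(** Since [u] is [M *m e - M *m D], the squared norm of [M *m D] is a difference of squared residual
    norms plus [2 dot (M *m e) D]. The first part gives [2 ln Q0 a] and the square, the second
    [4 ln Q0 a] through the cone. *)
Let prediction : D2 <= 6 * ln * Q0 * a + (ln * a) ^+ 2.
Proof.
have E : dot (M *m D) (M *m D) = l2norm u ^+ 2 - N0 ^+ 2 + 2 * dot (M *m e) D.
  rewrite N0E !l2norm_sqr uE dotBl !dotBr [dot (M *m D) (M *m e)]dotC.
  rewrite [dot (M *m e) (M *m D)]dot_annihilator; ring.
have -> : D2 = Q1 ^+ 2 - Q0 ^+ 2 + 2 * dot (M *m e) D / n%:R.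
  by rewrite D2E E Q1E Q0E -root_sqr; field; rewrite gt_eqF.
have h1 : 2 * dot (M *m e) D / n%:R <= 4 * ln * Q0 * a.
  rewrite ler_pdivrMr// (_ : 4 * ln * Q0 * a * n%:R = lam * Q0 * (4 * a)); last first.
    by rewrite lnE; field; rewrite gt_eqF.
  have lQ : 0 <= lam * Q0 by rewrite mulr_ge0// ltW.
  have h : lam * Q0 * (a + b) <= lam * Q0 * (4 * a).
    by rewrite ler_wpM2l//; have := cone; lra.
  by move: dotMeD h; lra.
have h2 : Q1 <= Q0 + ln * a.
  have h : 0 <= ln * b by rewrite mulr_ge0// ltW.
  by move: upper h; rewrite mulrBr; lra.
have h3 : Q1 ^+ 2 <= (Q0 + ln * a) ^+ 2.
  by rewrite ler_pXn2r ?nnegrE// (le_trans Q1_ge0).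
by move: h1 h3; move: (2 * _ / _) => z; rewrite sqrrD; nra.
Qed.

Hypothesis eigen : forall c : 'cV[R]_K, l * n%:R * dot c c <= dot (X *m c) (X *m c).
Hypothesis sparse : 16 * K%:R * s * `|X| ^+ 2 <= 3 / 4 * (l * n%:R).
Hypothesis sparse_lam : 8 * (s * lam ^+ 2) <= n%:R.

Let a_sqr : a ^+ 2 <= s * dot D D.
Proof.
pose i1 : 'cV[R]_n := \col_i (al i 0 != 0)%:R; pose aD : 'cV[R]_n := \col_i `|D i 0|.
have -> : a = dot i1 aD.
  rewrite aE big_mkcond; apply: eq_bigr => i _; rewrite !mxE.
  by case: (al i 0 != 0); rewrite ?mul1r ?mul0r.
have -> : s = dot i1 i1.
  rewrite sE; apply: eq_bigr => i _.
  by rewrite !mxE; case: (al i 0 != 0); rewrite ?mul1r ?mul0r.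
have -> : dot D D = dot aD aD.
  by apply: eq_bigr => i _; rewrite !mxE -normrM -expr2 ger0_norm ?sqr_ge0// expr2.
exact: cauchy_schwarz.
Qed.

(** By Pythagoras it suffices that the projection of [D] on the columns of [X] carries at most
    [3 / 4] of its squared norm. That projection is governed by [X^T *m D], hence by [|X|] and the
    mass [a + b <= 4 a], whose square explains the 16 in [sparse]. *)
Let restricted_eigenvalue : dot D D <= 4 * n%:R * D2.
Proof.
have [c Dc] := annihilator_decomp X D.
have ln0 : 0 < l * n%:R by rewrite mulr_gt0.
have h1 := proj_le ln0 eigen Dc.
have h2 : dot (X^T *m D) (X^T *m D) <= K%:R * (`|X| * (4 * a)) ^+ 2.
  rewrite (le_trans (dot_le_norm _))// ler_wpM2l//.
  rewrite ler_pXn2r ?nnegrE ?mulr_ge0//.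
  rewrite (le_trans (norm_trmx_mul_le _ _))// l1D ler_wpM2l//.
  by have := cone; lra.
have h3 : K%:R * (`|X| * (4 * a)) ^+ 2 <= 3 / 4 * (l * n%:R) * dot D D.
  have -> : K%:R * (`|X| * (4 * a)) ^+ 2 = 16 * K%:R * `|X| ^+ 2 * a ^+ 2 by ring.
  have KX : 0 <= 16 * K%:R * `|X| ^+ 2 by rewrite !mulr_ge0// sqr_ge0.
  rewrite (le_trans (ler_wpM2l KX a_sqr))// mulrA ler_wpM2r ?dot_ge0//.
  by rewrite mulrAC.
have h4 : dot (X *m c) (X *m c) <= 3 / 4 * dot D D.
  rewrite (le_trans h1)// ler_pdivrMr// (le_trans h2)// (le_trans h3)//.
  by rewrite mulrAC.
have h5 := annihilator_pythagoras Dc.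
have -> : 4 * n%:R * D2 = 4 * dot (M *m D) (M *m D).
  by rewrite D2E; field; rewrite gt_eqF.
move: h4 h5; move: (dot (X *m c) _) (dot (M *m D) _) (dot D D) => p q r.
by lra.
Qed.

(** The square [(ln a) ^ 2] is absorbed in half of [D2] by [sparse_lam], leaving [D2 <= 12 ln Q0 a].
    Combined with [a ^ 2 <= 4 n s D2] this gives the 48, which the cone multiplies by 4. *)
Lemma alpha_error_rate : a + b <= 192 * (s * lam) * Q0.
Proof.
suff : a <= 48 * (s * lam) * Q0 by have := cone; lra.
have a2 : a ^+ 2 <= s * (4 * n%:R * D2).
  by rewrite (le_trans a_sqr)// ler_wpM2l// restricted_eigenvalue.
have D2_ge0 : 0 <= D2 by rewrite D2E divr_ge0 ?dot_ge0.
have h1 : (ln * a) ^+ 2 <= D2 / 2.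
  rewrite exprMn (le_trans (ler_wpM2l (sqr_ge0 _) a2))//.
  have -> : ln ^+ 2 * (s * (4 * n%:R * D2)) = 8 * (s * lam ^+ 2) * (D2 / 2 / n%:R).
    by rewrite lnE; field; rewrite gt_eqF.
  rewrite (@le_trans _ _ (n%:R * (D2 / 2 / n%:R)))//.
    by rewrite ler_wpM2r// !divr_ge0.
  by rewrite mulrC divfK// gt_eqF.
have h2 : D2 <= 12 * ln * Q0 * a by move: prediction h1; lra.
have h3 : a ^+ 2 <= 48 * (s * lam) * Q0 * a.
  have n4 : 0 <= 4 * n%:R :> R by rewrite mulr_ge0.
  rewrite (le_trans a2)// (le_trans (ler_wpM2l s_ge0 (ler_wpM2l n4 h2)))//.
  by rewrite le_eqVlt; apply/orP; left; apply/eqP; rewrite lnE; field; rewrite gt_eqF.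
have [a0|a0] := eqVneq a 0; first by rewrite a0 !mulr_ge0// ltW.
have ap : 0 < a by rewrite lt_neqAle eq_sym a0 a_ge0.
by rewrite -(ler_pM2r ap) -expr2.
Qed.

Lemma residual_rate : `|Q1 - Q0| <= ln * (a + b).
Proof.
have h1 : 0 <= ln * a by rewrite mulr_ge0// ltW.
have h2 : 0 <= ln * b by rewrite mulr_ge0// ltW.
by move: upper lower h1 h2; rewrite ler_norml mulrBr !mulrDr; lra.
Qed.

Lemma alpha_error_l1 : l1norm D = a + b. Proof. exact: l1D. Qed.

End Rates.

Hypothesis N0_gt0 : 0 < l2norm (M *m e).
Hypothesis hlam : 2 * Num.sqrt n%:R * (`|M *m e| / l2norm (M *m e)) <= lam.
Let s : R := \sum_(i < n) (al i 0 != 0)%:R.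
Hypothesis eigen : forall c : 'cV[R]_K, l * n%:R * dot c c <= dot (X *m c) (X *m c).
Hypothesis sparse : 16 * K%:R * s * `|X| ^+ 2 <= 3 / 4 * (l * n%:R).
Hypothesis sparse_lam : 8 * (s * lam ^+ 2) <= n%:R.

Lemma l1norm_alpha_error :
  l1norm (ah - al) <= 192 * (s * lam) * (l2norm (M *m e) / Num.sqrt n%:R).
Proof.
rewrite (alpha_error_l1 erefl erefl).
exact: (alpha_error_rate erefl erefl erefl erefl erefl erefl N0_gt0 hlam
  erefl erefl erefl erefl erefl eigen sparse sparse_lam).
Qed.

Lemma residual_norm_error :
  `|l2norm (y - X *m bh - ah) / Num.sqrt n%:R - l2norm (M *m e) / Num.sqrt n%:R| <=
  192 * (s * lam ^+ 2 / n%:R) * (l2norm (M *m e) / Num.sqrt n%:R).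
Proof.
have h := residual_rate erefl erefl erefl erefl erefl erefl N0_gt0 hlam erefl erefl erefl.
apply: (le_trans h); rewrite -(alpha_error_l1 erefl erefl).
have ln_ge0 : 0 <= lam / n%:R by rewrite divr_ge0// ltW.
rewrite (le_trans (ler_wpM2l ln_ge0 l1norm_alpha_error))//.
rewrite le_eqVlt; apply/orP; left; apply/eqP; move: (l2norm _ / _) => z.
by field; rewrite gt_eqF.
Qed.

End SqrtLasso.

(** * Measurability of the residual maker *)

Section MeasurableMatrixOperations.
Context d (T : measurableType d) (R : realType).

(** The inverse is [x] times the power [-1] of [x ^ 2], and real powers are measurable. At 0 both
    sides vanish, the inverse of 0 being 0. *)
Lemma measurable_inv : measurable_fun setT (fun x : R => x^-1).
Proof.
rewrite (_ : (fun x : R => x^-1) = fun x => x * (x ^+ 2) `^ (-1)).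
  apply: measurable_funM => //.
  exact: (measurableT_comp (@measurable_powR R (-1))
    (measurable_funX 2 (@measurable_id _ R setT))).
apply/funext => x; rewrite powR_inv1 ?sqr_ge0//.
have [->|x0] := eqVneq x 0; first by rewrite invr0 mul0r.
by field.
Qed.

Lemma measurable_sqrt : measurable_fun setT (@Num.sqrt R).
Proof. by apply: continuous_measurable_fun; exact: sqrt_continuous. Qed.

Lemma measurable_mx_entry m n (A : T -> 'M[R]_(m, n)) i j :
  measurable_fun setT A -> measurable_fun setT (fun w => A w i j).
Proof. exact: measurableT_comp (measurable_entry i j). Qed.

Lemma measurable_mulmx m n p (A : T -> 'M[R]_(m, n)) (B : T -> 'M[R]_(n, p)) :
  measurable_fun setT A -> measurable_fun setT B ->
  measurable_fun setT (fun w => A w *m B w).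
Proof.
move=> mA mB; apply: measurable_fun_mxP => i j; under eq_fun do rewrite mxE.
by apply: measurable_sum => k; apply: measurable_funM; exact: measurable_mx_entry.
Qed.

Lemma measurable_trmx m n (A : T -> 'M[R]_(m, n)) :
  measurable_fun setT A -> measurable_fun setT (fun w => (A w)^T).
Proof.
move=> mA; apply: measurable_fun_mxP => i j; under eq_fun do rewrite mxE.
exact: measurable_mx_entry.
Qed.

Lemma measurable_addmx m n (A B : T -> 'M[R]_(m, n)) :
  measurable_fun setT A -> measurable_fun setT B ->
  measurable_fun setT (fun w => A w + B w).
Proof.
move=> mA mB; apply: measurable_fun_mxP => i j; under eq_fun do rewrite mxE.
by apply: measurable_funD; exact: measurable_mx_entry.
Qed.

Lemma measurable_scalemx m n (c : T -> R) (A : T -> 'M[R]_(m, n)) :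
  measurable_fun setT c -> measurable_fun setT A ->
  measurable_fun setT (fun w => c w *: A w).
Proof.
move=> mc mA; apply: measurable_fun_mxP => i j; under eq_fun do rewrite mxE.
by apply: measurable_funM => //; exact: measurable_mx_entry.
Qed.

Lemma measurable_oppmx m n (A : T -> 'M[R]_(m, n)) :
  measurable_fun setT A -> measurable_fun setT (fun w => - A w).
Proof.
move=> mA; under eq_fun do rewrite -scaleN1r.
by apply: measurable_scalemx; first exact: measurable_cst.
Qed.

Lemma measurable_det n (A : T -> 'M[R]_n) :
  measurable_fun setT A -> measurable_fun setT (fun w => \det (A w)).
Proof.
move=> mA; apply: measurable_sum => s; apply: measurable_funM => //.
by apply: measurable_prod => i _; exact: measurable_mx_entry.
Qed.

Lemma measurable_invmx n (A : T -> 'M[R]_n) :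
  (forall w, A w \in unitmx) -> measurable_fun setT A ->
  measurable_fun setT (fun w => invmx (A w)).
Proof.
move=> uA mA; rewrite (_ : (fun _ => _) = fun w => (\det (A w))^-1 *: \adj (A w)).
  apply: measurable_scalemx.
    exact: measurableT_comp measurable_inv (measurable_det mA).
  apply: measurable_fun_mxP => i j; under eq_fun do rewrite mxE.
  apply: measurable_funM => //; apply: measurable_det.
  apply: measurable_fun_mxP => k l; under eq_fun do rewrite !mxE.
  exact: measurable_mx_entry.
by apply/funext => w; rewrite /invmx uA.
Qed.

Lemma measurable_l2norm n (v : T -> 'cV[R]_n) :
  measurable_fun setT v -> measurable_fun setT (fun w => l2norm (v w)).
Proof.
move=> mv; apply: measurableT_comp measurable_sqrt _.
by apply: measurable_sum => i; apply: measurable_funX; exact: measurable_mx_entry.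
Qed.

End MeasurableMatrixOperations.

Section MeasurableAnnihilator.
Context (R : realType).

Lemma posdefmx_unit n (A : 'M[R]_n) : posdefmx A -> A \in unitmx.
Proof.
move=> Apd; rewrite -row_free_unit -kermx_eq0; apply/eqP/row_matrixP => i.
rewrite row0; set u := row i (kermx A).
have uA : u *m A = 0 by apply/sub_kermxP; exact: row_sub.
apply: trmx_inj; rewrite trmx0; apply/eqP; apply: contraT => u0.
have := posdefmx_dot_gt0 Apd u0.
by rewrite dotE trmxK mulmxA uA mul0mx mxE ltxx.
Qed.

Lemma posdefmx_tikhonov n K (X : 'M[R]_(n, K)) (t : R) : 0 < t ->
  posdefmx (X *m X^T + t%:M).
Proof.
move=> t0; split; first by rewrite linearD/= trmx_mul trmxK tr_scalar_mx.
move=> v v0; rewrite -mulmxA -dotE mulmxDl dotDr mul_scalar_mx dotZr -mulmxA dot_mulmx.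
rewrite ltr_wpDl ?dot_ge0// mulr_gt0// lt_neqAle dot_ge0 andbT eq_sym.
by apply: contra v0 => /eqP/dot_eq0 ->.
Qed.

(* As t tends to 0, the ridge residual t (X X^T + t I)^-1 e tends to the residual of
   the projection: the part of e orthogonal to the columns of X is preserved, and a
   vector X X^T z is sent to t (z - t (X X^T + t I)^-1 z). *)
Lemma tikhonov_dist n K (X : 'M[R]_(n, K)) (e : 'cV[R]_n) : exists C : R, forall t i,
  0 < t -> `|(t *: (invmx (X *m X^T + t%:M) *m e)) i 0 -
             (col_annihilator X *m e) i 0| <= t * C.
Proof.
have [c ec] := annihilator_decomp X e; have [z cz] := annihilator_decomp X^T c.
have XcE : X *m c = X *m X^T *m z.
  rewrite cz mulmxDr -{1}[X]trmxK annihilator_orth add0r mulmxA//.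
exists (`|z| + l2norm z) => t i t0.
have Au := posdefmx_unit (posdefmx_tikhonov X t0).
set A := X *m X^T + t%:M in Au *; set Me := col_annihilator X *m e.
have AMe : A *m Me = t *: Me.
  by rewrite mulmxDl mul_scalar_mx -mulmxA annihilator_orth mulmx0 add0r.
pose g := t *: (invmx A *m z).
have Ag : A *m g = t *: z by rewrite -scalemxAr mulKVmx.
have uE : t *: (invmx A *m e) - Me = t *: z - t *: g.
  have ec' : e = Me + (A *m z - t *: z).
    have AzE : A *m z = X *m X^T *m z + t *: z by rewrite mulmxDl mul_scalar_mx.
    by rewrite AzE addrK -XcE; exact: ec.
  rewrite [X in t *: (invmx A *m X) - _]ec' mulmxDr mulmxBr mulKmx// -scalemxAr scalerDr scalerBr.
  rewrite -/g; have -> : t *: (invmx A *m Me) = Me.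
    by rewrite scalemxAr -AMe mulKmx.
  by rewrite addrC addKr.
have gz : l2norm g <= l2norm z.
  have h : l2norm g ^+ 2 <= l2norm g * l2norm z.
    rewrite l2norm_sqr (le_trans _ (dot_le_l2norm g z))//.
    rewrite -(ler_pM2l t0) -[leRHS]dotZr -Ag mulmxDl mul_scalar_mx dotDr dotZr.
    by rewrite lerDr -mulmxA dot_mulmx dot_ge0.
  have [->|g0] := eqVneq (l2norm g) 0; first exact: l2norm_ge0.
  have gp : 0 < l2norm g by rewrite lt_neqAle eq_sym g0 l2norm_ge0.
  by rewrite -(ler_pM2l gp) -expr2.
have -> : (t *: (invmx A *m e)) i 0 - Me i 0 = t * (z i 0 - g i 0).
  have := congr1 (fun v : 'cV_n => v i 0) uE; rewrite [LHS]mxE [X in _ + X]mxE => ->.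
  by clearbody g; rewrite !mxE mulrBr.
rewrite normrM (ger0_norm (ltW t0)) ler_pM2l//.
rewrite (le_trans (ler_normB _ _))// lerD ?norm_mx_entry// (le_trans _ gz)//.
rewrite -(ler_pXn2r (n := 2))// ?nnegrE ?l2norm_ge0// l2norm_sqr.
by rewrite (le_trans _ (norm_le_dot g))// ler_pXn2r ?nnegrE// norm_mx_entry.
Qed.

(** The projector is not continuous in [X] where the rank drops, so the residual is reached as a
    pointwise limit of ridge residuals with parameter [1 / (m + 1)], measurable by the cofactor
    formula. This makes the event on the penalty level measurable. *)
Lemma measurable_annihilator_mul d (T : measurableType d) n K (X : T -> 'M[R]_(n, K))
    (e : T -> 'cV[R]_n) : measurable_fun setT X -> measurable_fun setT e ->
  measurable_fun setT (fun w => col_annihilator (X w) *m e w).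
Proof.
move=> mX me; apply: measurable_fun_mxP => i j; rewrite ord1.
pose t (m : nat) : R := m.+1%:R^-1.
have t0 m : 0 < t m by rewrite invr_gt0.
apply: (@measurable_fun_cvg _ _ _ _ (fun m w =>
  (t m *: (invmx (X w *m (X w)^T + (t m)%:M) *m e w)) i 0)) => [m|w _].
  apply: measurable_mx_entry; apply: measurable_scalemx; first exact: measurable_cst.
  apply: measurable_mulmx => //; apply: measurable_invmx.
    by move=> w; exact/posdefmx_unit/posdefmx_tikhonov.
  apply: measurable_addmx; last exact: measurable_cst.
  by apply: measurable_mulmx => //; exact: measurable_trmx.
have [C hC] := tikhonov_dist (X w) (e w).
apply/cvgrPdist_le => r r0; near=> m.
rewrite distrC (le_trans (hC _ _ (t0 m)))// /t mulrC ler_pdivrMr//.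
rewrite mulrC -ler_pdivrMr// (@le_trans _ _ m%:R) ?ler_nat//.
by near: m; exact: nbhs_infty_ger.
Unshelve. all: by end_near. Qed.

End MeasurableAnnihilator.

(** * Asymptotics *)

Section MonotoneMean.
Context d (T : measurableType d) (R : realType) (P : probability T R).

(** The limit of the means is finite, so monotone convergence yields the integrability of the limit
    together with its mean. *)
Lemma mean_monotone_cvg (h : nat -> T -> R) (f : T -> R) (c : R) :
  (forall n, integrable_fun P (h n)) -> (forall n w, 0 <= h n w) ->
  (forall w, {homo h^~ w : m n / (m <= n)%N >-> m <= n}) ->
  (forall w, h n w @[n --> \oo] --> f w) -> mean P (h n) @[n --> \oo] --> c ->
  integrable_fun P f /\ mean P f = c.
Proof.
move=> ih h0 hm hf hc.
have mh n := integrable_measurable (ih n).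
have mf : measurable_fun setT f by apply: (measurable_fun_cvg mh) => w _.
have f0 w : 0 <= f w.
  by rewrite -(cvg_lim (@Rhausdorff R) (hf w)) limr_ge//; [exact: cvgP (hf w)|exact: nearW].
have E : (\int[P]_w (f w)%:E = c%:E)%E.
  have -> : (\int[P]_w (f w)%:E = \int[P]_w limn (fun n => (h n w)%:E))%E.
    apply: eq_integral => w _; apply/esym/cvg_lim => //.
    by apply: cvg_EFin; [exact: nearW|exact: hf].
  rewrite monotone_convergence//.
  - apply: cvg_lim => //.
    under eq_fun do rewrite integral_mean//.
    by apply: cvg_EFin; [exact: nearW|exact: hc].
  - by move=> n; exact/measurable_EFinP.
  - by move=> n w _; rewrite lee_fin.
  - by move=> w _ m n mn; rewrite lee_fin hm.
split; last by rewrite /Rintegral E.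
apply/integrableP; split; first exact/measurable_EFinP.
under eq_integral do rewrite /= ger0_norm//.
by rewrite E ltry.
Qed.

Lemma le_norm_trunc (m m' u : R) : m <= m' -> `|trunc m u| <= `|trunc m' u|.
Proof.
move=> mm'; have [um|mu] := leP `|u| m; first by rewrite (trunc_id um) (trunc_id (le_trans um mm')).
rewrite {1}/trunc indicE memNset ?mulr0 ?normr0//= in_itv/= -ler_norml.
by apply/negP; rewrite -ltNge.
Qed.

Lemma mean_cond_expectation d' (T' : measurableType d') (Y : T -> R) (X : T -> T')
    (c : R) (B : set T') : measurable_fun setT X ->
  is_cond_expectation P Y X (fun=> c) -> measurable B ->
  mean P (fun w => \1_B (X w) * Y w) = mean P (fun w => \1_B (X w)) * c.
Proof.
move=> mX [iY _ _ hY] mB.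
have mXB : measurable (X @^-1` B) by rewrite -[X in measurable X]setTI; exact: mX.
have H (f : T -> R) : (\int[P]_(w in X @^-1` B) (f w)%:E =
    \int[P]_w (\1_B (X w) * f w)%:E)%E.
  rewrite integral_mkcond; apply: eq_integral => w _; rewrite patchE indicE.
  have -> : (w \in X @^-1` B) = (X w \in B) by apply/idP/idP; rewrite !inE.
  by case: ifP => _; rewrite ?mul1r ?mul0r.
have := hY B mB; rewrite !H => /(congr1 fine); rewrite -!/(Rintegral _ _ _) => ->.
rewrite mulrC -meanZ; last exact: (integrable_indic_fun mXB).
by apply: eq_mean => w; rewrite mulrC.
Qed.

End MonotoneMean.

Lemma dot_delta (R : realType) n (j : 'I_n) (v : 'cV[R]_n) : dot (delta_mx j 0) v = v j 0.
Proof.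
rewrite /dot (bigD1 j)//= mxE !eqxx mul1r big1 ?addr0// => k kj.
by rewrite mxE (negbTE kj) mul0r.
Qed.

(** * First and second moments of the score *)

Section ScoreMoments.
Context (R : realType) (K : nat) (sigma2 : R).
Context (Q : probability ('cV[R]_K * R)%type R) (Sigma : 'M[R]_K).
Hypothesis hSigma_fin : forall j k,
  Q.-integrable setT (fun z => (z.1 j 0 * z.1 k 0)%:E).
Hypothesis hSigma : forall j k, 'E_Q[fun z => z.1 j 0 * z.1 k 0] = (Sigma j k)%:E.
Hypothesis hxeps : forall j, 'E_Q[fun z => z.1 j 0 * z.2] = 0%E.
Hypothesis heps2 : is_cond_expectation Q (fun z => z.2 ^+ 2) fst (fun=> sigma2).

Definition score (t : 'cV[R]_K) (z : 'cV[R]_K * R) : R := dot t z.1 * z.2.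

Lemma measurable_score t : measurable_fun setT (score t).
Proof.
by apply: measurable_funM => //; apply: measurable_dot; exact: measurable_fst.
Qed.

Let design_fin (j k : 'I_K) : integrable_fun Q (fun z : 'cV[R]_K * R => z.1 j 0 * z.1 k 0).
Proof. exact: hSigma_fin. Qed.

Lemma mean_design (j k : 'I_K) : mean Q (fun z : 'cV[R]_K * R => z.1 j 0 * z.1 k 0) = Sigma j k.
Proof. by have := hSigma j k; rewrite unlock (integral_mean (design_fin j k)) => -[]. Qed.

Lemma mean_noise_sqr : integrable_fun Q (fun z : 'cV[R]_K * R => z.2 ^+ 2) /\
  mean Q (fun z : 'cV[R]_K * R => z.2 ^+ 2) = sigma2.
Proof.
have [iY _ _ _] := heps2; split => //.
have := mean_cond_expectation (@measurable_fst _ _ _ _) heps2 measurableT.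
rewrite indicT /= mean_cst mul1r => <-; apply: eq_mean => z; by rewrite mul1r.
Qed.

Lemma mean_dot_sqr (t : 'cV[R]_K) : integrable_fun Q (fun z : 'cV[R]_K * R => dot t z.1 ^+ 2) /\
  mean Q (fun z : 'cV[R]_K * R => dot t z.1 ^+ 2) = dot t (Sigma *m t).
Proof.
have E (z : 'cV[R]_K * R) : dot t z.1 ^+ 2 = \sum_i \sum_j (t i 0 * t j 0) * (z.1 i 0 * z.1 j 0).
  rewrite expr2 /dot mulr_suml; apply: eq_bigr => i _; rewrite mulr_sumr.
  by apply: eq_bigr => j _; ring.
have ij i j : integrable_fun Q (fun z : 'cV[R]_K * R => (t i 0 * t j 0) * (z.1 i 0 * z.1 j 0)).
  exact: integrable_funZ (design_fin i j).
have ii i := integrable_fun_sum (index_enum 'I_K) (ij i).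
split.
  by have := integrable_fun_sum (index_enum 'I_K) ii; under eq_fun do rewrite /= -E.
rewrite (eq_mean E) mean_sum//; apply: eq_bigr => i _.
rewrite mean_sum// mxE mulr_sumr; apply: eq_bigr => j _.
by rewrite meanZ// mean_design; ring.
Qed.

(** The product [(t . x) ^ 2 eps ^ 2] is not known in advance to be integrable. Truncating the first
    factor leaves a bounded function of [x], against which the conditional variance can be used; the
    truncations increase, and their means converge since [(t . x) ^ 2] is integrable. *)
Lemma mean_score_sqr t : integrable_fun Q (fun z : 'cV[R]_K * R => score t z ^+ 2) /\
  mean Q (fun z : 'cV[R]_K * R => score t z ^+ 2) = sigma2 * dot t (Sigma *m t).
Proof.
have [ie _] := mean_noise_sqr; have [it tE] := mean_dot_sqr t.
have mt : measurable_fun setT (fun x : 'cV[R]_K => dot t x).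
  by apply: measurable_dot; exact: measurable_id.
pose h (m : nat) (x : 'cV[R]_K) : R := trunc m%:R (dot t x) ^+ 2.
have mh m : measurable_fun setT (h m).
  by apply: measurable_funX; exact: measurableT_comp (measurable_trunc _) mt.
have h0 m x : 0 <= h m x by exact: sqr_ge0.
have hM m x : `|h m x| <= m%:R ^+ 2.
  by rewrite normrX ler_pXn2r ?nnegrE// norm_trunc_bound.
have hn x : {homo h^~ x : m n / (m <= n)%N >-> m <= n}.
  move=> m n mn; rewrite /h -[leLHS]real_normK ?num_real// -[leRHS]real_normK ?num_real//.
  by rewrite ler_pXn2r ?nnegrE// le_norm_trunc// ler_nat.
have hc x : h m x @[m --> \oo] --> dot t x ^+ 2.
  have c := @trunc_cvg R (dot t x); rewrite expr2.
  under eq_fun do rewrite /h expr2.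
  exact: cvgM.
have mh1 m : measurable_fun setT (fun z : 'cV[R]_K * R => h m z.1).
  exact: measurableT_comp (mh m) (@measurable_fst _ _ _ _).
apply: (@mean_monotone_cvg _ _ _ _ (fun m (z : 'cV[R]_K * R) => h m z.1 * z.2 ^+ 2)
  (fun z : 'cV[R]_K * R => score t z ^+ 2)).
- by move=> m; apply: integrable_funM_bounded (mh1 m) _ ie => z; exact: hM.
- by move=> m z; rewrite mulr_ge0// sqr_ge0.
- by move=> z m n mn; rewrite ler_wpM2r ?sqr_ge0// hn.
- by move=> z; rewrite exprMn; apply: cvgM; [exact: hc|exact: cvg_cst].
have E m : mean Q (fun z : 'cV[R]_K * R => h m z.1 * z.2 ^+ 2) = mean Q (fun z : 'cV[R]_K * R => h m z.1) * sigma2.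
  apply: (mean_factor _ ie _ (mh m) (hM m)); first exact: measurable_fst.
  by move=> B mB; exact: mean_cond_expectation.
under eq_fun do rewrite E; rewrite mulrC -tE; apply: cvgM; last exact: cvg_cst.
apply: (mean_dominated_cvg mh1 _ _ it).2 => [z|m z]; first exact: hc.
rewrite ger0_norm//= /h -[leLHS]real_normK ?num_real// -[leRHS]real_normK ?num_real//.
by rewrite ler_pXn2r ?nnegrE// norm_trunc_le.
Qed.

(** Integrability comes from the second moment; the zero mean is then read on each coordinate from
    [hxeps] and extended by linearity. *)
Lemma mean_score t : integrable_fun Q (score t) /\ mean Q (score t) = 0.
Proof.
have its u : integrable_fun Q (score u).
  exact: integrable_of_sqr (measurable_score u) (mean_score_sqr u).1.
split; first exact: its.
have E z : score t z = \sum_j t j 0 * score (delta_mx j 0) z.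
  rewrite /score {1}/dot mulr_suml; apply: eq_bigr => j _; rewrite dot_delta; ring.
rewrite (eq_mean E) mean_sum => [|j]; last exact/integrable_funZ/its.
apply: big1 => j _; rewrite meanZ//; have := hxeps j.
rewrite unlock (_ : (fun z => _) = EFin \o score (delta_mx j 0)); last first.
  by apply/funext => z; rewrite /= /score dot_delta.
by rewrite integral_mean// => -[->]; rewrite mulr0.
Qed.

End ScoreMoments.

(** * Positive definite matrices: coercivity and inverses *)

Section PositiveDefinite.
Context (R : realType).

Lemma norm_mulmx_le m n p (A : 'M[R]_(m, n)) (B : 'M[R]_(n, p)) :
  `|A *m B| <= n%:R * (`|A| * `|B|).
Proof.
apply: norm_mx_le => [|i j]; first by rewrite !mulr_ge0.
rewrite mxE (le_trans (ler_norm_sum _ _ _))//.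
rewrite (@le_trans _ _ (\sum_(k < n) `|A| * `|B|))//; last first.
  by rewrite sumr_const card_ord mulr_natl.
by apply: ler_sum => k _; rewrite normrM ler_pM// norm_mx_entry.
Qed.

Lemma norm_dot_mulmx_le n (A : 'M[R]_n) (v : 'cV[R]_n) :
  `|dot v (A *m v)| <= n%:R ^+ 2 * `|A| * dot v v.
Proof.
have l1 : l1norm v <= n%:R * `|v|.
  rewrite (@le_trans _ _ (\sum_(k < n) `|v|))//; last first.
    by rewrite sumr_const card_ord mulr_natl.
  by apply: ler_sum => k _; exact: norm_mx_entry.
rewrite dotC (le_trans (norm_dot_le _ _))//.
rewrite (le_trans (ler_pM _ _ (norm_mulmx_le _ _) l1)) ?l1norm_ge0//.
have -> : n%:R * (`|A| * `|v|) * (n%:R * `|v|) = n%:R ^+ 2 * `|A| * `|v| ^+ 2 by ring.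
by rewrite ler_wpM2l ?norm_le_dot// mulr_ge0.
Qed.

(** Cauchy-Schwarz for the form of [A], applied to [v] and [A^-1 v], bounds [(v . v) ^ 2] by
    [v . A v] times [v . A^-1 v], and the last factor is at most a multiple of [v . v]. No spectral
    theory is involved. *)
Lemma posdefmx_coercive n (A : 'M[R]_n) : posdefmx A ->
  exists2 C : R, 0 < C & forall v, dot v v <= C * dot v (A *m v).
Proof.
move=> Apd; have uA := posdefmx_unit Apd; pose B := invmx A.
exists (n%:R ^+ 2 * `|B| + 1) => [|v]; first by rewrite ltr_wpDl// mulr_ge0.
have cs := cauchy_schwarz_posdef v (B *m v) Apd.
rewrite mulKVmx// in cs.
have [v0|vn0] := eqVneq (dot v v) 0.
  by rewrite (dot_eq0 v0) mulmx0 dot0l mulr0.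
have vp : 0 < dot v v by rewrite lt_neqAle eq_sym vn0 dot_ge0.
have h : dot (B *m v) v <= (n%:R ^+ 2 * `|B| + 1) * dot v v.
  rewrite dotC (le_trans (ler_norm _))// (le_trans (norm_dot_mulmx_le _ _))//.
  by rewrite ler_pM2r// lerDl.
rewrite -(ler_pM2r vp) -expr2 (le_trans cs)// [leRHS]mulrAC mulrC.
by rewrite ler_wpM2r// posdefmx_dot_ge0.
Qed.

Lemma posdefmx_invmx n (A : 'M[R]_n) : posdefmx A -> posdefmx (invmx A).
Proof.
move=> Apd; have uA := posdefmx_unit Apd; have [AT _] := Apd.
split=> [|v v0]; first by rewrite trmx_inv AT.
rewrite -mulmxA -dotE; set w := invmx A *m v.
have vE : v = A *m w by rewrite mulKVmx.
rewrite vE dotC; apply: posdefmx_dot_gt0 => //.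
by apply: contra v0 => /eqP w0; rewrite vE w0 mulmx0.
Qed.

Lemma posdefmx_scale n (A : 'M[R]_n) (a : R) : 0 < a -> posdefmx A -> posdefmx (a *: A).
Proof.
move=> a0 [AT A0]; split=> [|v v0]; first by rewrite linearZ/= AT.
by rewrite -scalemxAr -scalemxAl mxE mulr_gt0// A0.
Qed.

Lemma posdefmx_diag_gt0 n (A : 'M[R]_n) i : posdefmx A -> 0 < A i i.
Proof.
move=> [_ /(_ (delta_mx i 0))].
have -> : ((delta_mx i 0 : 'cV[R]_n)^T *m A *m (delta_mx i 0 : 'cV[R]_n)) 0 0 = A i i.
  by rewrite trmx_delta -rowE -colE !mxE.
apply; apply/eqP => /(congr1 (fun v : 'cV_n => v i 0)) /eqP.
by rewrite !mxE !eqxx oner_eq0.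
Qed.

End PositiveDefinite.

(** * Deterministic bounds for the scaled estimation error *)

Section EstimationError.
Context (R : realType) (n K : nat) (X : 'M[R]_(n, K)) (beta : 'cV[R]_K).
Context (e al y : 'cV[R]_n) (lam l c : R) (bh : 'cV[R]_K) (ah : 'cV[R]_n).
Hypothesis yE : y = X *m beta + al + e.
Hypotheses (n0 : (0 < n)%N) (lam0 : 0 < lam) (l0 : 0 < l) (c0 : 0 < c).
Hypothesis hmin : forall b a, sqrt_lasso_obj lam y X bh ah <= sqrt_lasso_obj lam y X b a.

Definition gram : 'M[R]_K := n%:R^-1 *: (X^T *m X).
Definition noise_score : 'cV[R]_K := (Num.sqrt n%:R)^-1 *: (X^T *m e).
Definition noise_level : R := l2norm (col_annihilator X *m e) / Num.sqrt n%:R.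
Definition outlier_count : R := \sum_(i < n) (al i 0 != 0)%:R.
(** Times 192 and the noise level, this bounds the term by which the outliers perturb the normal
    equations; the sparsity conditions below are expressed through it. *)
Definition outlier_effect : R := outlier_count * lam * `|X| / Num.sqrt n%:R.

Local Notation root := (Num.sqrt n%:R).
Local Notation Me := (col_annihilator X *m e).
Local Notation W := noise_score.
Local Notation q := noise_level.
Local Notation s := outlier_count.
Local Notation v := outlier_effect.

Let np : 0 < n%:R :> R. Proof. by rewrite ltr0n. Qed.
Let root_gt0 : 0 < root :> R. Proof. by rewrite sqrtr_gt0. Qed.
Let root_sqr : root ^+ 2 = n%:R :> R. Proof. by rewrite sqr_sqrtr ?ltW. Qed.

Lemma dot_gram (b : 'cV[R]_K) : dot (X *m b) (X *m b) = n%:R * dot b (gram *m b).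
Proof.
rewrite -scalemxAl dotZr mulVKf ?gt_eqF// -mulmxA [RHS]dot_mulmx trmxK//.
Qed.

(** Half of the coercivity of [Sigma] survives a perturbation whose quadratic form uses at most the
    other half. *)
Lemma gram_ge (Sigma : 'M[R]_K) (C : R) (b : 'cV[R]_K) :
  dot b b <= C * dot b (Sigma *m b) -> 0 < C ->
  K%:R ^+ 2 * `|gram - Sigma| <= (2 * C)^-1 ->
  (2 * C)^-1 * dot b b <= dot b (gram *m b).
Proof.
move=> hC C0 hS.
have h1 : dot b b / C <= dot b (Sigma *m b) by rewrite ler_pdivrMr// mulrC.
have h2 := norm_dot_mulmx_le (gram - Sigma) b.
rewrite mulmxBl dotBr in h2.
have h3 := ler_wpM2r (dot_ge0 b) hS.
have E : dot b b / C = (2 * C)^-1 * dot b b + (2 * C)^-1 * dot b b.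
  by field; rewrite gt_eqF.
move: (le_trans h2 h3) h1; rewrite E ler_norml => /andP[h _]; move: h.
move: ((2 * C)^-1 * dot b b) (dot b (gram *m b)) (dot b (Sigma *m b)) => a1 a2 a3.
lra.
Qed.

Hypothesis eigen : forall b, l * dot b b <= dot b (gram *m b).

(** By Pythagoras the difference is the squared norm of the projection of [e] divided by [n];
    [proj_le] controls it by the squared norm of the score, which will be bounded in probability. *)
Lemma noise_level_sqr :
  `|noise_level ^+ 2 - dot e e / n%:R| <= dot noise_score noise_score / l / n%:R.
Proof.
have [b eb] := annihilator_decomp X e.
have ln0 : 0 < l * n%:R by rewrite mulr_gt0.
have h b' : l * n%:R * dot b' b' <= dot (X *m b') (X *m b').
  by rewrite dot_gram mulrAC mulrC ler_pM2l.
have h1 := proj_le ln0 h eb; have h2 := annihilator_pythagoras eb.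
have -> : q ^+ 2 = dot Me Me / n%:R by rewrite expr_div_n root_sqr l2norm_sqr.
have WW : dot W W = dot (X^T *m e) (X^T *m e) / n%:R.
  by rewrite dotZl dotZr mulrA -expr2 exprVn root_sqr mulrC.
rewrite WW h2 -mulrBl opprD addrA subrr add0r mulNr normrN ger0_norm; last first.
  by rewrite divr_ge0 ?dot_ge0// ltW.
rewrite ler_pM2r ?invr_gt0// (le_trans h1)// le_eqVlt; apply/orP; left; apply/eqP.
by field; rewrite !gt_eqF.
Qed.

Hypothesis q_gt0 : 0 < noise_level.
Hypothesis hlam : 2 * root * (`|Me| / l2norm Me) <= lam.
Hypothesis Xge : c <= `|X|.
Hypothesis sparse : 4 * K%:R * outlier_effect ^+ 2 <= 3 / 4 * l.
Hypothesis sparse_lam : 8 * (outlier_effect / c) ^+ 2 <= 1.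

Let N_gt0 : 0 < l2norm Me.
Proof. by have := q_gt0; rewrite /noise_level pmulr_lgt0// invr_gt0. Qed.

Let s_ge0 : 0 <= s. Proof. exact: sumr_ge0. Qed.

Let v_ge0 : 0 <= v. Proof. by rewrite divr_ge0 ?mulr_ge0 ?(ltW lam0). Qed.

(* s is a natural number *)
Let s_le_sqr : s <= s ^+ 2.
Proof.
rewrite /outlier_count -natr_sum; case: (\sum_i _)%N => [|m]; first by rewrite expr0n.
by rewrite expr2 ler_peMr// ler1n.
Qed.

(** A Euclidean norm is at most [root] times the sup norm, so the quantity that [lam] dominates is
    itself at least 2. *)
Let lam_ge2 : 2 <= lam.
Proof.
rewrite (le_trans _ hlam)// -mulrA ler_peMr// mulrA ler_pdivlMr// mul1r.
rewrite -(ler_pXn2r (n := 2))// ?nnegrE ?l2norm_ge0//.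
by rewrite l2norm_sqr exprMn root_sqr dot_le_norm.
Qed.

Let vX : v ^+ 2 = (s * lam) ^+ 2 * `|X| ^+ 2 / n%:R.
Proof. by rewrite /outlier_effect expr_div_n root_sqr exprMn. Qed.

Lemma outlier_penalty_le :
  s * lam ^+ 2 / n%:R <= (outlier_effect / c) ^+ 2.
Proof.
rewrite expr_div_n vX ler_pdivlMr ?exprn_gt0// mulrAC.
rewrite ler_pM2r ?invr_gt0//.
apply: ler_pM; rewrite ?sqr_ge0//.
- by rewrite mulr_ge0 ?sqr_ge0.
- by rewrite exprMn ler_wpM2r ?sqr_ge0.
- by rewrite ler_pXn2r ?nnegrE// ltW.
Qed.

Let sparse_lam' : 8 * (s * lam ^+ 2) <= n%:R.
Proof.
have := sparse_lam; have h := outlier_penalty_le => h'.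
rewrite -[leRHS]mul1r -ler_pdivrMr// -mulrA (le_trans _ h')// ler_pM2l//.
Qed.

Let sparse' : 16 * K%:R * s * `|X| ^+ 2 <= 3 / 4 * (l * n%:R).
Proof.
(* Here [4 <= lam ^ 2] and [s <= s ^ 2] are used together. *)
have h : 4 * s * `|X| ^+ 2 <= v ^+ 2 * n%:R.
  rewrite vX divfK ?gt_eqF// ler_wpM2r ?sqr_ge0// exprMn mulrC.
  apply: ler_pM => //; rewrite (_ : 4 = 2 ^+ 2 :> R); last by rewrite -natrX.
  by rewrite ler_pXn2r ?nnegrE ?(ltW lam0).
rewrite [leRHS]mulrA (le_trans _ (ler_wpM2r (ltW np) sparse))//.
have -> : 16 * K%:R * s * `|X| ^+ 2 = 4 * K%:R * (4 * s * `|X| ^+ 2) by ring.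
by rewrite -[leRHS]mulrA ler_wpM2l// mulr_ge0.
Qed.

Let eigen' (b : 'cV[R]_K) : l * n%:R * dot b b <= dot (X *m b) (X *m b).
Proof. by rewrite dot_gram mulrAC mulrC ler_pM2l. Qed.

Lemma residual_level_le :
  `|l2norm (y - X *m bh - ah) / root - noise_level| <=
  192 * (outlier_effect / c) ^+ 2 * noise_level.
Proof.
have := residual_norm_error yE n0 lam0 l0 hmin N_gt0 hlam eigen' sparse' sparse_lam'.
move=> /le_trans; apply; rewrite -/outlier_count -/noise_level ler_wpM2r ?(ltW q_gt0)//.
by rewrite ler_wpM2l// outlier_penalty_le.
Qed.

Let Z : 'cV[R]_K := root *: (bh - beta).
Let r : 'cV[R]_K := root^-1 *: (X^T *m (ah - al)).

Let r_le : `|r| <= 192 * v * q.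
Proof.
have := l1norm_alpha_error yE n0 lam0 l0 hmin N_gt0 hlam eigen' sparse' sparse_lam'.
rewrite -/outlier_count -/noise_level => h.
rewrite normrZ ger0_norm ?invr_ge0 ?(ltW root_gt0)// mulrC.
rewrite ler_pdivrMr// (le_trans (norm_trmx_mul_le _ _))//.
rewrite (le_trans (ler_wpM2l _ h))// le_eqVlt; apply/orP; left; apply/eqP.
by rewrite /outlier_effect; field; rewrite gt_eqF.
Qed.

Let gramZ : gram *m Z = W - r.
Proof.
have E : n%:R^-1 * root = root^-1 :> R 
    by move: root_sqr root_gt0; move: root => z <- z0; field; rewrite gt_eqF.
have h := gram_estimation_error yE n0 hmin.
rewrite -scalemxAr -scalemxAl scalerA mulrC E h mulmxBr scalerBr//.
Qed.

(** Pairing the normal equations with [Z] itself and using the lower eigenvalue bound gives a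
    quadratic inequality in the norm of [Z]. *)
Lemma scaled_error_norm_le :
  `|Z| <= K%:R * (`|noise_score| + 192 * outlier_effect * noise_level) / l.
Proof.
have h1 : l * dot Z Z <= dot Z (W - r) by rewrite -gramZ eigen.
have h2 : dot Z (W - r) <= `|W - r| * l1norm Z.
  by rewrite dotC (le_trans (ler_norm _))// norm_dot_le.
have l1 : l1norm Z <= K%:R * `|Z|.
  rewrite (@le_trans _ _ (\sum_(k < K) `|Z|))//; last first.
    by rewrite sumr_const card_ord mulr_natl.
  by apply: ler_sum => k _; exact: norm_mx_entry.
have h3 : `|W - r| <= `|W| + 192 * v * q.
  by rewrite (le_trans (ler_normB _ _))// lerD2l.
have [->|Z0] := eqVneq `|Z| 0.
  by rewrite divr_ge0 ?mulr_ge0 ?addr_ge0 ?mulr_ge0// ltW.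
have Zp : 0 < `|Z| by rewrite lt_neqAle eq_sym Z0 normr_ge0.
rewrite ler_pdivlMr// -(ler_pM2r Zp).
have -> : `|Z| * l * `|Z| = l * `|Z| ^+ 2 by ring.
rewrite (le_trans (ler_wpM2l (ltW l0) (norm_le_dot Z)))// (le_trans h1)//.
rewrite (le_trans h2)// (le_trans (ler_pM _ _ h3 l1)) ?l1norm_ge0//.
by rewrite le_eqVlt; apply/orP; left; apply/eqP; ring.
Qed.

(** The identity [Sigma Z - W = - ((gram - Sigma) Z + r)] avoids inverting the random matrix [gram]:
    a small matrix multiplies [Z], whose norm is already controlled. *)
Lemma scaled_error_expansion (Sigma : 'M[R]_K) : posdefmx Sigma ->
  `|Z - invmx Sigma *m noise_score| <=
  K%:R * `|invmx Sigma| *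
  (K%:R * (`|gram - Sigma| * `|Z|) + 192 * outlier_effect * noise_level).
Proof.
move=> Spd; have uS := posdefmx_unit Spd.
have -> : Z - invmx Sigma *m W = - (invmx Sigma *m ((gram - Sigma) *m Z + r)).
  rewrite mulmxBl gramZ addrAC subrK mulmxBr mulKmx// opprB//.
rewrite normrN (le_trans (norm_mulmx_le _ _))// mulrA ler_wpM2l ?mulr_ge0//.
by rewrite (le_trans (ler_normD _ _))// lerD// norm_mulmx_le.
Qed.

End EstimationError.

Section CloseMeans.
Context (R : realType) (d : nat -> measure_display).
Context (T : forall n, measurableType (d n)) (P : forall n, probability (T n) R).

Lemma with_prob_mean_dist (f g : forall n, T n -> R) (e r M : R) : 0 <= e -> 0 <= M ->
  (forall n, measurable_fun setT (f n)) -> (forall n, measurable_fun setT (g n)) ->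
  (forall n w, `|f n w| <= M) -> (forall n w, `|g n w| <= M) ->
  with_prob P r (fun n (w : T n) => `|f n w - g n w| <= e) ->
  \forall n \near \oo, `|mean (P n) (f n) - mean (P n) (g n)| <= e + 2 * M * r.
Proof.
move=> e0 M0 mf mg fM gM; apply: filterS => n [B [mB PB BA]].
have If := integrable_bounded (P := P n) (mf n) (fM n).
have Ig := integrable_bounded (P := P n) (mg n) (gM n).
have iB := integrable_indic_fun (P := P n) mB.
have IfB : integrable_fun (P n) (fun w => f n w - g n w) by exact: integrable_funB.
have iS : integrable_fun (P n) (fun w => e + 2 * M * \1_B w).
  by apply: integrable_funD; [exact: integrable_cst_fun|exact: integrable_funZ].
rewrite -meanB// (le_trans (norm_mean_le IfB))//.
apply: (@le_trans _ _ (mean (P n) (fun w => e + 2 * M * \1_B w))).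
  apply: mean_le => //; first exact: integrable_fun_norm.
  move=> w; rewrite indicE; have [_|/negP wB] := boolP (w \in B).
    rewrite mulr1 (le_trans (ler_normB _ _))// ler_wpDl//.
    by rewrite mulr_natl mulr2n lerD.
  by rewrite mulr0 addr0 BA// => Bw; apply: wB; rewrite inE.
rewrite meanD//; [|exact: integrable_cst_fun|exact: integrable_funZ].
rewrite mean_cst meanZ// mean_indic// lerD2l ler_wpM2l ?mulr_ge0//.
by rewrite -lee_fin fineK ?fin_num_measure.
Qed.

End CloseMeans.

(** * Limits of the averages of design, noise and score *)

Section IidSample.
Context (R : realType) (K : nat) (sigma2 : R).
Context (Q : probability ('cV[R]_K * R)%type R) (Sigma : 'M[R]_K).
Hypothesis hSigma_fin : forall j k,
  Q.-integrable setT (fun z => (z.1 j 0 * z.1 k 0)%:E).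
Hypothesis hSigma : forall j k, 'E_Q[fun z => z.1 j 0 * z.1 k 0] = (Sigma j k)%:E.
Hypothesis hxeps : forall j, 'E_Q[fun z => z.1 j 0 * z.2] = 0%E.
Hypothesis heps2 : is_cond_expectation Q (fun z => z.2 ^+ 2) fst (fun=> sigma2).
Context (d : nat -> measure_display) (T : forall n, measurableType (d n)).
Context (P : forall n, probability (T n) R).
Context (x : forall n, 'I_n -> T n -> 'cV[R]_K) (eps : forall n, 'I_n -> T n -> R).
Hypothesis mx : forall n i, measurable_fun setT (@x n i).
Hypothesis meps : forall n i, measurable_fun setT (@eps n i).
Hypothesis indep : forall n, mutually_independent (P n) (fun (i : 'I_n) w => (x i w, eps i w)).
Hypothesis law : forall n (i : 'I_n), has_law (P n) (fun w => (x i w, eps i w)) Q.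

Definition design n w : 'M[R]_(n, K) := design_mx (fun i => x i w).
Definition noise n w : 'cV[R]_n := \col_i eps i w.

Let mxe n (i : 'I_n) : measurable_fun setT (fun w => (x i w, eps i w)).
Proof. exact: measurable_fun_pair. Qed.

Lemma measurable_design n : measurable_fun setT (@design n).
Proof.
apply: measurable_fun_mxP => i j; under eq_fun do rewrite mxE.
exact: measurable_mx_entry.
Qed.

Lemma measurable_noise n : measurable_fun setT (@noise n).
Proof.
apply: measurable_fun_mxP => i j; under eq_fun do rewrite mxE.
exact: meps.
Qed.

Lemma law_of_large_numbers (h : 'cV[R]_K * R -> R) e r : integrable_fun Q h ->
  0 < e -> 0 < r ->
  with_prob P r (fun n (w : T n) =>
    `|n%:R^-1 * (\sum_(i < n) h (x i w, eps i w)) - mean Q h| < e).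
Proof.
move=> ih e0 r0.
apply: (with_prob_markov (a := fun=> e)) => [_//|].
have := mean_dist_average mxe indep law ih (mulr_gt0 r0 e0).
by apply: filterS => n [i1 i2]; split.
Qed.

Lemma gram_design n (w : T n) j k : gram (design w) j k =
  n%:R^-1 * \sum_(i < n) (x i w j 0 * x i w k 0).
Proof. by rewrite !mxE; congr (_ * _); apply: eq_bigr => i _; rewrite !mxE. Qed.

Lemma gram_cvg e r : 0 < e -> 0 < r ->
  with_prob P r (fun n (w : T n) => `|gram (design w) - Sigma| < e).
Proof.
move=> e0 r0.
have hjk (jk : 'I_K * 'I_K) s : 0 < s ->
    with_prob P s (fun n (w : T n) => `|(gram (design w) - Sigma) jk.1 jk.2| < e).
  move=> s0; have := law_of_large_numbers (hSigma_fin jk.1 jk.2) e0 s0.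
  apply: with_prob_sub; apply: nearW => n w.
  by rewrite !mxE -(mean_design hSigma_fin hSigma) -gram_design !mxE.
apply: with_prob_sub (with_prob_forall r0 hjk).
by apply: nearW => n w h; apply: norm_mx_lt => // i j; exact: h (i, j).
Qed.

Lemma noise_sqr_cvg e r : 0 < e -> 0 < r ->
  with_prob P r (fun n (w : T n) => `|dot (noise w) (noise w) / n%:R - sigma2| < e).
Proof.
move=> e0 r0; have [ie iE] := mean_noise_sqr heps2.
have := law_of_large_numbers ie e0 r0; rewrite iE.
apply: with_prob_sub; apply: nearW => n w; rewrite mulrC.
by congr (`|_ * _ - _| < _); apply: eq_bigr => i _; rewrite !mxE expr2.
Qed.

Lemma dot_noise_score n (w : T n) t : dot t (noise_score (design w) (noise w)) =
  (Num.sqrt n%:R)^-1 * \sum_(i < n) score t (x i w, eps i w).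
Proof.
rewrite dotZr dot_mulmx trmxK; congr (_ * _); apply: eq_bigr => i _.
rewrite !mxE /score; congr (_ * _); apply: eq_bigr => j _.
by rewrite mxE mulrC.
Qed.

Lemma measurable_noise_score n :
  measurable_fun setT (fun w : T n => noise_score (design w) (noise w)).
Proof.
apply: measurable_scalemx; first exact: measurable_cst.
apply: measurable_mulmx; last exact: measurable_noise.
exact/measurable_trmx/measurable_design.
Qed.

(** The mean of the squared norm is the sum of the [m j] for every positive [n], so Markov's
    inequality gives one bound for all these sample sizes. *)
Lemma noise_score_tight r : 0 < r -> exists2 A : R, 0 < A & with_prob P r (fun n (w : T n) =>
  dot (noise_score (design w) (noise w)) (noise_score (design w) (noise w)) < A).
Proof.
move=> r0; pose D j : 'cV[R]_K := delta_mx j 0.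
pose m j := mean Q (fun z => score (D j) z ^+ 2).
have m0 j : 0 <= m j by apply: mean_ge0 => z; exact: sqr_ge0.
have S0 : 0 <= \sum_j m j by apply: sumr_ge0 => j _.
exists ((\sum_j m j + 1) / r); first by rewrite divr_gt0// ltr_wpDl.
apply: (with_prob_markov (a := fun=> _)) => [_|].
  by rewrite divr_gt0// ltr_wpDl.
exists 1%N => // n /= n0; have np : 0 < n%:R :> R by rewrite ltr0n.
have s2 j := mean_sqr_sum (@mxe n) (@indep n) (@law n) (measurable_score (D j))
  (mean_score_sqr hSigma_fin hSigma heps2 (D j)).1
  (mean_score hSigma_fin hSigma hxeps heps2 (D j)).2.
have E (w : T n) : dot (noise_score (design w) (noise w)) (noise_score (design w) (noise w)) =
    \sum_j n%:R^-1 * (\sum_(i < n) score (D j) (x i w, eps i w)) ^+ 2.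
  apply: eq_bigr => j _; set W := noise_score _ _.
  by rewrite -(dot_delta j W) dot_noise_score -expr2 exprMn exprVn sqr_sqrtr ?ltW.
have ij j := integrable_funZ n%:R^-1 (s2 j).1.
split.
- rewrite (_ : (fun _ => _) = fun w =>
    \sum_j n%:R^-1 * (\sum_(i < n) score (D j) (x i w, eps i w)) ^+ 2).
    exact: integrable_fun_sum.
  exact/funext.
- by move=> w; exact: dot_ge0.
rewrite (eq_mean E) mean_sum// mulrC divfK ?gt_eqF//.
rewrite (eq_bigr m) ?lerDl// => j _.
by rewrite meanZ ?(s2 j).1// (s2 j).2 mulKf ?gt_eqF.
Qed.

(** A diagonal entry of the Gram matrix is an average of squares, at most the squared sup norm, and
    it converges to [Sigma j j], which is positive. *)
Lemma design_norm_ge (j : 'I_K) r : posdefmx Sigma -> 0 < r ->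
  with_prob P r (fun n (w : T n) => Num.sqrt (Sigma j j / 2) <= `|design w|).
Proof.
move=> Spd r0; have S0 := posdefmx_diag_gt0 j Spd.
have S2 : 0 < Sigma j j / 2 by rewrite divr_gt0.
apply: with_prob_sub (gram_cvg S2 r0); exists 1%N => // n /= n0 w h.
have np : 0 < n%:R :> R by rewrite ltr0n.
have : gram (design w) j j <= `|design w| ^+ 2.
  rewrite gram_design mulrC ler_pdivrMr//.
  apply: (@le_trans _ _ (\sum_(i < n) `|design w| ^+ 2)); last first.
    by rewrite sumr_const card_ord mulr_natr.
  apply: ler_sum => i _; rewrite -expr2 -real_normK ?num_real//.
  rewrite ler_pXn2r ?nnegrE// (le_trans _ (norm_mx_entry _ i j))//.
  by rewrite mxE.
have := le_lt_trans (norm_mx_entry _ j j) h.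
rewrite mxE [X in _ + X]mxE ltr_norml => /andP[h1 _] h2.
have h3 : Sigma j j / 2 <= `|design w| ^+ 2 by move: h1 h2; lra.
rewrite -(ler_pXn2r (n := 2))// ?nnegrE ?sqrtr_ge0// sqr_sqrtr//.
exact: ltW.
Qed.

(* Cramer-Wold: the projection of Sigma^-1 W along t is the normalized sum of the
   scores in the direction Sigma^-1 t. *)
Lemma noise_score_clt (t : 'cV[R]_K) (s : R) : posdefmx Sigma ->
  mean (P n) (fun w : T n =>
    cos (dot t (invmx Sigma *m noise_score (design w) (noise w)) + s))
    @[n --> \oo] -->
  expR (- (dot t ((sigma2 *: invmx Sigma) *m t) / 2)) * cos s.
Proof.
move=> Spd; have uS := posdefmx_unit Spd; have [BT _] := posdefmx_invmx Spd.
pose u := invmx Sigma *m t.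
have [i2 E2] := mean_score_sqr hSigma_fin hSigma heps2 u.
have E n (w : T n) : dot t (invmx Sigma *m noise_score (design w) (noise w)) =
    (Num.sqrt n%:R)^-1 * \sum_(i < n) score u (x i w, eps i w).
  by rewrite dot_mulmx BT dot_noise_score.
under eq_fun do (under eq_mean do rewrite E).
have := mean_cos_clt (s := s) mxe indep law (measurable_score u) i2
  (mean_score hSigma_fin hSigma hxeps heps2 u).2.
by rewrite E2 -scalemxAl dotZr mulKVmx// dotC.
Qed.

End IidSample.

(** * Asymptotics of the estimator *)

Section SquareRootLassoEstimator.
Context (R : realType) (K : nat) (beta : 'cV[R]_K) (sigma2 : R).
Hypotheses (hK : (0 < K)%N) (sigma2_gt0 : 0 < sigma2).
Context (Q : probability ('cV[R]_K * R)%type R) (Sigma : 'M[R]_K).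
Hypothesis hSigma_fin : forall j k,
  Q.-integrable setT (fun z => (z.1 j 0 * z.1 k 0)%:E).
Hypothesis hSigma : forall j k, 'E_Q[fun z => z.1 j 0 * z.1 k 0] = (Sigma j k)%:E.
Hypothesis Spd : posdefmx Sigma.
Hypothesis hxeps : forall j, 'E_Q[fun z => z.1 j 0 * z.2] = 0%E.
Hypothesis heps2 : is_cond_expectation Q (fun z => z.2 ^+ 2) fst (fun=> sigma2).
Context (d : nat -> measure_display) (T : forall n, measurableType (d n)).
Context (P : forall n, probability (T n) R).
Context (x : forall n, 'I_n -> T n -> 'cV[R]_K) (eps alpha y : forall n, 'I_n -> T n -> R).
Hypothesis mx : forall n i, measurable_fun setT (@x n i).
Hypothesis meps : forall n i, measurable_fun setT (@eps n i).
Hypothesis malpha : forall n i, measurable_fun setT (@alpha n i).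
Hypothesis yE : forall n i w,
  y i w = ((x i w)^T *m beta) 0 0 + alpha i w + @eps n i w.
Hypothesis indep :
  forall n, mutually_independent (P n) (fun (i : 'I_n) w => (x i w, eps i w)).
Hypothesis law : forall n (i : 'I_n), has_law (P n) (fun w => (x i w, eps i w)) Q.
Context (p : nat -> R).
Hypothesis hp : forall n i, P n [set w | @alpha n i w != 0] = (p n)%:E.
Context (lam : nat -> R).
Hypothesis lam_gt0 : forall n, 0 < lam n.
Local Notation X := (design x).
Local Notation e := (noise eps).
Local Notation al := (noise alpha).
Local Notation Y := (noise y).
Hypothesis hlam : P n [set w |
    2 * Num.sqrt n%:R * (`|col_annihilator (X w) *m e w| /
      l2norm (col_annihilator (X w) *m e w)) <= lam n] @[n --> \oo] --> 1%E.
Hypothesis hrate : cvg_in_probability P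
  (fun n (w : T n) => p n * lam n * `|X w| * Num.sqrt n%:R : R^o) 0.
Context (bhat : forall n, T n -> 'cV[R]_K) (ahat : forall n, T n -> 'cV[R]_n).
Hypothesis mbhat : forall n, measurable_fun setT (@bhat n).
Hypothesis mahat : forall n, measurable_fun setT (@ahat n).
Hypothesis hmin : forall n (w : T n) b a,
  sqrt_lasso_obj (lam n) (Y w) (X w) (bhat w) (ahat w) <=
  sqrt_lasso_obj (lam n) (Y w) (X w) b a.

Let modelE n (w : T n) : Y w = X w *m beta + al w + e w.
Proof.
apply/colP => i; rewrite mxE yE [RHS]mxE [X in _ = X + _]mxE ![(noise _ _) i 0]mxE.
congr (_ + _ + _); rewrite !mxE; apply: eq_bigr => j _.
by rewrite !mxE.
Qed.

Let mset n (i : 'I_n) : measurable [set w | alpha i w != 0].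
Proof.
rewrite (_ : [set _ | _] = ~` (alpha i @^-1` [set 0])); last first.
  by apply/seteqP; split=> w /=; [move/eqP|move/eqP].
by apply: measurableC; rewrite -[X in measurable X]setTI; exact: malpha.
Qed.

Let mean_outlier_count n : integrable_fun (P n) (fun w => outlier_count (al w)) /\
  mean (P n) (fun w => outlier_count (al w)) = n%:R * p n.
Proof.
have E (w : T n) : outlier_count (al w) = \sum_(i < n) \1_[set w | alpha i w != 0] w.
  apply: eq_bigr => i _; rewrite mxE indicE; congr (nat_of_bool _)%:R.
  by apply/idP/idP; rewrite inE.
have ii (i : 'I_n) := integrable_indic_fun (P := P n) (mset i).
split.
  rewrite (_ : (fun _ => _) = fun w => \sum_(i < n) \1_[set w | alpha i w != 0] w).
    exact: integrable_fun_sum.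
  exact/funext.
rewrite (eq_mean E) mean_sum// (eq_bigr (fun=> p n)) => [|i _].
  by rewrite sumr_const card_ord mulr_natl.
by rewrite mean_indic// hp.
Qed.

(* Markov's inequality; when p n = 0 there are almost surely no outliers. *)
Lemma outlier_count_le r : 0 < r ->
  with_prob P r (fun n (w : T n) => outlier_count (al w) <= n%:R * p n / r).
Proof.
move=> r0; pose a n := if 0 < n%:R * p n then n%:R * p n / r else 1.
have a0 n : 0 < a n by rewrite /a; case: ifPn => // h; rewrite divr_gt0.
have np0 n : 0 <= n%:R * p n.
  by rewrite -(mean_outlier_count n).2 mean_ge0// => w; exact: sumr_ge0.
have : with_prob P r (fun n w => outlier_count (@noise _ _ _ alpha n w) < a n).
  apply: with_prob_markov => //; apply: nearW => n.
  have [i1 i2] := mean_outlier_count n; split => //; first by move=> w; exact: sumr_ge0.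
  rewrite i2 /a; case: ifPn => [_|]; first by rewrite [leRHS]mulrC divfK// gt_eqF.
  by rewrite -leNgt mulr1 => /le_trans; apply; exact: ltW.
apply: with_prob_sub; apply: nearW => n w; rewrite /a; case: ifPn => [_ /ltW//|].
rewrite -leNgt => h; have -> : n%:R * p n = 0 by apply/le_anti; rewrite h np0.
(* The threshold is 1 in this case, and a natural number below 1 is 0. *)
by rewrite mul0r /outlier_count -natr_sum ltrn1 ltnS leqn0 => /eqP ->.
Qed.

Lemma outlier_effect_cvg u r : 0 < u -> 0 < r ->
  with_prob P r (fun n (w : T n) => outlier_effect (X w) (al w) (lam n) < u).
Proof.
move=> u0 r0; have r2 : 0 < r / 2 by rewrite divr_gt0.
have mr n : measurable_fun setT
    (fun w : T n => `|(p n * lam n * `|X w| * Num.sqrt n%:R : R^o) - 0|).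
  apply: measurableT_comp (@normr_measurable _ _) _.
  apply: measurable_funB => //; apply: measurable_funM => //.
  by apply: measurable_funM => //; apply: measurable_mx_norm; exact: measurable_design.
(* The threshold [u (r / 2)] compensates the factor [2 / r] that Markov's inequality puts on the
   outlier count. *)
have h := cvg_in_probability_with_prob (mulr_gt0 u0 r2) r2 mr hrate.
rewrite [r]splitr; apply: with_prob_sub (with_prob_and h (outlier_count_le r2)).
exists 1%N => // n /= n0 w [h1 h2].
have np : 0 < n%:R :> R by rewrite ltr0n.
have rp : 0 < Num.sqrt n%:R :> R by rewrite sqrtr_gt0.
rewrite subr0 in h1; have := le_lt_trans (ler_norm _) h1; rewrite -ltr_pdivrMr//.
apply: le_lt_trans; rewrite /outlier_effect.
have lX : 0 <= lam n * `|X w| / Num.sqrt n%:R.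
  by rewrite divr_ge0 ?mulr_ge0// ltW.
have := ler_wpM2r lX h2; rewrite !mulrA => /le_trans; apply.
rewrite le_eqVlt; apply/orP; left; apply/eqP.
have -> : n%:R = Num.sqrt n%:R ^+ 2 :> R by rewrite sqr_sqrtr ?ltW.
move: rp; rewrite sqrtr_sqr; move: (Num.sqrt _) => z z0.
by rewrite (gtr0_norm z0); field; rewrite !gt_eqF.
Qed.

Let mX n : measurable_fun setT (fun w : T n => X w).
Proof. exact: measurable_design. Qed.

Lemma penalty_event r : 0 < r -> with_prob P r (fun n (w : T n) =>
  2 * Num.sqrt n%:R * (`|col_annihilator (X w) *m e w| /
      l2norm (col_annihilator (X w) *m e w)) <= lam n).
Proof.
move=> r0; apply: with_prob_lim1 => // n.
have mM : measurable_fun setT (fun w : T n => col_annihilator (X w) *m e w).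
  by apply: measurable_annihilator_mul => //; exact: measurable_noise.
apply: measurable_le; apply: measurable_funM => //; apply: measurable_funM.
  exact: measurable_mx_norm.
by apply: measurableT_comp (@measurable_inv R) _; exact: measurable_l2norm.
Qed.

Definition regular_sample (l c A u : R) n (w : T n) :=
  (((0 < n)%N /\ forall b, l * dot b b <= dot b (gram (X w) *m b)) /\
   (0 < noise_level (X w) (e w) /\ `|noise_level (X w) (e w) ^+ 2 - sigma2| < u)) /\
  ((2 * Num.sqrt n%:R * (`|col_annihilator (X w) *m e w| /
      l2norm (col_annihilator (X w) *m e w)) <= lam n /\ c <= `|X w|) /\
   ((outlier_effect (X w) (al w) (lam n) < u /\ `|gram (X w) - Sigma| < u) /\
    dot (noise_score (X w) (e w)) (noise_score (X w) (e w)) < A)).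

(** The order of the quantifiers matters: [l] and [c] are built from [Sigma] and [K] alone, [A]
    depends on the probability [r], and the precision [u] remains free, to be chosen after them. *)
Lemma regular_sample_event : exists l c : R, [/\ 0 < l, 0 < c &
  forall r, 0 < r -> exists2 A : R, 0 < A &
    forall u, 0 < u -> with_prob P r (@regular_sample l c A u)].
Proof.
have [C C0 hC] := posdefmx_coercive Spd; pose j0 := Ordinal hK.
pose l := (2 * C)^-1; have l0 : 0 < l by rewrite invr_gt0 mulr_gt0.
have K2 : 0 < K%:R ^+ 2 :> R by rewrite exprn_gt0// ltr0n.
exists l, (Num.sqrt (Sigma j0 j0 / 2)); split => //.
  by rewrite sqrtr_gt0 divr_gt0// posdefmx_diag_gt0.
move=> r r0; have r2 : 0 < r / 2 by rewrite divr_gt0.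
have [A A0 hA] := noise_score_tight hSigma_fin hSigma hxeps heps2 mx meps indep law r2.
exists A => // u u0.
(* Closeness within [sigma2] rules out a zero noise level. One half of [m] is spent on the noise
   average, the other on the projection of the noise, of order [1 / n]. *)
pose m := Num.min u sigma2; have m0 : 0 < m by rewrite lt_min u0.
have m2 : 0 < m / 2 by rewrite divr_gt0.
(* The second term is the perturbation that [gram_ge] tolerates for the eigenvalue bound [l]. *)
pose k := Num.min u (l / K%:R ^+ 2); have k0 : 0 < k by rewrite lt_min u0 divr_gt0.
have h1 s (s0 : 0 < s) := gram_cvg hSigma_fin hSigma mx meps indep law k0 s0.
have h2 s (s0 : 0 < s) := noise_sqr_cvg heps2 mx meps indep law m2 s0.
have h3 s (s0 : 0 < s) := design_norm_ge hSigma_fin hSigma mx meps indep law j0 Spd s0.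
have h4 s (s0 : 0 < s) := outlier_effect_cvg u0 s0.
have h := with_prob_andW (with_prob_andW h1 h2)
  (with_prob_andW (with_prob_andW h3 h4) penalty_event) r2.
rewrite [r]splitr; apply: with_prob_sub (with_prob_and h hA).
near=> n; have n0 : (0 < n)%N by near: n; exact: nbhs_infty_gt.
have np : 0 < n%:R :> R by rewrite ltr0n.
have nA : A / l / n%:R < m / 2.
  rewrite ltr_pdivrMr// -ltr_pdivrMl// mulrC; near: n; exact: nbhs_infty_gtr.
move=> w [[[g1 g2] [[g3 g4] g5]] g6].
have eig b : l * dot b b <= dot b (gram (X w) *m b).
  apply: (gram_ge (hC b) C0); rewrite mulrC -ler_pdivlMr//.
  by rewrite (le_trans (ltW g1))// ge_min lexx orbT.
have q1 : `|noise_level (X w) (e w) ^+ 2 - sigma2| < m.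
  have a1 := noise_level_sqr (e w) n0 l0 eig.
  have a2 : dot (noise_score (X w) (e w)) (noise_score (X w) (e w)) / l / n%:R < m / 2.
    apply: lt_trans nA.
    have li : 0 < l^-1 by rewrite invr_gt0.
    have ni : 0 < n%:R^-1 :> R by rewrite invr_gt0.
    by rewrite (ltr_pM2r ni) (ltr_pM2r li).
  have a3 := le_lt_trans a1 a2.
  move: a3 g2; rewrite !ltr_norml; lra.
have qu : `|noise_level (X w) (e w) ^+ 2 - sigma2| < u.
  by rewrite (lt_le_trans q1)// ge_min lexx.
have q0 : 0 < noise_level (X w) (e w).
  rewrite lt_neqAle divr_ge0 ?l2norm_ge0// ?sqrtr_ge0// andbT eq_sym.
  apply/eqP => E; move: q1; rewrite E expr0n/= sub0r normrN gtr0_norm// ltNge.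
  by rewrite ge_min lexx orbT.
have gu : `|gram (X w) - Sigma| < u by rewrite (lt_le_trans g1)// ge_min lexx.
by split; split.
Unshelve. all: by end_near. Qed.

Let Z n (w : T n) : 'cV[R]_K := Num.sqrt n%:R *: (bhat w - beta).

(* u is chosen small enough for the hypotheses of the deterministic bounds *)
Let small (l c : R) : 0 < l -> 0 < c -> exists2 u0 : R, 0 < u0 &
  forall v : R, 0 <= v -> v <= u0 ->
    4 * K%:R * v ^+ 2 <= 3 / 4 * l /\ 8 * (v / c) ^+ 2 <= 1.
Proof.
move=> l0 c0; have K0 : 0 < K%:R :> R by rewrite ltr0n.
pose a := Num.min (3 / 4 * l / (4 * K%:R)) (c ^+ 2 / 8).
have a0 : 0 < a by rewrite lt_min !divr_gt0 ?mulr_gt0 ?exprn_gt0.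
exists (Num.sqrt a); first by rewrite sqrtr_gt0.
move=> v v0 vu; have va : v ^+ 2 <= a.
  by rewrite -[leRHS]sqr_sqrtr ?(ltW a0)// ler_pXn2r ?nnegrE ?sqrtr_ge0.
split.
  rewrite mulrC -ler_pdivlMr ?mulr_gt0// (le_trans va)//.
  by rewrite ge_min lexx.
rewrite expr_div_n mulrA ler_pdivrMr ?exprn_gt0// mul1r mulrC -ler_pdivlMr//.
by rewrite (le_trans va)// ge_min lexx orbT.
Qed.

Lemma scaled_error_tight r : 0 < r ->
  exists A : R, with_prob P r (fun n (w : T n) => `|Z w| <= A).
Proof.
move=> r0; have [l [c [l0 c0 h]]] := regular_sample_event.
have [A A0 hA] := h r r0; have [u0 u00 hu] := small l0 c0.
pose u := Num.min u0 1; have up : 0 < u by rewrite lt_min u00 ltr01.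
(* [A + 1] bounds the norm of the score, whose square is below [A], and [sigma2 + 2] bounds the
   noise level, whose square is below [sigma2 + 1]; these bounds spare square roots. *)
exists (K%:R * ((A + 1) + 192 * 1 * (sigma2 + 2)) / l).
apply: with_prob_sub (hA u up); apply: nearW => n w.
move=> [[[n0 eig] [q0 q1]] [[pen Xc] [[v1 g1] WA]]].
have v0 : 0 <= outlier_effect (X w) (al w) (lam n).
  by rewrite divr_ge0 ?mulr_ge0 ?sumr_ge0 ?(ltW (lam_gt0 n)).
have [s1 s2] : 4 * K%:R * outlier_effect (X w) (al w) (lam n) ^+ 2 <= 3 / 4 * l /\
    8 * (outlier_effect (X w) (al w) (lam n) / c) ^+ 2 <= 1.
  by apply: hu => //; rewrite (le_trans (ltW v1))// ge_min lexx.
have := scaled_error_norm_le (modelE w) n0 (lam_gt0 n) l0 c0 (@hmin n w) eig q0 pen Xc s1 s2.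
move/le_trans; apply.
rewrite ler_pM2r ?invr_gt0// ler_pM2l ?ltr0n//.
have u1 : u <= 1 by rewrite ge_min lexx orbT.
apply: lerD.
  have := le_lt_trans (norm_le_dot _) WA; have := normr_ge0 (noise_score (X w) (e w)).
  move: `|noise_score _ _| => z; nra.
apply: ler_pM => //; [by rewrite mulr_ge0|exact: ltW| |].
  by rewrite ler_pM2l// (le_trans (ltW v1)).
move: q1; move: (noise_level _ _) q0 => q q0; rewrite ltr_norml => /andP[_ q1].
nra.
Qed.

Lemma scaled_error_expansion_cvg a r : 0 < a -> 0 < r ->
  with_prob P r (fun n (w : T n) =>
    `|Z w - invmx Sigma *m noise_score (X w) (e w)| <= a).
Proof.
move=> a0 r0; have r2 : 0 < r / 2 by rewrite divr_gt0.
have [l [c [l0 c0 h]]] := regular_sample_event.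
have [A A0 hA] := h _ r2; have [u0 u00 hu] := small l0 c0.
have [B hB] := scaled_error_tight r2.
(* [B] comes from tightness and does not depend on [u]; hence [u] can be taken at most [a / D],
   which makes the whole bound at most [a]. *)
pose D := K%:R * `|invmx Sigma| * (K%:R * `|B| + 192 * (sigma2 + 2)) + 1.
have D0 : 0 < D.
  by rewrite ltr_wpDl// !mulr_ge0// addr_ge0 ?mulr_ge0// addr_ge0// ltW.
pose u := Num.min (Num.min u0 1) (a / D).
have up : 0 < u by rewrite !lt_min u00 ltr01 divr_gt0.
rewrite [r]splitr; apply: with_prob_sub (with_prob_and (hA u up) hB); apply: nearW => n w.
move=> [[[[n0 eig] [q0 q1]] [[pen Xc] [[v1 g1] WA]]] ZB].
have v0 : 0 <= outlier_effect (X w) (al w) (lam n).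
  by rewrite divr_ge0 ?mulr_ge0 ?sumr_ge0 ?(ltW (lam_gt0 n)).
have [s1 s2] : 4 * K%:R * outlier_effect (X w) (al w) (lam n) ^+ 2 <= 3 / 4 * l /\
    8 * (outlier_effect (X w) (al w) (lam n) / c) ^+ 2 <= 1.
  by apply: hu => //; rewrite (le_trans (ltW v1))// !ge_min lexx.
have := scaled_error_expansion (modelE w) n0 (lam_gt0 n) l0 c0 (@hmin n w) eig q0 pen Xc
  s1 s2 Spd.
move/le_trans; apply.
have u1 : u <= 1 by rewrite !ge_min lexx !orbT.
have uD : u * D <= a by rewrite -ler_pdivlMr// ge_min lexx orbT.
have hq : noise_level (X w) (e w) <= sigma2 + 2.
  move: q1; move: (noise_level _ _) q0 => q q0; rewrite ltr_norml => /andP[_ q1].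
  nra.
apply: (@le_trans _ _ (K%:R * `|invmx Sigma| *
    (K%:R * (u * `|B|) + 192 * u * (sigma2 + 2)))).
  rewrite ler_wpM2l ?mulr_ge0// lerD//.
    by rewrite ler_wpM2l// ler_pM// ?(ltW g1)// (le_trans ZB)// ler_norm.
  apply: ler_pM => //; [by rewrite mulr_ge0|exact: ltW|].
  by rewrite ler_wpM2l// ltW.
apply: le_trans uD; rewrite /D [leRHS]mulrDr mulr1.
have -> : K%:R * `|invmx Sigma| * (K%:R * (u * `|B|) + 192 * u * (sigma2 + 2)) =
  u * (K%:R * `|invmx Sigma| * (K%:R * `|B| + 192 * (sigma2 + 2))) by ring.
by rewrite lerDl ltW.
Qed.

Let mZ n : measurable_fun setT (@Z n).
Proof.
apply: measurable_scalemx; first exact: measurable_cst.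
by apply: measurable_addmx => //; exact: measurable_cst.
Qed.

Lemma scaled_error_normal :
  cvg_in_distribution P Z (mvnormal 0 (sigma2 *: invmx Sigma)).
Proof.
apply: (cvg_in_distribution_cos mZ) => [t s|]; last exact: scaled_error_tight.
rewrite mean_cos_mvnormal; last exact/posdefmx_scale/posdefmx_invmx.
have clt := noise_score_clt hSigma_fin hSigma hxeps heps2 mx meps indep law (t := t) (s := s) Spd.
apply/cvgrPdist_le => a a0.
(* Budget: [a / 3] for the distance of the cosines on the good event, [2 (a / 6)] off it, and
   [a / 3] for the central limit theorem. A distance [b] between the vectors moves [dot t] by at
   most [a / 3]. *)
have a3 : 0 < a / 3 by rewrite divr_gt0.
have a6 : 0 < a / 6 by rewrite divr_gt0.
pose b := a / 3 / (l1norm t + 1).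
have b0 : 0 < b by rewrite divr_gt0// ltr_wpDl// l1norm_ge0.
have mY n : measurable_fun setT (fun w : T n => invmx Sigma *m noise_score (X w) (e w)).
  by apply: measurable_mulmx; [exact: measurable_cst|exact: measurable_noise_score].
have D := with_prob_mean_dist (P := P) (M := 1) (ltW a3) ler01
  (fun n => measurable_cos_dot t s (@mZ n)) (fun n => measurable_cos_dot t s (mY n))
  (fun n w => cos_max _) (fun n w => cos_max _).
have hD : with_prob P (a / 6) (fun n (w : T n) => `|cos (dot t (Z w) + s) -
    cos (dot t (invmx Sigma *m noise_score (X w) (e w)) + s)| <= a / 3).
  apply: with_prob_sub (scaled_error_expansion_cvg b0 a6); apply: nearW => n w hw.
  rewrite (le_trans (norm_cosB_le _ _))//.
  rewrite opprD addrACA subrr addr0 -dotBr dotC (le_trans (norm_dot_le _ _))//.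
  rewrite (le_trans (ler_wpM2r (l1norm_ge0 t) hw))// /b mulrAC ler_pdivrMr.
    by rewrite ler_pM2l// lerDl.
  by rewrite ltr_wpDl// l1norm_ge0.
move/cvgrPdist_le: clt => /(_ _ a3); apply: filterS2 (D _ hD) => n.
rewrite !ler_norml; lra.
Qed.

Lemma residual_variance_cvg a r : 0 < a -> 0 < r ->
  with_prob P r (fun n (w : T n) =>
    `|(l2norm (Y w - X w *m bhat w - ahat w) / Num.sqrt n%:R) ^+ 2 - sigma2| < a).
Proof.
move=> a0 r0; have [l [c [l0 c0 h]]] := regular_sample_event.
have [A A0 hA] := h r r0; have [u0 u00 hu] := small l0 c0.
pose D := 192 / c ^+ 2 * (sigma2 + 2); have D0 : 0 < D.
  by rewrite mulr_gt0 ?divr_gt0 ?exprn_gt0// ltr_wpDl// ltW.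
(* If [z] is within [g <= 1] of [q], then [z + q] is at most [1 + 2 q], so [z ^ 2] is within [a / 2]
   of [q ^ 2]. The constraint [u <= 1] below turns the squared outlier effect into a linear
   bound. *)
pose g := Num.min 1 (a / 2 / (1 + 2 * (sigma2 + 2))).
have s4 : 0 < 1 + 2 * (sigma2 + 2) by have := sigma2_gt0; lra.
have g0 : 0 < g by rewrite lt_min ltr01 divr_gt0// divr_gt0.
pose u := Num.min (Num.min u0 1) (Num.min (a / 2) (g / D)).
have up : 0 < u by rewrite !lt_min u00 ltr01 !divr_gt0.
apply: with_prob_sub (hA u up); apply: nearW => n w.
move=> [[[n0 eig] [q0 q1]] [[pen Xc] [[v1 g1] WA]]].
have v0 : 0 <= outlier_effect (X w) (al w) (lam n).
  by rewrite divr_ge0 ?mulr_ge0 ?sumr_ge0 ?(ltW (lam_gt0 n)).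
have [s1 s2] : 4 * K%:R * outlier_effect (X w) (al w) (lam n) ^+ 2 <= 3 / 4 * l /\
    8 * (outlier_effect (X w) (al w) (lam n) / c) ^+ 2 <= 1.
  by apply: hu => //; rewrite (le_trans (ltW v1))// !ge_min lexx.
have := residual_level_le (modelE w) n0 (lam_gt0 n) l0 c0 (@hmin n w) eig q0 pen Xc s1 s2.
have u1 : u <= 1 by rewrite !ge_min lexx !orbT.
have ua : u <= a / 2 by rewrite !ge_min lexx !orbT.
have uD : u * D <= g by rewrite -ler_pdivlMr// !ge_min lexx !orbT.
have hq : noise_level (X w) (e w) <= sigma2 + 2.
  move: q1; move: (noise_level _ _) q0 => q q0; rewrite ltr_norml => /andP[_ q1].
  nra.
have bound : 192 * (outlier_effect (X w) (al w) (lam n) / c) ^+ 2 *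
    noise_level (X w) (e w) <= g.
  move: (noise_level _ _) q0 hq => q q0' hq'.
  apply: le_trans uD; rewrite /D expr_div_n.
  rewrite [leRHS](_ : _ = 192 * (u / c ^+ 2) * (sigma2 + 2)); last by ring.
  apply: ler_pM => //; [by rewrite mulr_ge0// divr_ge0// sqr_ge0|exact: ltW|].
  rewrite ler_pM2l// ler_pM2r ?invr_gt0 ?exprn_gt0//.
  move: v0 v1; move: (outlier_effect _ _ _) => v v0 v1; nra.
move=> /le_trans /(_ bound).
move: (l2norm _ / _) (noise_level _ _) q0 q1 hq => z q q0 q1 hq zq.
have g1' : g <= 1 by rewrite ge_min lexx.
have gs : g * (1 + 2 * (sigma2 + 2)) <= a / 2.
  by rewrite -ler_pdivlMr// ge_min lexx orbT.
have zz : `|z ^+ 2 - q ^+ 2| <= a / 2.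
  rewrite subr_sqr normrM; apply: le_trans gs; apply: ler_pM => //.
  rewrite (_ : z + q = (z - q) + 2 * q); last by ring.
  rewrite (le_trans (ler_normD _ _))// lerD ?(le_trans zq)//.
  by rewrite ger0_norm ?mulr_ge0 ?(ltW q0)// ler_pM2l.
move: zz (lt_le_trans q1 ua); rewrite ler_norml !ltr_norml; lra.
Qed.

End SquareRootLassoEstimator.

Theorem theorem2p3 (R : realType) (K : nat) (hK : (1 <= K)%N)
    (beta : 'cV[R]_K) (sigma2 : R) (hsigma2 : 0 < sigma2)
    (* joint law of (x_i, eps_i), and its moments *)
    (Q : probability ('cV[R]_K * R)%type R) (Sigma : 'M[R]_K)
    (hSigma_fin : forall j k,
       Q.-integrable setT (fun z => (z.1 j 0 * z.1 k 0)%:E))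
    (hSigma : forall j k,
       'E_Q[fun z => z.1 j 0 * z.1 k 0] = (Sigma j k)%:E)
    (hSigma_pd : posdefmx Sigma)
    (hxeps : forall j, 'E_Q[fun z => z.1 j 0 * z.2] = 0%E)
    (heps : 'E_Q[fun z => z.2] = 0%E)
    (heps2 : is_cond_expectation Q (fun z => z.2 ^+ 2) fst (fun=> sigma2))
    (* the sample of size n *)
    (d : nat -> measure_display) (T : forall n, measurableType (d n))
    (P : forall n, probability (T n) R)
    (x : forall n, 'I_n -> {RV (P n) >-> 'cV[R]_K})
    (eps : forall n, 'I_n -> {RV (P n) >-> R})
    (alpha : forall n, 'I_n -> {RV (P n) >-> R})
    (y : forall n, 'I_n -> T n -> R)
    (hy : forall n i w,
       y n i w = ((x n i w)^T *m beta) 0 0 + alpha n i w + eps n i w)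
    (hyx_iid : forall n, iid (P n) (fun i w => (y n i w, x n i w)))
    (hxeps_iid : forall n, iid (P n) (fun i w => (x n i w, eps n i w)))
    (hxeps_law : forall n i, has_law (P n) (fun w => (x n i w, eps n i w)) Q)
    (p : nat -> R)
    (hp : forall n i, P n [set w | alpha n i w != 0] = (p n)%:E)
    (hp_range : forall n, 0 <= p n < 1 / 2)
    (hp_lim : p n @[n --> \oo] --> 0)
    (X : forall n, T n -> 'M[R]_(n, K))
    (hX : forall n w, X n w = design_mx (fun i => x n i w))
    (* penalty level *)
    (lam : nat -> R) (hlam : forall n, 0 < lam n)
    (hlam_lim :
       P n [set w |
         let Me := col_annihilator (X n w) *m \col_i eps n i w in
         2 * Num.sqrt n%:R * (`|Me| / l2norm Me) <= lam n]
         @[n --> \oo] --> 1%E)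
    (hrate1 : cvg_in_probability P
       (fun n w => p n * lam n * `|X n w| * Num.sqrt n%:R : R^o) 0)
    (hrate2 : cvg_in_probability P
       (fun n w => p n * Num.max (lam n) (Num.sqrt `|X n w|) : R^o) 0)
    (* estimators *)
    (bhat : forall n, {RV (P n) >-> 'cV[R]_K})
    (ahat : forall n, {RV (P n) >-> 'cV[R]_n})
    (hmin : forall n w (b : 'cV[R]_K) (a : 'cV[R]_n),
       sqrt_lasso_obj (lam n) (\col_i y n i w) (X n w) (bhat n w) (ahat n w) <=
       sqrt_lasso_obj (lam n) (\col_i y n i w) (X n w) b a) :
  [/\ cvg_in_distribution P
        (fun n w => Num.sqrt n%:R *: (bhat n w - beta))
        (mvnormal 0 (sigma2 *: invmx Sigma)),
      cvg_in_probability P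
        (fun n w => n%:R^-1 * \sum_(i < n)
           (y n i w - ((x n i w)^T *m bhat n w) 0 0 - ahat n w i 0) ^+ 2 : R^o)
        sigma2 &
      cvg_in_probability P
        (fun n w => n%:R^-1 *: \sum_(i < n) (x n i w *m (x n i w)^T))
        Sigma].
Proof.
(* The random variables are unbundled into plain functions with separate measurability facts, the
   form used by the preceding sections. *)
pose xf n (i : 'I_n) (w : T n) : 'cV[R]_K := x n i w.
pose ef n (i : 'I_n) (w : T n) : R := eps n i w.
pose af n (i : 'I_n) (w : T n) : R := alpha n i w.
pose bf n (w : T n) : 'cV[R]_K := bhat n w.
pose hf n (w : T n) : 'cV[R]_n := ahat n w.
have XE : X = fun n (w : T n) => design xf w.
  by apply: functional_extensionality_dep => n; apply/funext => w; rewrite hX.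
subst X; clear hX.
have mx n i : measurable_fun setT (@xf n i) by exact: measurable_funPT.
have me n i : measurable_fun setT (@ef n i) by exact: measurable_funPT.
have ma n i : measurable_fun setT (@af n i) by exact: measurable_funPT.
have mb n : measurable_fun setT (@bf n) by exact: measurable_funPT.
have mh n : measurable_fun setT (@hf n) by exact: measurable_funPT.
have my n i : measurable_fun setT (y n i).
  rewrite (_ : y n i = fun w => dot (xf n i w) beta + af n i w + ef n i w).
    apply: measurable_funD => //; apply: measurable_funD => //.
    by under eq_fun do rewrite dotC; exact: measurable_dot.
  by apply/funext => w; rewrite hy dotE.
have indep n : mutually_independent (P n) (fun (i : 'I_n) w => (xf n i w, ef n i w)).
  by have [] := hxeps_iid n.
split.
- exact: (scaled_error_normal hK hsigma2 hSigma_fin hSigma hSigma_pd hxeps heps2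
    mx me ma hy indep hxeps_law hp hlam hlam_lim hrate1 mb hmin).
(* The variance estimator is the square of the normalized residual norm. *)
- rewrite (_ : (fun n w => _) = fun n w =>
    (l2norm (noise y w - design xf w *m bf n w - hf n w) / Num.sqrt n%:R) ^+ 2 : R^o);
    last first.
    apply: functional_extensionality_dep => n; apply/funext => w.
    rewrite expr_div_n l2norm_sqr sqr_sqrtr// mulrC; congr (_ * _).
    apply: eq_bigr => i _; rewrite -expr2.
    have -> : (noise y w - design xf w *m bf n w - hf n w) i 0 =
        y n i w - ((x n i w)^T *m bhat n w) 0 0 - ahat n w i 0.
      rewrite !mxE; congr (_ - _ - _); apply: eq_bigr => j _; by rewrite !mxE.
    by [].
  apply: with_prob_cvg_in_probability => [n|e r e0 r0].
    apply: measurableT_comp (@normr_measurable _ _) _.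
    apply: measurable_funB => //; apply: measurable_funX; apply: measurable_funM => //.
    apply: measurable_l2norm; apply: measurable_addmx; last exact: measurable_oppmx.
    apply: measurable_addmx; first exact: measurable_noise.
    by apply: measurable_oppmx; apply: measurable_mulmx => //; exact: measurable_design.
  exact: (residual_variance_cvg hK hsigma2 hSigma_fin hSigma hSigma_pd hxeps heps2
    mx me ma hy indep hxeps_law hp hlam hlam_lim hrate1 hmin).
- rewrite (_ : (fun n w => _) = fun n w => gram (design xf (w : T n))); last first.
    apply: functional_extensionality_dep => n; apply/funext => w.
    apply/matrixP => j k; rewrite gram_design mxE summxE; congr (_ * _).
    by apply: eq_bigr => i _; rewrite mxE big_ord1 mxE.
  apply: with_prob_cvg_in_probability => [n|e r e0 r0].
    apply: measurable_mx_norm; apply: measurable_addmx; last exact: measurable_cst.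
    apply: measurable_scalemx; first exact: measurable_cst.
    by apply: measurable_mulmx; [apply: measurable_trmx|]; exact: measurable_design.
  exact: (gram_cvg hSigma_fin hSigma mx me indep hxeps_law).
Qed.
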